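(* Let $d=1$, let $W$ be an admissible interaction potential, let $\mu^0\in\mathscr{P}$, and let $\mu$ be the gradient flow solution of the interaction system with initial datum $\mu^0$. Assume that $\mu$ is uniformly confined, i.e. there exists $K>0$ such that $\operatorname{supp}\mu_i(t)\subset[-K,K]$ for all $t\ge0$ and all $i\in\{1,\ldots,n\}$. Moreover, suppose that the maps $W_{ij}'$ are Lipschitz-continuous on the interval $[-2K,2K]$ for all $i,j\in\{1,\ldots,n\}$. Set $\mathcal{W}^t:=\mathcal{W}(\mu(t))$ for $t\ge0$. Then the following holds: (a) There exists $\mathcal{W}^\infty\in\mathbb{R}$ such that $\lim_{t\to\infty}\mathcal{W}^t=\mathcal{W}^\infty$, and $\lim_{t\to\infty}\left(\frac{\mathrm{d}}{\mathrm{d}t}\mathcal{W}^t\right)=0$. (b) For each sequence $(t_k)_{k\in\mathbb{N}}$ in $(0,\infty)$ with $t_k\to\infty$ as $k\to\infty$, there exist a subsequence $(t_{k_l})_{l\in\mathbb{N}}$ and a steady state $\overline\mu\in\mathscr{P}$ of the interaction system such that for all $i\in\{1,\ldots,n\}$: $$\lim_{l\to\infty}\mathbf{W}_1(\mu_i(t_{k_l}),\overline\mu_i)=0.$$ Thus, the $\omega$-limit set can only contain steady states of the interaction system.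
   Context: Spatial dimension $d=1$. Let $n\in\mathbb{N}$, $m_1,\ldots,m_n>0$, $p_1,\ldots,p_n>0$, $E\in\mathbb{R}$ be fixed. Admissible interaction potential: a map $W:\mathbb{R}\to\mathbb{R}^{n\times n}$ such that $W(z)$ is a symmetric matrix for each $z$; $W_{ij}\in C^1(\mathbb{R};\mathbb{R})$ for all $i,j$; $W(z)=W(-z)$ for all $z$; there is a matrix $\overline W\in\mathbb{R}^{n\times n}$ with $|W_{ij}(z)|\le\overline W_{ij}(1+|z|^2)$ for all $z,i,j$; and there is a symmetric matrix $\kappa\in\mathbb{R}^{n\times n}$ such that $z\mapsto W_{ij}(z)-\frac12\kappa_{ij}|z|^2$ is convex for all $i,j$. Interaction system: $\partial_t\mu_i=\partial_x\big[m_i\mu_i\,\partial_x\big(\sum_{j=1}^nW_{ij}*\mu_j\big)\big]$, $i=1,\ldots,n$; it holds in the sense of distributions if for all $i$ and all $\varphi\in C_c^\infty((0,\infty)\times\mathbb{R})$: $\int_0^\infty\int_{\mathbb{R}}\big(\partial_t\varphi(t,x)-m_i\partial_x\varphi(t,x)\sum_{j=1}^n\int W_{ij}'(x-y)\,\mathrm{d}\mu_j(t,y)\big)\mathrm{d}\mu_i(t,x)\,\mathrm{d}t=0$. A steady state is an element of $\mathscr{P}$ which, as a constant curve in time, solves the interaction system in the sense of distributions. $\mathscr{P}$ is the set of $n$-tuples $\mu=(\mu_1,\ldots,\mu_n)$ of nonnegative Borel measures on $\mathbb{R}$ with $\mu_j(\mathbb{R})=p_j$, finite second moments, and $\sum_{j=1}^n\frac1{m_j}\int_{\mathbb{R}}x\,\mathrm{d}\mu_j(x)=E$,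 with the distance $$\mathbf{W}_{\mathscr{P}}(\mu^0,\mu^1)=\Big[\sum_{j=1}^n\frac1{m_j}\inf\Big\{\int|x-y|^2\,\mathrm{d}\gamma_j(x,y):\gamma_j\in\Gamma(\mu^0_j,\mu^1_j)\Big\}\Big]^{1/2},$$ where $\Gamma(\mu^0_j,\mu^1_j)$ is the set of finite Borel measures on $\mathbb{R}\times\mathbb{R}$ with marginals $\mu_j^0,\mu_j^1$. The interaction energy is $\mathcal{W}(\mu)=\frac12\sum_{i,j=1}^n\int\int W_{ij}(x-y)\,\mathrm{d}\mu_i(x)\,\mathrm{d}\mu_j(y)$. For finite measures $\alpha,\beta$ on $\mathbb{R}$ of equal mass, $\mathbf{W}_1(\alpha,\beta)=\inf\{\int|x-y|\,\mathrm{d}\gamma:\gamma\in\Gamma(\alpha,\beta)\}$ is the $L^1$-Wasserstein distance. $AC^2_{\mathrm{loc}}([0,\infty);(X,\mathbf{d}))$ is the set of curves $\mu:[0,\infty)\to X$ such that for each $T>0$ there is $\varphi\in L^2([0,T])$ with $\mathbf{d}(\mu(s),\mu(t))\le\int_s^t\varphi(r)\,\mathrm{d}r$ for $0\le s\le t\le T$. The gradient flow solution with initial datum $\mu^0\in\mathscr{P}$ is the (existing and unique) curve in $AC^2_{\mathrm{loc}}([0,\infty);(\mathscr{P},\mathbf{W}_{\mathscr{P}}))$ with $\mu(0)=\mu^0$ for which the interaction system holds in the sense of distributions. The $\omega$-limit set consists of all $\nu\in\mathscr{P}$ for which there is a sequence $t_k\to\infty$ with $\mathbf{W}_1(\mu_i(t_k),\nu_i)\to0$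 for all $i$. *)

(* Defs.v *)
From mathcomp Require Import all_boot all_order all_algebra.
From mathcomp Require Import all_classical all_reals all_analysis.

Set Implicit Arguments.
Unset Strict Implicit.
Unset Printing Implicit Defensive.

Import Order.TTheory GRing.Theory Num.Theory.
Import numFieldNormedType.Exports.

Local Open Scope classical_set_scope.
Local Open Scope ring_scope.

Notation borel_measure R := {measure set (measurableTypeR R) -> \bar R%type}.
Notation borel_measure2 R :=
  {measure set (measurableTypeR R * measurableTypeR R)%type -> \bar R%type}.

Section potentials.
Context {R : realType} {n : nat}.
Implicit Types W : R -> 'M[R]_n.

Definition W_entry W (i j : 'I_n) : R -> R := fun z => W z i j.

Definition admissible_potential W : Prop :=
  [/\ (forall z, (W z)^T = W z),
      (forall i j, (forall z, derivable (W_entry W i j) z 1) /\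
                   continuous (derive1 (W_entry W i j))),
      (forall z, W z = W (- z)),
      (exists Wbar : 'M[R]_n, forall z i j,
          `|W z i j| <= Wbar i j * (1 + `|z| ^+ 2)) &
      (exists2 kappa : 'M[R]_n, kappa^T = kappa &
        forall i j, convex_function (setT : set R^o)
          (fun z : R^o => W z i j - 2^-1 * kappa i j * `|z| ^+ 2 : R^o))].

End potentials.

Section state_space.
Context {R : realType} {n : nat}.
Implicit Types (m p : 'I_n -> R) (E : R) (mu nu : 'I_n -> borel_measure R).

(* The integrals in the last clause are real numbers because of the finite
   mass and the finite second moments. *)
Definition in_P m p E mu : Prop :=
  [/\ (forall j, mu j setT = (p j)%:E),
      (forall j, (\int[mu j]_x ((x : R) ^+ 2)%:E < +oo)%E) &
      \sum_j (m j)^-1 * \int[mu j]_x (x : R) = E].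

Definition coupling (alpha beta : borel_measure R) : set (borel_measure2 R) :=
  [set gamma | forall A : set (measurableTypeR R), measurable A ->
     gamma (A `*` setT) = alpha A /\ gamma (setT `*` A) = beta A].

Definition transport_cost (c : R -> R -> R) (alpha beta : borel_measure R)
    : \bar R :=
  ereal_inf [set (\int[gamma]_z (c z.1 z.2)%:E)%E
            | gamma in coupling alpha beta].

Definition dist_W1 : borel_measure R -> borel_measure R -> \bar R :=
  transport_cost (fun x y => `|x - y|).

Definition dist_P m mu nu : \bar R :=
  ((\sum_j (m j)^-1%:E *
     transport_cost (fun x y => `|x - y| ^+ 2)%R (mu j) (nu j)) `^ 2^-1)%E.

Definition msupport (alpha : borel_measure R) : set R :=
  [set x | forall e : R, 0 < e -> (0 < alpha (ball x e))%E].

(* For an admissible [W] and [mu] with finite mass and second moments all the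
   integrals are finite, so that the real-valued integral is the intended
   one. *)
Definition interaction_energy (W : R -> 'M[R]_n) mu : R :=
  2^-1 * \sum_i \sum_j
    \int[mu j]_y (\int[mu i]_x (W ((x : R) - (y : R)) i j)).

End state_space.

Section test_functions.
Context {R : realType}.
Implicit Type phi : R * R -> R.

Definition partial_t phi : R * R -> R :=
  fun z => derive1 (fun s : R => phi (s, z.2)) z.1.

Definition partial_x phi : R * R -> R :=
  fun z => derive1 (fun y : R => phi (z.1, y)) z.2.

Fixpoint iter_partial (w : seq bool) phi : R * R -> R :=
  if w is b :: w' then
    (if b then partial_x else partial_t) (iter_partial w' phi)
  else phi.

Definition smooth2 phi : Prop :=
  forall w : seq bool,
    [/\ continuous (iter_partial w phi),
        (forall z, derivable (fun s : R => iter_partial w phi (s, z.2)) z.1 1) &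
        (forall z, derivable (fun y : R => iter_partial w phi (z.1, y)) z.2 1)].

(* An element of C_c^oo((0,oo) x R) is represented by its extension by zero to
   R x R. *)
Definition test_function phi : Prop :=
  let supp := closure [set z | phi z != 0] in
  [/\ smooth2 phi, compact supp & supp `<=` [set z | 0 < z.1]].

End test_functions.

Section dynamics.
Context {R : realType} {n : nat}.
Implicit Types (m p : 'I_n -> R) (E : R) (W : R -> 'M[R]_n)
  (mu : R -> 'I_n -> borel_measure R).

(* Curves on [0,oo) are functions on R whose values at negative times are
   irrelevant.  Semiconvexity and quadratic growth of [W_ij] force linear growth
   of [W_ij'], so its integral against a measure with finite mass and second
   moment is finite, as is the remaining one for a test function [phi]. *)
Definition distributional_solution m W mu : Prop :=
  forall (i : 'I_n) (phi : R * R -> R), test_function phi ->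
    (\int[lebesgue_measure]_(t in `]0%R, +oo[)
       \int[mu t i]_x
         (partial_t phi (t, x) - m i * partial_x phi (t, x) *
            \sum_j \int[mu t j]_y (derive1 (W_entry W i j) ((x : R) - (y : R)))%R
         )%R%:E = 0)%E.

Definition steady_state m p E W (nu : 'I_n -> borel_measure R) : Prop :=
  in_P m p E nu /\ distributional_solution m W (fun=> nu).

Definition AC2_loc m p E mu : Prop :=
  (forall t, 0 <= t -> in_P m p E (mu t)) /\
  forall T, 0 < T -> exists f : R -> R,
    [/\ measurable_fun (`[0, T] : set (measurableTypeR R)) f,
        (\int[lebesgue_measure]_(r in `[0%R, T]) ((f r) ^+ 2)%:E < +oo)%E &
        forall s t, 0 <= s -> s <= t -> t <= T ->
          (dist_P m (mu s) (mu t) <=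
             \int[lebesgue_measure]_(r in `[s, t]) (f r)%:E)%E].

(* Measures are functions on all sets, hence the initial condition is an
   equality on Borel sets only. *)
Definition gradient_flow_solution m p E W
    (mu0 : 'I_n -> borel_measure R) mu : Prop :=
  [/\ AC2_loc m p E mu,
      (forall i (A : set (measurableTypeR R)), measurable A ->
          mu 0 i A = mu0 i A) &
      distributional_solution m W mu].

Definition omega_limit m p E mu : set ('I_n -> borel_measure R) :=
  [set nu | in_P m p E nu /\
    exists t : nat -> R,
      [/\ (forall k, 0 <= t k), t k @[k --> \oo] --> +oo &
          forall i, dist_W1 (mu (t k) i) (nu i) @[k --> \oo] --> 0%E]].

End dynamics.

(* Main.v *)
Require Import Defs.
From mathcomp Require Import all_boot all_order all_algebra.
From mathcomp Require Import all_classical all_reals all_analysis.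
From mathcomp Require Import measurable_realfun ring lra.

Set Implicit Arguments.
Unset Strict Implicit.
Unset Printing Implicit Defensive.

Import Order.TTheory GRing.Theory Num.Theory.
Import numFieldNormedType.Exports.

Local Open Scope classical_set_scope.
Local Open Scope ring_scope.

(** On test functions supported in [-K, K] the weak equation says that
    t |-> \int f d mu_i(t) has derivative - \int f' V_i(t) d mu_i(t), where
    V_i = m_i \sum_j W_ij' * mu_j, first for smooth f and, by approximation, for f
    of class C^1 with Lipschitz derivative.  Taking f Lipschitz shows that mu_i is
    Lipschitz in time for the distance dual to Lipschitz functions; taking for f the
    potentials \sum_j W_ij * mu_j shows that the energy e satisfies
    |e(t) - e(s) + D(mu(s)) (t - s)| <= A (t - s)^2 with the dissipation
    D(mu) = \sum_i 1/m_i \int V_i^2 d mu_i >= 0.  Hence e is nonincreasing and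
    bounded below, e' = - D(mu(t)), and D(mu(t)) -> 0.

    D is continuous for W_1 on confined measures, so D vanishes at every limit point
    nu.  Then V_i = 0 holds nu_i-almost everywhere and nu is a steady state.
    Compactness of the trajectory is obtained from the quantile functions of the
    mu_i(t): they are monotone with values in [-K, K], so by Tychonoff's theorem they
    have a pointwise cluster point, and for monotone functions closeness on a fine
    grid controls the L^1 distance, hence W_1. *)

(** * Calculus and smooth approximation *)

Section Calculus.
Context {R : realType}.
Implicit Types (f g q : R -> R) (x y z a b c : R).

(** The curve is absolutely continuous for a transport distance, which by itself yields continuity
    in time without a rate. A quadratic error in the energy expansion needs more: the flux at an
    intermediate time must differ from the flux at [s] by O(|t - s|). Hence Lipschitz dependence on
    time is extracted from the equation before the energy is touched. The next obstacle is
    regularity: [W'] is merely Lipschitz on [-2K, 2K], where the differences of two points of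
    [-K, K] lie, so the potentials need not be smooth and have to be approximated in C^1.

    The remainder of the expansion does two jobs: it proves differentiability of the energy, and it
    makes a large dissipation cost a definite amount of energy over a fixed time span, without any
    derivative of the dissipation. Of the theory of W_1 only two one-sided bounds enter: W_1
    controls integrals of Lipschitz functions, and the L^1 distance of quantile functions controls
    W_1. *)

Lemma derivable_cont f : (forall x, derivable f x 1) -> continuous f.
Proof.
by move=> df x; apply: differentiable_continuous; apply/derivable1_diffP.
Qed.

Lemma is_derive_derive1 f x : derivable f x 1 -> is_derive x 1 f (derive1 f x).
Proof. by move=> df; split => //; rewrite derive1E. Qed.

Lemma derive1_is_derive f (x d : R) : is_derive x 1 f d -> derive1 f x = d.
Proof. by move=> h; rewrite derive1E derive_val. Qed.

Lemma mvt f (a b : R) : a < b -> (forall x, derivable f x 1) ->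
  exists c, [/\ a < c, c < b & f b - f a = derive1 f c * (b - a)].
Proof.
move=> ab df.
have [x _||c] := @MVT R f (derive1 f) a b ab.
- exact/is_derive_derive1.
- exact/continuous_subspaceT/derivable_cont.
by rewrite in_itv /= => /andP[ac cb] e; exists c.
Qed.

Lemma mvt_bound f (a b x y M : R) : (forall x, derivable f x 1) ->
  (forall z, a <= z <= b -> `|derive1 f z| <= M) ->
  a <= x <= b -> a <= y <= b -> `|f x - f y| <= M * `|x - y|.
Proof.
move=> df fM; wlog xy : x y / x < y => [wl xab yab|/andP[ax xb] /andP[ay yb]].
  have [xy|yx|->] := ltgtP x y; first exact: wl.
    by rewrite distrC [`|x - y|]distrC; exact: wl.
  by rewrite !subrr normr0 mulr0.
have [c [xc cy e]] := mvt xy df.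
rewrite distrC e normrM [`|x - y|]distrC ler_wpM2r// fM//.
by rewrite (le_trans ax (ltW xc)) (le_trans (ltW cy) yb).
Qed.

Lemma eq_near_derive f g (x d : R) :
  (\forall y \near x, f y = g y) -> is_derive x 1 g d -> is_derive x 1 f d.
Proof.
move=> fg dg.
have gf : {near x, g =1 f} by near=> y; apply/esym; near: y.
exact: near_eq_is_derive gf dg.
Unshelve. all: by end_near. Qed.

(** The fundamental theorem applies to integrals from a fixed left end. The primitives starting at
    [- n], normalised to vanish at 0, agree where both are valid and are glued to a primitive on the
    whole line. *)
Lemma continuous_primitive q : continuous q ->
  exists Q : R -> R, forall x : R, is_derive x 1 Q (q x).
Proof.
move=> cq.
pose F (n : nat) (x : R) : R :=
  \int[lebesgue_measure]_(t in `[(- n%:R : R), x]) q t.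
have dF (n : nat) (x : R) : - n%:R < x -> is_derive x 1 (F n) (q x).
  move=> nx.
  have [||||d e] := @continuous_FTC1_closed R q (- n%:R) x (x + 1).
  - by rewrite ltrDl.
  - apply: continuous_compact_integrable; first exact: segment_compact.
    exact/continuous_subspaceT.
  - by [].
  - exact: cq.
  by rewrite -e; exact: is_derive_derive1.
pose G n x := F n x - F n 0.
have dG (n : nat) (x : R) : - n%:R < x -> is_derive x 1 (G n) (q x).
  by move=> nx; rewrite -[q x]subr0; apply: is_deriveB; exact: dF.
have GG (n k : nat) (x : R) : - n%:R < x -> (0 < n)%N -> G (n + k)%N x = G n x.
  move=> nx n0.
  have key (a b y z : R) : a <= y -> y <= z -> z <= b -> - n%:R < a ->
      G (n + k)%N z - G n z = G (n + k)%N y - G n y.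
    move=> ay yz zb na.
    have dH (u : R) : a <= u -> is_derive u 1 (fun x => G (n + k)%N x - G n x) 0.
      move=> au; rewrite -(subrr (q u)); apply: is_deriveB; apply: dG.
        rewrite (le_lt_trans _ (lt_le_trans na au))// lerN2 ler_nat.
        exact: leq_addr.
      exact: lt_le_trans na au.
    have [||c _] := @MVT_segment R (fun x => G (n + k)%N x - G n x) (fun=> 0) y z yz.
    - move=> u; rewrite in_itv/= => /andP[yu uz]; apply: dH.
      exact: le_trans ay (ltW yu).
    - apply: continuous_in_subspaceT => u; rewrite inE/= in_itv/= => /andP[yu uz].
      apply: differentiable_continuous; apply/derivable1_diffP.
      by have [] := dH u (le_trans ay yu).
    by rewrite mul0r => /eqP; rewrite subr_eq0 => /eqP.
  have G0 (j : nat) : G j 0 = 0 by rewrite /G subrr.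
  have n0' : - n%:R < 0 :> R by rewrite oppr_lt0 ltr0n.
  apply/eqP; rewrite -subr_eq0; apply/eqP.
  have [x0|x0] := leP x 0.
    by rewrite -(key x 0 x 0)// !G0 subrr.
  by rewrite (key 0 x 0 x)// ?(ltW x0)// !G0 subrr.
pose N (x : R) := (Num.truncn `|x|).+1.
have NP x : - (N x)%:R < x.
  have : `|x| < (N x)%:R by rewrite truncnS_gt.
  by rewrite ltr_norml => /andP[].
exists (fun x => G (N x) x) => x.
(* [L] dominates [N y] for every [y] within 1 of [x], so near [x] the glued function is the single
   primitive [G L]. *)
pose L := N (`|x| + 1).
apply: (@eq_near_derive _ (G L)); last first.
  apply: dG; have : `|x| < L%:R.
    rewrite (@lt_trans _ _ (`|x| + 1)) ?ltrDl//.
    by rewrite -{1}[`|x| + 1]ger0_norm ?addr_ge0// truncnS_gt.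
  by rewrite ltr_norml => /andP[].
have near1 : \forall y \near x, `|y - x| < 1.
  by apply/nbhs_ballP; exists 1 => //= z; rewrite /ball/= distrC.
near=> y.
have yx : `|y| <= `|x| + 1.
  rewrite -lerBlDl (le_trans (lerB_dist _ _))// ltW//.
have NL : (N y <= L)%N.
  by rewrite ltnS le_truncn// [leRHS]ger0_norm ?addr_ge0.
by rewrite -(subnKC NL) GG.
Unshelve. all: by end_near. Qed.
End Calculus.

(** * Smooth step functions and smooth approximation in one variable *)

Section Smooth.
Context {R : realType}.
Implicit Types (f g q : R -> R) (x y z a b c : R).

Lemma derD f g (x df dg : R) : is_derive x 1 f df -> is_derive x 1 g dg ->
  is_derive x 1 (fun y => f y + g y) (df + dg).
Proof. by move=> hf hg; exact: (@is_deriveD _ _ _ f g x 1 df dg hf hg). Qed.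

Lemma derB f g (x df dg : R) : is_derive x 1 f df -> is_derive x 1 g dg ->
  is_derive x 1 (fun y => f y - g y) (df - dg).
Proof. by move=> hf hg; exact: (@is_deriveB _ _ _ f g x 1 df dg hf hg). Qed.

Lemma derM f g (x df dg : R) : is_derive x 1 f df -> is_derive x 1 g dg ->
  is_derive x 1 (fun y => f y * g y) (f x * dg + g x * df).
Proof. by move=> hf hg; exact: (@is_deriveM _ _ f g x 1 df dg hf hg). Qed.

Lemma derN f (x df : R) : is_derive x 1 f df -> is_derive x 1 (fun y => - f y) (- df).
Proof. by move=> hf; exact: (@is_deriveN _ _ _ f x 1 df hf). Qed.

Lemma der_cst (c x : R) : is_derive x 1 (fun=> c) 0.
Proof. exact: is_derive_cst. Qed.

Lemma derZ f (c x df : R) : is_derive x 1 f df -> is_derive x 1 (fun y => c * f y) (c * df).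
Proof. by move=> hf; exact: (@is_deriveZ _ _ _ f c x 1 df hf). Qed.

Lemma der_comp f g (x df dg : R) : is_derive (g x) 1 f df -> is_derive x 1 g dg ->
  is_derive x 1 (fun y => f (g y)) (df * dg).
Proof. by move=> hf hg; exact: (@is_derive1_comp _ f g x df dg hf hg). Qed.

Lemma der_affine (a b x : R) : is_derive x 1 (fun y => a * y + b) a.
Proof.
have := derD (derZ a (@is_derive_id R R x 1)) (der_cst b x).
by rewrite mulr1 addr0.
Qed.

(** The bound puts the difference quotient within C |h| of [d]. This yields the derivative of [flat]
    at 0 and, later, that of the energy. *)
Lemma is_derive_quadratic f (x d C e : R) : 0 < e ->
  (forall h, `|h| < e -> `|f (x + h) - f x - d * h| <= C * h ^+ 2) ->
  is_derive x 1 f d.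
Proof.
move=> e0 fC.
have C0 : 0 <= C.
  have e2 : `|e / 2| < e by rewrite ger0_norm; lra.
  have := le_trans (normr_ge0 _) (fC _ e2).
  by rewrite pmulr_lge0// exprn_gt0//; lra.
suff cv : h^-1 *: (f (h + x) - f x) @[h --> 0^'] --> d.
  have cv' : h^-1 *: ((f \o shift x) (h *: 1) - f x) @[h --> 0^'] --> d.
    move: cv; apply: cvg_trans; apply: near_eq_cvg; near=> h.
    by rewrite /= /shift /= [h *: 1]mulr1.
  by split; [apply/cvg_ex; exists d|exact/cvg_lim].
apply/cvgrPdist_le => eps eps0.
near=> h.
have h0 : h != 0 by near: h; exact: nbhs_dnbhs_neq.
have he : `|h| < e by near: h; apply: dnbhs0_lt.
have hC : `|h| < eps / (C + 1) by near: h; apply: dnbhs0_lt; rewrite divr_gt0//; lra.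
have -> : d - h^-1 *: (f (h + x) - f x) = - (h^-1 * (f (x + h) - f x - d * h)).
  by rewrite /GRing.scale/= [h + x]addrC; field.
rewrite normrN normrM normfV ler_pdivrMl ?normr_gt0//.
apply: le_trans (fC _ he) _.
have -> : h ^+ 2 = `|h| * `|h| by rewrite -expr2 real_normK ?num_real.
rewrite mulrCA ler_wpM2l// (le_trans (ler_wpM2l C0 (ltW hC)))//.
by rewrite mulrA ler_pdivrMr; nra.
Unshelve. all: by end_near. Qed.

(** Only the existence of [k] derivatives is asked for, not continuity of the last one; once all [k]
    are required the difference disappears. *)
Fixpoint Ck (k : nat) f : Prop :=
  if k is k'.+1 then (forall x, derivable f x 1) /\ Ck k' (derive1 f) else True.

Definition smooth f := forall k, Ck k f.

Lemma Ck_intro k f g : (forall x, is_derive x 1 f (g x)) -> Ck k g -> Ck k.+1 f.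
Proof.
move=> dfg Cg; split=> [x|]; first by have [] := dfg x.
by rewrite (_ : derive1 f = g)//; apply/funext => x; exact: derive1_is_derive.
Qed.

Lemma CkS k f : Ck k.+1 f -> Ck k f.
Proof. by elim: k f => //= k ih f [df Cf]; split => //; apply: ih. Qed.

Lemma Ck_is_derive k f : Ck k.+1 f -> forall x, is_derive x 1 f (derive1 f x).
Proof. by move=> [df _] x; exact: is_derive_derive1. Qed.

Lemma CkD k f g : Ck k f -> Ck k g -> Ck k (fun x => f x + g x).
Proof.
elim: k f g => // k ih f g Cf Cg.
apply: (@Ck_intro _ _ (fun x => derive1 f x + derive1 g x)).
  by move=> x; exact: (derD (Ck_is_derive Cf x) (Ck_is_derive Cg x)).
by apply: ih; [exact: Cf.2|exact: Cg.2].
Qed.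

Lemma Ck_cst k c : Ck k (fun=> c).
Proof.
elim: k c => // k ih c; apply: (@Ck_intro _ _ (fun=> 0)) => //.
Qed.

Lemma CkM k f g : Ck k f -> Ck k g -> Ck k (fun x => f x * g x).
Proof.
elim: k f g => // k ih f g Cf Cg.
apply: (@Ck_intro _ _ (fun x => f x * derive1 g x + g x * derive1 f x)).
  by move=> x; exact: (derM (Ck_is_derive Cf x) (Ck_is_derive Cg x)).
by apply: CkD; apply: ih; do ?[exact: CkS|exact: Cf.2|exact: Cg.2].
Qed.

Lemma Ck_affine k f a b : Ck k f -> Ck k (fun x => f (a * x + b)).
Proof.
elim: k f => // k ih f Cf.
have d x := @der_comp f (fun y => a * y + b) x _ _ (Ck_is_derive Cf _) (der_affine a b x).
apply: (Ck_intro d).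
apply: CkM; [exact: ih Cf.2|exact: Ck_cst].
Qed.

Lemma smooth_is_derive f : smooth f -> forall x, is_derive x 1 f (derive1 f x).
Proof. by move=> /(_ 1%N) /Ck_is_derive. Qed.

Lemma smooth_derive1 f : smooth f -> smooth (derive1 f).
Proof. by move=> sf k; exact: (sf k.+1).2. Qed.

Lemma smooth_derivable f : smooth f -> forall x, derivable f x 1.
Proof. by move=> /(_ 1%N) []. Qed.

Lemma smooth_continuous f : smooth f -> continuous f.
Proof. by move=> /smooth_derivable /derivable_cont. Qed.

Lemma smooth_primitive f g : (forall x, is_derive x 1 f (g x)) -> smooth g ->
  smooth f.
Proof. by move=> dfg sg [//|k]; exact: Ck_intro dfg (sg k). Qed.

Lemma smoothD f g : smooth f -> smooth g -> smooth (fun x => f x + g x).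
Proof. by move=> sf sg k; exact: CkD. Qed.

Lemma smoothM f g : smooth f -> smooth g -> smooth (fun x => f x * g x).
Proof. by move=> sf sg k; exact: CkM. Qed.

Lemma smooth_cst c : smooth (fun=> c).
Proof. by move=> k; exact: Ck_cst. Qed.

Lemma smooth_affine f a b : smooth f -> smooth (fun x => f (a * x + b)).
Proof. by move=> sf k; exact: Ck_affine. Qed.

(* The derivatives of [expR (- x^-1)] on the positive half-line are combinations
   of these functions. *)
Definition flat (k : nat) x : R :=
  if 0 < x then x^-1 ^+ k * expR (- x^-1) else 0.

(** A single term of the exponential series, of degree [k.+2], beats the power [x^-1 ^+ k] with two
    orders to spare; these two orders give the zero derivative at 0. *)
Lemma flat_le k x : 0 < x -> flat k x <= k.+2`!%:R * x ^+ 2.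
Proof.
move=> x0; rewrite /flat x0 expRN ler_pdivrMr ?expR_gt0//.
rewrite -(@ler_pM2r _ (x^-1 ^+ 2)) ?exprn_gt0 ?invr_gt0// -exprD addn2.
have -> : k.+2`!%:R * x ^+ 2 * expR x^-1 * x^-1 ^+ 2 = k.+2`!%:R * expR x^-1.
  by field; rewrite gt_eqF.
rewrite -ler_pdivrMl ?ltr0n ?fact_gt0// mulrC.
have := @expR_ge1Dxn R x^-1 k.+1 _; rewrite invr_ge0 ltW// => /(_ isT); lra.
Qed.

Lemma flat_ge0 k x : 0 <= flat k x.
Proof.
rewrite /flat; case: ifP => // x0.
by rewrite mulr_ge0 ?expR_ge0// exprn_ge0// invr_ge0 ltW.
Qed.

(** Differentiation stays within the linear span of the family, so smoothness of all its members
    follows by one induction on the order. *)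
Lemma is_derive_flat k x :
  is_derive x 1 (flat k) (flat k.+2 x - k%:R * flat k.+1 x).
Proof.
have [x0|x0|->] := ltgtP x 0.
- rewrite /flat !ifF ?subrr ?mulr0 ?subr0; [|by rewrite ltNge ltW..].
  apply: eq_near_derive (der_cst 0 x).
  near=> y; rewrite ifF//; apply/negP/negP; rewrite -leNgt ltW//.
  by near: y; exact: lt_nbhsl.
- rewrite /flat !x0.
  suff : is_derive x 1 (fun y => y^-1 ^+ k * expR (- y^-1))
      (x^-1 ^+ k.+2 * expR (- x^-1) - k%:R * (x^-1 ^+ k.+1 * expR (- x^-1))).
    apply: eq_near_derive; near=> y; rewrite ifT//; near: y; exact: lt_nbhsr.
  have xn0 : x != 0 by rewrite gt_eqF.
  have dV : is_derive x 1 (fun y : R => y^-1) (- x ^- 2).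
    rewrite -[X in is_derive _ _ _ X]mulr1.
    exact: (is_deriveV xn0 (@is_derive_id R R x 1)).
  (* For [k = 0] the truncated exponent [k.-1] is harmless, as the factor [k%:R] vanishes. *)
  have dX : is_derive x 1 (fun y : R => y^-1 ^+ k) (k%:R * x^-1 ^+ k.-1 * - x ^- 2).
    elim: k => [|k ih].
      by rewrite mul0r mul0r; under eq_fun do rewrite expr0; exact: der_cst.
    under eq_fun do rewrite exprS.
    rewrite (_ : _ * _ = x^-1 * (k%:R * x^-1 ^+ k.-1 * - x ^- 2) + x^-1 ^+ k * - x ^- 2); last first.
      by case: k ih => [|k] _ /=; rewrite ?expr0 ?exprS -?[k.+2]addn1 ?natrD -?[k.+1]addn1 ?natrD; ring.
    exact: (derM dV ih).
  have dE : is_derive x 1 (fun y : R => expR (- y^-1)) (expR (- x^-1) * x ^- 2).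
    have := @der_comp expR (fun y => - y^-1) x _ _ (is_derive_expR _) (derN dV).
    by rewrite opprK.
  have -> : x^-1 ^+ k.+2 * expR (- x^-1) - k%:R * (x^-1 ^+ k.+1 * expR (- x^-1)) =
    x^-1 ^+ k * (expR (- x^-1) * x ^- 2) + expR (- x^-1) * (k%:R * x^-1 ^+ k.-1 * - x ^- 2).
    case: k dX => [|k] _ /=; rewrite !exprS ?expr0; field; rewrite xn0//.
  exact: (derM dX dE).
- rewrite /flat ltxx mulr0 subr0.
  apply: (@is_derive_quadratic _ _ _ k.+2`!%:R 1) => // h _.
  rewrite add0r mul0r subr0 /flat ltxx subr0 ger0_norm -/(flat k h) ?flat_ge0//.
  have [h0|h0] := ltP 0 h; first exact: flat_le.
  by rewrite /flat ltNge h0/= mulr_ge0// sqr_ge0.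
Unshelve. all: by end_near. Qed.

Lemma smooth_flat k : smooth (flat k).
Proof.
move=> j; elim: j k => // j ih k; apply: Ck_intro (is_derive_flat k) _.
apply: CkD => //.
rewrite (_ : (fun x => _) = (fun x => (- k%:R) * flat k.+1 x)); last first.
  by apply/funext => x; rewrite mulNr.
by apply: CkM => //; exact: Ck_cst.
Qed.

(** [S] is the normalised primitive of the bump exp(-1/x) exp(-1/(1-x)), which is nonnegative and
    vanishes outside ]0, 1[. *)
Lemma smoothstep_ex : exists S : R -> R, [/\ smooth S,
  (forall x, x <= 0 -> S x = 0), (forall x, 1 <= x -> S x = 1),
  (forall x, 0 <= S x <= 1) & (forall x, 0 <= derive1 S x)].
Proof.
pose b x := flat 0 x * flat 0 (-1 * x + 1).
have sb : smooth b by apply: smoothM; [|apply: smooth_affine]; exact: smooth_flat.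
have b0 x : 0 <= b x by rewrite mulr_ge0// flat_ge0.
have [B dB] := continuous_primitive (smooth_continuous sb).
have sB : smooth B := smooth_primitive dB sb.
have B'E x : derive1 B x = b x := derive1_is_derive (dB x).
(* The mean value theorem exhibits the total integral as a value of [b] inside ]0, 1[, hence as a
   positive number to divide by. *)
have [c [c0 c1 eB]] := mvt ltr01 (smooth_derivable sB).
rewrite subr0 mulr1 B'E in eB.
have I0 : 0 < B 1 - B 0.
  have c10 : 0 < -1 * c + 1 by lra.
  rewrite eB /b /flat c0 c10 !expr0 !mul1r mulr_gt0//; exact: expR_gt0.
have Bnd x y : x <= y -> B x <= B y.
  rewrite le_eqVlt => /predU1P[->//|xy].
  have [d [_ _ e]] := mvt xy (smooth_derivable sB).
  by rewrite -subr_ge0 e B'E mulr_ge0// subr_ge0 ltW.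
have Bl x : x <= 0 -> B x = B 0.
  rewrite le_eqVlt => /predU1P[->//|x0].
  have [d [xd d0 e]] := mvt x0 (smooth_derivable sB).
  move: e; rewrite B'E /b {1}/flat ltNge (ltW d0)/= !mul0r => /eqP.
  by rewrite subr_eq0 => /eqP.
have Br x : 1 <= x -> B x = B 1.
  rewrite le_eqVlt => /predU1P[->//|x0].
  have [d [xd d0 e]] := mvt x0 (smooth_derivable sB).
  have d10 : (0 < -1 * d + 1) = false by apply/negP/negP; rewrite -leNgt; lra.
  move: e; rewrite B'E /b {2}/flat d10 mulr0 mul0r => /eqP.
  by rewrite subr_eq0 => /eqP.
pose S x := (B 1 - B 0)^-1 * (B x - B 0).
have dS x : is_derive x 1 S ((B 1 - B 0)^-1 * b x).
  by have := derZ (B 1 - B 0)^-1 (derB (dB x) (der_cst (B 0) x)); rewrite subr0.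
exists S; split.
- by apply: smooth_primitive dS _; apply: smoothM => //; exact: smooth_cst.
- by move=> x x0; rewrite /S (Bl _ x0) subrr mulr0.
- by move=> x x1; rewrite /S (Br _ x1) mulVf// gt_eqF.
- move=> x; rewrite /S mulr_ge0 ?invr_ge0 ?(ltW I0)//=; last first.
    have [x0|x0] := leP x 0; first by rewrite (Bl _ x0) subrr.
    by rewrite subr_ge0 Bnd// ltW.
  rewrite ler_pdivrMl// mulr1 lerB//.
  by have [x1|x1] := leP 1 x; [rewrite (Br _ x1)|rewrite Bnd// ltW].
- by move=> x; rewrite (derive1_is_derive (dS x)) mulr_ge0// invr_ge0 ltW.
Qed.

(* The witness is the piecewise linear interpolation of [q] with its corners
   smoothed out. *)
Lemma smooth_approx q (A L e : R) : 0 < A -> 0 < e -> 0 <= L ->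
  (forall x y, - A <= x <= A -> - A <= y <= A -> `|q x - q y| <= L * `|x - y|) ->
  exists2 s, smooth s & forall x, - A <= x <= A -> `|s x - q x| <= e.
Proof.
move=> A0 e0 L0 ql.
have [S [sS S0 S1 S01 _]] := smoothstep_ex.
(* [N] makes the mesh [h] so fine that two oscillations of [q] over a cell, each at most [L * h],
   stay below [e]. *)
have [N] : exists N : nat, 4 * L * A / e < N.+1%:R.
  by exists (Num.truncn (4 * L * A / e)); rewrite truncnS_gt.
set h := 2 * A / N.+1%:R; move=> hN.
have h0 : 0 < h by rewrite divr_gt0// mulr_gt0.
have he : 2 * (L * h) <= e.
  rewrite /h; move: hN; rewrite ltr_pdivrMr// => /ltW hN.
  rewrite !mulrA ler_pdivrMr ?ltr0n//; apply: le_trans (le_trans hN _); last by rewrite mulrC.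
  lra.
pose a (k : nat) := - A + k%:R * h.
have a0 : a 0 = - A by rewrite /a mul0r addr0.
have aS k : a k.+1 = a k + h by rewrite /a -natr1; ring.
have aN : a N.+1 = A by rewrite /a /h mulrC divfK ?pnatr_eq0//; lra.
have aA (k : nat) : (k <= N.+1)%N -> - A <= a k <= A.
  move=> kN; rewrite /a lerDl mulr_ge0 ?(ltW h0)//=.
  by rewrite -[leRHS]aN /a lerD2l ler_wpM2r ?(ltW h0)// ler_nat.
(* The [k]-th summand climbs from 0 to the increment of [q] over the cell between [a k] and [a k.+1]
   and is constant on either side. *)
pose s (n : nat) x := q (- A) + \sum_(k < n) (q (a k.+1) - q (a k)) * S (h^-1 * x + (- (h^-1 * a k))).
have sarg x k : h^-1 * x + (- (h^-1 * a k)) = (x - a k) / h by ring.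
have ss n : smooth (s n).
  apply: smoothD; first exact: smooth_cst.
  elim: n => [|n ih].
    by under eq_fun do rewrite big_ord0; exact: smooth_cst.
  under eq_fun do rewrite big_ord_recr/=.
  apply: smoothD => //; apply: smoothM; first exact: smooth_cst.
  exact: smooth_affine.
have sS' n x : s n.+1 x = s n x + (q (a n.+1) - q (a n)) * S ((x - a n) / h).
  by rewrite /s big_ord_recr/= addrA sarg.
have sR n x : a n <= x -> s n x = q (a n).
  elim: n x => [|n ih] x anx; first by rewrite /s big_ord0 addr0 a0.
  rewrite sS' ih; last by apply: le_trans anx; rewrite aS; lra.
  by rewrite S1 ?mulr1 ?subrKC// ler_pdivlMr// mul1r lerBrDl -aS.
(* Left of [a n] the newest summand vanishes; right of it all earlier ones are saturated, and the
   error is one oscillation of [q] plus one partial jump. *)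
have key n x : (n <= N.+1)%N -> - A <= x <= a n -> `|s n x - q x| <= 2 * (L * h).
  elim: n => [_|n ih nN].
    rewrite a0 => /andP[x1 x2]; have -> : x = - A by lra.
    rewrite sR ?a0// subrr normr0 mulr_ge0// mulr_ge0// ltW//.
  move=> /andP[Ax xa].
  have [xan|anx] := leP x (a n).
    rewrite sS' S0 ?mulr0 ?addr0; last by rewrite pmulr_lle0 ?invr_gt0// subr_le0.
    by apply: ih; [exact: ltnW|rewrite Ax].
  rewrite sS' sR ?(ltW anx)//.
  have xA : - A <= x <= A by rewrite Ax (le_trans xa)//; case/andP: (aA _ nN).
  have anA := aA _ (ltnW nN).
  have e1 : `|q (a n) - q x| <= L * h.
    apply: le_trans (ql _ _ anA xA) _; rewrite ler_wpM2l// distrC ger0_norm; last by rewrite subr_ge0 ltW.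
    by rewrite lerBlDl -aS.
  have e2 : `|(q (a n.+1) - q (a n)) * S ((x - a n) / h)| <= L * h.
    rewrite normrM -[leRHS]mulr1 ler_pM//.
      apply: le_trans (ql _ _ (aA _ nN) anA) _.
      by rewrite aS [_ + h]addrC addrK ger0_norm ?(ltW h0).
    by have /andP[? ?] := S01 ((x - a n) / h); rewrite ger0_norm.
  rewrite [X in `|X|](_ : _ = (q (a n) - q x) + (q (a n.+1) - q (a n)) * S ((x - a n) / h)); last by ring.
  by apply: le_trans (ler_normD _ _) _; lra.
by exists (s N.+1) => // x xA; rewrite (le_trans _ he)// key// aN.
Qed.

(** The derivative is approximated and then integrated. The primitive is shifted to agree with [f]
    at 0, whence the factor [A], the largest distance from 0. *)
Lemma smooth_C1_approx f (A L e : R) : 0 < A -> 0 < e -> 0 <= L ->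
  (forall x, derivable f x 1) ->
  (forall x y, - A <= x <= A -> - A <= y <= A ->
     `|derive1 f x - derive1 f y| <= L * `|x - y|) ->
  exists s, [/\ smooth s,
    (forall x, - A <= x <= A -> `|derive1 s x - derive1 f x| <= e) &
    (forall x, - A <= x <= A -> `|s x - f x| <= e * A)].
Proof.
move=> A0 e0 L0 df lf.
have [g sg gf] := smooth_approx A0 e0 L0 lf.
have [G dG] := continuous_primitive (smooth_continuous sg).
have G'E x : derive1 G x = g x := derive1_is_derive (dG x).
have sG := smooth_primitive dG sg.
pose s x := G x + (f 0 - G 0).
have ds x : is_derive x 1 s (g x).
  by have := derD (dG x) (der_cst (f 0 - G 0) x); rewrite addr0.
have s'E x : derive1 s x = g x := derive1_is_derive (ds x).
exists s; split.
- by apply: smoothD => //; exact: smooth_cst.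
- by move=> x xA; rewrite s'E gf.
move=> x xA.
have dd y : is_derive y 1 (fun y => s y - f y) (g y - derive1 f y).
  exact: (derB (ds y) (is_derive_derive1 (df y))).
have := @mvt_bound R (fun y => s y - f y) (- A) A x 0 e.
rewrite [s 0]addrC subrK subrr !subr0 => H.
apply: le_trans (H _ _ xA _) _.
- by move=> y; have [] := dd y.
- by move=> z zA; rewrite (derive1_is_derive (dd z)) gf.
- by lra.
- by rewrite ler_wpM2l ?(ltW e0)// ler_norml.
Qed.
End Smooth.

(** * Test functions *)

Section TestFunctions.
Context {R : realType}.
Implicit Types (f g q psi theta : R -> R) (x y a b c : R).

(** Products of a time profile and a space profile are the only test functions needed to derive the
    balance laws. Their iterated partial derivatives are again products, which reduces smoothness in
    the plane to one variable. *)
Definition tensor psi theta : R * R -> R := fun z => psi z.1 * theta z.2.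

Lemma derZr f (c x df : R) : is_derive x 1 f df ->
  is_derive x 1 (fun y => f y * c) (df * c).
Proof. by move=> h; rewrite mulrC; under eq_fun do rewrite mulrC; exact: derZ. Qed.

Lemma partial_t_tensor psi theta : smooth psi ->
  partial_t (tensor psi theta) = tensor (derive1 psi) theta.
Proof.
move=> sp; apply/funext => -[t x]; rewrite /partial_t /tensor/=.
exact: derive1_is_derive (derZr _ (smooth_is_derive sp t)).
Qed.

Lemma partial_x_tensor psi theta : smooth theta ->
  partial_x (tensor psi theta) = tensor psi (derive1 theta).
Proof.
move=> sp; apply/funext => -[t x]; rewrite /partial_x /tensor/=.
exact: derive1_is_derive (derZ _ (smooth_is_derive sp x)).
Qed.

Lemma iter_partial_tensor (w : seq bool) psi theta : smooth psi -> smooth theta ->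
  exists p t, [/\ smooth p, smooth t &
    iter_partial w (tensor psi theta) = tensor p t].
Proof.
move=> sp st; elim: w => [|b w [p [t [sp' st' e]]]]; first by exists psi, theta.
rewrite /= e; case: b.
  by exists p, (derive1 t); split => //; [exact: smooth_derive1|exact: partial_x_tensor].
by exists (derive1 p), t; split => //; [exact: smooth_derive1|exact: partial_t_tensor].
Qed.

Lemma tensor_continuous psi theta : continuous psi -> continuous theta ->
  continuous (tensor psi theta).
Proof.
move=> cp ct z; apply: cvgM.
  by apply: (@cvg_comp _ _ _ fst psi _ (nbhs z.1)); [exact: cvg_fst|exact: cp].
by apply: (@cvg_comp _ _ _ snd theta _ (nbhs z.2)); [exact: cvg_snd|exact: ct].
Qed.

Lemma test_function_tensor psi theta (a b A : R) : 0 < a ->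
  smooth psi -> smooth theta ->
  (forall x, x \notin `[a, b] -> psi x = 0) ->
  (forall x, x \notin `[- A, A] -> theta x = 0) ->
  test_function (tensor psi theta).
Proof.
move=> a0 sp st p0 t0.
have sub : closure [set z | tensor psi theta z != 0] `<=`
    (`[a, b] `*` `[- A, A]).
  have cl : closed (`[a, b] `*` `[- A, A] : set (R * R)).
    by apply: compact_closed; [exact: norm_hausdorff|apply: compact_setX; exact: segment_compact].
  rewrite [X in _ `<=` X](closure_id _).1//; apply: closure_subset => -[t x] /=.
  rewrite /tensor/= => /eqP tx; split => /=; apply: contrapT => /negP h; apply: tx.
    by rewrite p0 ?mul0r.
  by rewrite t0 ?mulr0.
split.
- move=> w; have [p [t [sp' st' ->]]] := iter_partial_tensor w sp st; split.
  + by apply: tensor_continuous; exact: smooth_continuous.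
  + by move=> z; have [] := derZr (t z.2) (smooth_is_derive sp' z.1).
  + by move=> z; have [] := derZ (p z.1) (smooth_is_derive st' z.2).
- apply: subclosed_compact sub; first exact: closed_closure.
  by apply: compact_setX; exact: segment_compact.
- by move=> z /sub [] /=; rewrite in_itv/= => /andP[az _] _; exact: lt_le_trans az.
Qed.

(** [chi] rises on [-A-2, -A-1] and falls on [A+1, A+2]. The margin of 1 around [-A, A] makes its
    derivative vanish there, so a product with [chi] keeps both values and derivatives. *)
Lemma smooth_cutoff (A : R) : 0 < A -> exists2 chi : R -> R, smooth chi &
  (forall x, - A <= x <= A -> chi x = 1 /\ derive1 chi x = 0) /\
  (forall x, x \notin `[- (A + 2), A + 2] -> chi x = 0).
Proof.
move=> A0; have [S [sS S0 S1 _ _]] := @smoothstep_ex R.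
pose chi x := S (1 * x + (A + 2)) + (-1) * S (1 * x + (- A - 1)).
have schi : smooth chi.
  by apply: smoothD; [|apply: smoothM; [exact: smooth_cst|]]; exact: smooth_affine.
have chi1 x : - A - 1 <= x <= A + 1 -> chi x = 1.
  by move=> /andP[x1 x2]; rewrite /chi S1 ?S0; lra.
exists chi => //; split=> x.
  move=> /andP[xA Ax]; split; first by apply: chi1; lra.
  apply: derive1_is_derive; apply: eq_near_derive (der_cst 1 x).
  near=> y; apply: chi1.
  by rewrite !ltW//; near: y; [apply: lt_nbhsl|apply: lt_nbhsr]; lra.
rewrite in_itv/= negb_and -!ltNge => /orP[xA|xA].
  by rewrite /chi !S0; lra.
by rewrite /chi !S1; lra.
Unshelve. all: by end_near. Qed.

Lemma continuous_integrable_itv f a b :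
  (forall x, a <= x <= b -> {for x, continuous f}) ->
  lebesgue_measure.-integrable `[a, b] (EFin \o f).
Proof.
move=> cf; apply: continuous_compact_integrable; first exact: segment_compact.
apply: continuous_in_subspaceT => x; rewrite inE/= in_itv/=; exact: cf.
Qed.

Lemma Rintegral_derive1 f g a b : a < b -> (forall x, is_derive x 1 f (g x)) ->
  continuous g -> \int[lebesgue_measure]_(x in `[a, b]) g x = f b - f a.
Proof.
move=> ab dfg cg.
have cf : continuous f by apply: derivable_cont => x; have [] := dfg x.
rewrite /Rintegral (@continuous_FTC2 R g f)//.
- exact: continuous_subspaceT.
- split.
  + by move=> x _; have [] := dfg x.
  + exact/cvg_at_right_filter/cf.
  + exact/cvg_at_left_filter/cf.
- by move=> x _; exact: derive1_is_derive.
Qed.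

(* The weak equation is tested against smooth approximations of the indicator of
   [a, b]. *)
Lemma weak_derivative_bound F g (a b c d : R) : a < b ->
  (forall x, a <= x <= b -> {for x, continuous F}) ->
  (forall x, a <= x <= b -> {for x, continuous g}) ->
  (forall psi, smooth psi -> (forall x, x \notin `[a, b] -> psi x = 0) ->
     \int[lebesgue_measure]_(t in `[a, b]) (derive1 psi t * F t - psi t * g t) = 0) ->
  (forall t, a <= t <= b -> `|g t - c| <= d) ->
  `|F b - F a + c * (b - a)| <= d * (b - a).
Proof.
move=> ab cF cg weak gd.
have [S [sS S0 S1 S01 S'0]] := @smoothstep_ex R.
have S'out x : x < 0 \/ 1 < x -> derive1 S x = 0.
  move=> [x0|x1]; apply: derive1_is_derive.
    apply: eq_near_derive (der_cst 0 x); near=> y; apply: S0; apply: ltW.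
    by near: y; exact: lt_nbhsl.
  apply: eq_near_derive (der_cst 1 x); near=> y; apply: S1; apply: ltW.
  by near: y; exact: lt_nbhsr.
have Snd x y : x <= y -> S x <= S y.
  rewrite le_eqVlt => /predU1P[->//|xy].
  have [e [_ _ E]] := mvt xy (smooth_derivable sS).
  by rewrite -subr_ge0 E mulr_ge0// subr_ge0 ltW.
(* Adding a linear term absorbs [c]: what remains is to bound the increment of [G]. *)
pose G t := F t + c * (t - a).
have cG x : a <= x <= b -> {for x, continuous G}.
  move=> xab; apply: cvgD; first exact: cF.
  apply: cvgM; first exact: cvg_cst.
  by apply: cvgB; [exact: cvg_id|exact: cvg_cst].
suff key eta : 0 < eta -> `|G b - G a| <= 2 * eta + d * (b - a).
  have -> : F b - F a + c * (b - a) = G b - G a by rewrite /G; ring.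
  apply/ler_addgt0Pr => e e0.
  by have := key (e / 2) (divr_gt0 e0 (ltr0Sn _ _)); lra.
move=> eta0.
have aab : a <= a <= b by rewrite lexx ltW.
have bab : a <= b <= b by rewrite lexx ltW.
have /cvgrPdist_le /(_ _ eta0) /nbhs_ballP [e1 /= e10 ha] := cG _ aab.
have /cvgrPdist_le /(_ _ eta0) /nbhs_ballP [e2 /= e20 hb] := cG _ bab.
(* [eps] is the width of the two ramps: [G] varies by at most [eta] on each, and [eps <= b - a]
   orders the ramps so that [psi] is nonnegative. *)
pose eps := Num.min (b - a) (Num.min (e1 / 2) (e2 / 2)).
have eps0 : 0 < eps by rewrite !lt_min subr_gt0 ab !divr_gt0.
have [eba [ee1 ee2]] : eps <= b - a /\ eps <= e1 / 2 /\ eps <= e2 / 2.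
  by rewrite /eps !ge_min !lexx ?orbT.
have near_a t : a <= t -> t <= a + eps -> ball a e1 t.
  by move=> ? ?; rewrite /ball/= distrC ger0_norm; lra.
have near_b t : t <= b -> b - eps <= t -> ball b e2 t.
  by move=> ? ?; rewrite /ball/= ger0_norm; lra.
have far_a t : a + eps < t -> 1 < (t - a) / eps.
  by move=> ?; rewrite ltr_pdivlMr// mul1r ltrBrDl.
have far_b t : t < b - eps -> 1 - (b - t) / eps < 0.
  by move=> ?; rewrite subr_lt0 ltr_pdivlMr// mul1r ltrBrDl -ltrBrDr.
have Vi0 : 0 < eps^-1 by rewrite invr_gt0.
pose Sa t := S (eps^-1 * t + - (eps^-1 * a)).
pose Sb t := S (eps^-1 * t + (1 - eps^-1 * b)).
have aE t : eps^-1 * t + - (eps^-1 * a) = (t - a) / eps by ring.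
have bE t : eps^-1 * t + (1 - eps^-1 * b) = 1 - (b - t) / eps by ring.
have sSa : smooth Sa by exact: smooth_affine.
have sSb : smooth Sb by exact: smooth_affine.
have dSa t : derive1 Sa t = derive1 S ((t - a) / eps) / eps.
  rewrite -aE; apply: derive1_is_derive.
  exact: (@der_comp _ S (fun t => eps^-1 * t + - (eps^-1 * a)) _ _ _ (smooth_is_derive sS _) (der_affine _ _ _)).
have dSb t : derive1 Sb t = derive1 S (1 - (b - t) / eps) / eps.
  rewrite -bE; apply: derive1_is_derive.
  exact: (@der_comp _ S (fun t => eps^-1 * t + (1 - eps^-1 * b)) _ _ _ (smooth_is_derive sS _) (der_affine _ _ _)).
have dSa0 t : 0 <= derive1 Sa t by rewrite dSa mulr_ge0// ltW.
have dSb0 t : 0 <= derive1 Sb t by rewrite dSb mulr_ge0// ltW.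
pose psi t := Sa t + -1 * Sb t.
have spsi : smooth psi by apply: smoothD => //; apply: smoothM => //; exact: smooth_cst.
have psi'E t : derive1 psi t = derive1 Sa t - derive1 Sb t.
  apply: derive1_is_derive.
  have := derD (smooth_is_derive sSa t) (derZ (-1) (smooth_is_derive sSb t)).
  by rewrite mulN1r.
have Saa : Sa a = 0 by rewrite /Sa aE S0// subrr mul0r.
have Sbb : Sb b = 1 by rewrite /Sb bE S1// subrr mul0r subr0.
have Sab : Sa b = 1 by rewrite /Sa aE S1// ler_pdivlMr// mul1r.
have Sba : Sb a = 0.
  by rewrite /Sb bE S0// subr_le0 ler_pdivlMr// mul1r.
have psi_out t : t \notin `[a, b] -> psi t = 0.
  rewrite in_itv/= negb_and -!ltNge /psi /Sa /Sb aE bE => /orP[ta|bt].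
    rewrite S0 ?S0 ?mulr0 ?addr0//.
      by rewrite subr_le0 ler_pdivlMr// mul1r; lra.
    by rewrite pmulr_lle0//; lra.
  rewrite S1 ?S1 ?mulr1 ?subrr//.
    by rewrite lerDl oppr_ge0 pmulr_lle0//; lra.
  by rewrite ler_pdivlMr// mul1r; lra.
have psi01 t : 0 <= psi t <= 1.
  have /andP[_ h1] := S01 ((t - a) / eps).
  have /andP[h2 _] := S01 (1 - (b - t) / eps).
  rewrite /psi mulN1r subr_ge0 /Sa /Sb aE bE; apply/andP; split; last by lra.
  apply: Snd; rewrite -subr_ge0.
  have -> : (t - a) / eps - (1 - (b - t) / eps) = (b - a - eps) / eps by field; rewrite gt_eqF.
  by rewrite mulr_ge0//; [lra|exact: ltW].
(* Adding the exact derivative of [Z] to the weak integrand makes the integral equal to [G b - G a]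
   and leaves an integrand in which [G] is compared with its end values only on the ramps. *)
pose Z t := c * (psi t * (1 * t + - a)) + (- G a * Sa t + G b * Sb t).
have slin u v : smooth (fun t => u * t + v).
  by apply: smooth_primitive (smooth_cst u) => x; exact: der_affine.
have sZ : smooth Z.
  apply: smoothD; last by apply: smoothD; apply: smoothM => //; exact: smooth_cst.
  by apply: smoothM; [exact: smooth_cst|exact: smoothM].
have Z'E t : derive1 Z t = c * (psi t + (1 * t + - a) * derive1 psi t) +
     (- G a * derive1 Sa t + G b * derive1 Sb t).
  apply: derive1_is_derive.
  have := derD (derZ c (derM (smooth_is_derive spsi t) (der_affine 1 (- a) t)))
    (derD (derZ (- G a) (smooth_is_derive sSa t)) (derZ (G b) (smooth_is_derive sSb t))).
  by rewrite mulr1.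
pose h t := (derive1 psi t * F t - psi t * g t) + derive1 Z t.
have ZI := Rintegral_derive1 ab (smooth_is_derive sZ) (smooth_continuous (smooth_derive1 sZ)).
have cw x : a <= x <= b -> {for x, continuous (fun t => derive1 psi t * F t - psi t * g t)}.
  move=> xab; apply: cvgB; apply: cvgM; do ?[exact: cF|exact: cg].
    exact/smooth_continuous/smooth_derive1.
  exact/smooth_continuous.
have iw := continuous_integrable_itv cw.
have iZ : lebesgue_measure.-integrable `[a, b] (EFin \o derive1 Z).
  by apply: continuous_integrable_itv => x _; exact/smooth_continuous/smooth_derive1.
have hI : \int[lebesgue_measure]_(t in `[a, b]) h t = G b - G a.
  rewrite /h RintegralD// (weak psi spsi psi_out) add0r ZI /Z /psi.
  by rewrite Sab Sbb Saa Sba; ring.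
(* A primitive of the majorant: its increment over [a, b] is exactly the bound sought. *)
pose Y t := eta * (Sa t + Sb t) + (d * t + 0).
have sY : smooth Y.
  by apply: smoothD => //; apply: smoothM; [exact: smooth_cst|exact: smoothD].
have Y'E t : derive1 Y t = eta * (derive1 Sa t + derive1 Sb t) + d.
  apply: derive1_is_derive.
  exact: (derD (derZ eta (derD (smooth_is_derive sSa t) (smooth_is_derive sSb t))) (der_affine d 0 t)).
have YI := Rintegral_derive1 ab (smooth_is_derive sY) (smooth_continuous (smooth_derive1 sY)).
have ih : lebesgue_measure.-integrable `[a, b] (EFin \o h).
  apply: continuous_integrable_itv => x xab; apply: cvgD; first exact: cw.
  exact/smooth_continuous/smooth_derive1.
rewrite -hI (le_trans (le_normr_Rintegral _ ih))//.
have -> : 2 * eta + d * (b - a) = Y b - Y a by rewrite /Y Sab Sbb Saa Sba; ring.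
rewrite -YI; apply: le_Rintegral => //.
- exact: (integrable_norm ih).
- by apply: continuous_integrable_itv => x _; exact/smooth_continuous/smooth_derive1.
move=> t /=; rewrite in_itv/= => /andP[at_ tb].
have -> : h t = derive1 Sa t * (G t - G a) - derive1 Sb t * (G t - G b) - psi t * (g t - c).
  by rewrite /h Z'E psi'E /G; ring.
rewrite Y'E.
have b1 : `|derive1 Sa t * (G t - G a)| <= eta * derive1 Sa t.
  rewrite normrM ger0_norm// mulrC.
  have [tae|tae] := leP t (a + eps).
    by rewrite ler_wpM2r// distrC; apply: ha; exact: near_a.
  rewrite dSa S'out ?mul0r ?mulr0//; right.
  exact: far_a.
have b2 : `|derive1 Sb t * (G t - G b)| <= eta * derive1 Sb t.
  rewrite normrM ger0_norm// mulrC.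
  have [tae|tae] := leP (b - eps) t.
    by rewrite ler_wpM2r// distrC; apply: hb; exact: near_b.
  rewrite dSb S'out ?mul0r ?mulr0//; left.
  exact: far_b.
have b3 : `|psi t * (g t - c)| <= d.
  have /andP[p0 p1] := psi01 t.
  have tab : a <= t <= b by rewrite at_.
  rewrite normrM ger0_norm// (le_trans _ (gd _ tab))//.
  by rewrite ler_piMl.
rewrite [eta * _]mulrDr.
apply: le_trans (ler_normB _ _) _; apply: lerD => //.
exact: le_trans (ler_normB _ _) (lerD b1 b2).
Unshelve. all: by end_near. Qed.

End TestFunctions.

(** * Confined measures *)

Section Confined.
Context {R : realType} (K : R) (K0 : 0 < K).
Implicit Types (f g h : R -> R) (x y a b c p : R) (al be : borel_measure R).

(* Precomposing with [clamp] makes continuous integrands bounded without changing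
   their integrals against measures confined to [-K, K]. *)
Definition clamp x := Num.max (- K) (Num.min K x).

Lemma clamp_bound x : - K <= clamp x <= K.
Proof. have nK : - K <= K by move: K0; lra.
by rewrite /clamp le_max lexx/= ge_max nK ge_min lexx. Qed.

Lemma clamp_id x : - K <= x <= K -> clamp x = x.
Proof.
by move=> /andP[h1 h2]; rewrite /clamp min_r// max_r.
Qed.

Lemma clamp_continuous : continuous clamp.
Proof.
move=> x; apply: (@continuous_max _ _ (cst (- K)) (fun x => Num.min K x)).
  exact: cvg_cst.
by apply: (@continuous_min _ _ (cst K) id); [exact: cvg_cst|exact: cvg_id].
Qed.

Lemma clamp_lip x y : `|clamp x - clamp y| <= `|x - y|.
Proof.
wlog xy : x y / x <= y => [wl|].
  have [|/ltW] := leP x y; first exact: wl.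
  by move=> yx; rewrite distrC [leRHS]distrC; exact: wl.
have := K0; rewrite /clamp !maxEle !minEle.
by do ![case: ifPn => /negP]; rewrite ?(distrC x) ?(@ger0_norm _ (y - x)) ?subr_ge0//;
  move=> *; rewrite ler_norml; lra.
Qed.

(** Confinement is recorded as a null set, the form that integrals see; [msupport_confined] derives
    it from the support. *)
Definition confined p al := al setT = p%:E /\ al (~` `[- K, K]) = 0%E.

Lemma continuous_bounded h a b : continuous h ->
  exists2 M : R, 0 <= M & forall x, a <= x <= b -> `|h x| <= M.
Proof.
move=> ch; have [ab|ba] := leP a b; last first.
  by exists 0 => // x; lra.
have cn : {within `[a, b], continuous (fun x => `|h x|)}.
  by apply: continuous_subspaceT => x; apply: cvg_norm; exact: ch.
have [c _ hc] := EVT_max ab cn.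
by exists `|h c| => // x xab; apply: hc; rewrite in_itv.
Qed.

Lemma bounded_integrable d (T : measurableType d) (al : {measure set T -> \bar R})
    (f : T -> R) (p M : R) : al setT = p%:E -> measurable_fun setT f ->
  (forall x : T, `|f x| <= M) -> al.-integrable setT (EFin \o f).
Proof.
move=> alp mf fM; apply: measurable_bounded_integrable => //.
  by rewrite alp ltry.
exists M; split; first exact: num_real.
by move=> N MN x _; exact: le_trans (fM x) (ltW MN).
Qed.

Lemma continuous_measurable f : continuous f ->
  measurable_fun (setT : set (measurableTypeR R)) f.
Proof. exact: continuous_measurable_fun. Qed.

Section ConfinedMeasure.
Variables (p : R) (al : borel_measure R).
Hypothesis al_conf : confined p al.

Lemma confined_ae f g : (forall x, - K <= x <= K -> f x = g x) ->
  ae_eq al setT (EFin \o f) (EFin \o g).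
Proof.
move=> fg; exists (~` `[- K, K]); split.
- by apply: measurableC; exact: measurable_itv.
- exact: al_conf.2.
- move=> x /= nx; rewrite in_itv/= => xK; apply: nx => _.
  by rewrite fg.
Qed.

Lemma integrable_clamp f : continuous f ->
  al.-integrable setT (EFin \o (fun x => f (clamp x))).
Proof.
move=> cf; have [M _ fM] := @continuous_bounded f (- K) K cf.
apply: (bounded_integrable al_conf.1) => [|x]; last exact/fM/clamp_bound.
apply: continuous_measurable => x.
by apply: continuous_comp; [exact: clamp_continuous|exact: cf].
Qed.

Lemma confined_integrable f : continuous f -> al.-integrable setT (EFin \o f).
Proof.
move=> cf; apply/integrableP; split.
  by apply/measurable_EFinP; exact: continuous_measurable.
have /integrableP[m1 lt1] := integrable_clamp cf.
apply: le_lt_trans lt1; apply: ae_ge0_le_integral => //.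
- by apply: measurableT_comp => //; apply/measurable_EFinP; exact: continuous_measurable.
- exact: measurableT_comp.
have [A [mA A0 AS]] := @confined_ae f (fun x => f (clamp x)) (fun x xK => congr1 f (esym (clamp_id xK))).
exists A; split => // x /= nx; apply: AS => /= e; apply: nx => _.
by move: (e I) => [->].
Qed.

Lemma eq_confined f g : continuous f -> continuous g ->
  (forall x, - K <= x <= K -> f x = g x) -> \int[al]_x f x = \int[al]_x g x.
Proof.
move=> cf cg fg; rewrite /Rintegral; congr fine; apply: ae_eq_integral => //.
- by apply/measurable_EFinP; exact: continuous_measurable.
- by apply/measurable_EFinP; exact: continuous_measurable.
- exact: confined_ae.
Qed.

Lemma Rintegral_clamp f : continuous f -> \int[al]_x f x = \int[al]_x f (clamp x).
Proof.
move=> cf; apply: eq_confined => //.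
  by move=> x; apply: continuous_comp; [exact: clamp_continuous|exact: cf].
by move=> x xK; rewrite clamp_id.
Qed.

Lemma le_confined f g : continuous f -> continuous g ->
  (forall x, - K <= x <= K -> f x <= g x) -> \int[al]_x f x <= \int[al]_x g x.
Proof.
move=> cf cg fg; rewrite (Rintegral_clamp cf) (Rintegral_clamp cg).
apply: le_Rintegral => //; [exact: integrable_clamp|exact: integrable_clamp|].
by move=> x _; exact/fg/clamp_bound.
Qed.

Lemma mass_ge0 : 0 <= p.
Proof. by rewrite -lee_fin -al_conf.1 measure_ge0. Qed.

Lemma Rintegral_cstT c : \int[al]_x c = c * p.
Proof. by rewrite Rintegral_cst// al_conf.1. Qed.

Lemma RintegralDc f g : continuous f -> continuous g ->
  \int[al]_x (f x + g x) = \int[al]_x f x + \int[al]_x g x.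
Proof. by move=> cf cg; rewrite RintegralD//; exact: confined_integrable. Qed.

Lemma RintegralBc f g : continuous f -> continuous g ->
  \int[al]_x (f x - g x) = \int[al]_x f x - \int[al]_x g x.
Proof. by move=> cf cg; rewrite RintegralB//; exact: confined_integrable. Qed.

Lemma RintegralZc c f : continuous f -> \int[al]_x (c * f x) = c * \int[al]_x f x.
Proof. by move=> cf; rewrite RintegralZl//; exact: confined_integrable. Qed.

Lemma Rintegral_bound f (M : R) : continuous f ->
  (forall x, - K <= x <= K -> `|f x| <= M) -> `|\int[al]_x f x| <= M * p.
Proof.
move=> cf fM; rewrite ler_norml -mulNr -!Rintegral_cstT.
have cc (c : R) : continuous (fun _ : R => c) by move=> x; exact: cvg_cst.
by rewrite !le_confined// => x /fM; rewrite ler_norml => /andP[].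
Qed.

Lemma Rintegral_sum n (f : 'I_n -> R -> R) : (forall i, continuous (f i)) ->
  \int[al]_x (\sum_i f i x) = \sum_i \int[al]_x f i x.
Proof.
move=> cf; have cs k (F : 'I_k -> R -> R) : (forall i, continuous (F i)) ->
    continuous (fun x => \sum_i F i x).
  elim: k F => [|k ih] F cF.
    by under eq_fun do rewrite big_ord0; move=> x; exact: cvg_cst.
  under eq_fun do rewrite big_ord_recr/=.
  by move=> x; apply: cvgD; [apply: ih => i; exact: cF|exact: cF].
elim: n f cf => [|n ih] f cf.
  rewrite big_ord0; under eq_Rintegral do rewrite big_ord0.
  by rewrite Rintegral_cstT mul0r.
under eq_Rintegral do rewrite big_ord_recr/=.
by rewrite RintegralDc//; [rewrite ih// big_ord_recr|exact: cs].
Qed.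

Lemma continuous_shift_comp h x : continuous h -> continuous (fun y => h (x - y)).
Proof.
move=> ch y; apply: (@continuous_comp _ _ _ (fun y => x - y) h); last exact: ch.
by apply: cvgB; [exact: cvg_cst|exact: cvg_id].
Qed.

Lemma continuous_shift_comp' h y : continuous h -> continuous (fun x => h (x - y)).
Proof.
move=> ch x; apply: (@continuous_comp _ _ _ (fun x => x - y) h); last exact: ch.
by apply: cvgB; [exact: cvg_id|exact: cvg_cst].
Qed.

Lemma Rintegral_shift_clamp h x : continuous h ->
  \int[al]_y h (x - y) = \int[al]_y h (x - clamp y).
Proof. by move=> ch; rewrite -(Rintegral_clamp (@continuous_shift_comp h x ch)). Qed.

Lemma shift_integrable h x : continuous h ->
  al.-integrable setT (EFin \o (fun y => h (x - clamp y))).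
Proof.
by move=> ch; apply: (integrable_clamp (f := fun y => h (x - y))); exact: continuous_shift_comp.
Qed.

(** The constant [M] is the dominating function for passing to the limit and differentiating under
    the integral: [x] stays within 1 of [a], and [clamp y] in [-K, K]. *)
Lemma shift_bounded h a : continuous h -> exists2 M : R, 0 <= M &
  forall x y, `]a - 1, a + 1[%classic x -> `|h (x - clamp y)| <= M.
Proof.
move=> ch.
have [M M0 hM] := @continuous_bounded h (a - 1 - K) (a + 1 + K) ch.
exists M => // x y /=; rewrite in_itv/= => /andP[x1 x2].
by apply: hM; have := clamp_bound y; lra.
Qed.

Lemma continuous_conv h : continuous h ->
  continuous (fun x => \int[al]_y h (x - y)).
Proof.
move=> ch a.
rewrite (_ : (fun x => _) = (fun x => \int[al]_y h (x - clamp y))); last first.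
  by apply/funext => x; exact: Rintegral_shift_clamp.
have [M M0 hM] := shift_bounded a ch.
apply: (@continuity_under_integral R _ _ al (fun x y => h (x - clamp y)) setT
  measurableT (a - 1) (a + 1) _ _ (fun=> M)).
- by move=> x _; exact: shift_integrable.
- apply: aeW => y _ x _; exact: continuous_shift_comp'.
- by apply: (bounded_integrable al_conf.1 _ (M := M)) => // x; rewrite ger0_norm.
- by move=> x xI; apply: aeW => y _; exact: hM.
- by rewrite inE/= in_itv/=; lra.
Qed.

Lemma is_derive_conv h x : (forall x, derivable h x 1) -> continuous (derive1 h) ->
  is_derive x 1 (fun x => \int[al]_y h (x - y)) (\int[al]_y derive1 h (x - y)).
Proof.
move=> dh ch'; have ch := derivable_cont dh.
rewrite (_ : (fun x => _) = (fun x => \int[al]_y h (x - clamp y))); last first.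
  by apply/funext => x'; exact: Rintegral_shift_clamp.
rewrite (Rintegral_shift_clamp x ch').
have dc (z y : R) : is_derive z 1 (fun x => h (x - y)) (derive1 h (z - y)).
  have := @der_comp _ h (fun x => 1 * x + - y) z _ _ (is_derive_derive1 (dh _)) (der_affine 1 (- y) z).
  by rewrite mulr1; under eq_fun do rewrite mul1r; rewrite mul1r.
have [M M0 hM] := shift_bounded x ch'.
have xI : `]x - 1, x + 1[%classic x by rewrite /= in_itv/=; lra.
have intf z : `]x - 1, x + 1[%classic z -> al.-integrable setT (EFin \o (fun y => h (z - clamp y))).
  by move=> _; exact: shift_integrable.
have derf z y : `]x - 1, x + 1[%classic z -> [set: R] y -> derivable (fun x => h (x - clamp y)) z 1.
  by move=> _ _; have [] := dc z (clamp y).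
have intM : al.-integrable setT (EFin \o (fun=> M)).
  by apply: (bounded_integrable al_conf.1 _ (M := M)) => // z; rewrite ger0_norm.
have ub z y : `]x - 1, x + 1[%classic z -> [set: R] y -> `|derive1 (fun x => h (x - clamp y)) z| <= M.
  by move=> zI _; rewrite (derive1_is_derive (dc z (clamp y))) hM.
have d1 := @derivable_under_integral R _ _ al (fun x y => h (x - clamp y)) setT measurableT
  x (x - 1) (x + 1) xI intf derf (fun=> M) (fun=> M0) intM ub.
have d2 := @differentiation_under_integral R _ _ al (fun x y => h (x - clamp y)) setT measurableT
  x (x - 1) (x + 1) xI intf derf (fun=> M) (fun=> M0) intM ub.
rewrite (_ : \int[al]_y derive1 h (x - clamp y) = derive1 (fun x => \int[al]_y h (x - clamp y)) x).
  exact: is_derive_derive1.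
rewrite d2; apply: eq_Rintegral => y _.
by rewrite /partial1of2 (derive1_is_derive (dc x (clamp y))).
Qed.

End ConfinedMeasure.
End Confined.

(** * Couplings *)

Section Transport.
Context {R : realType} (K : R) (K0 : 0 < K).
Implicit Types (f g h : R -> R) (x y a b c p : R) (al be : borel_measure R).

(** A point outside the support lies in a null ball with rational centre and radius. There are
    countably many such balls, so their union is null. *)
Lemma msupport_confined p al : al setT = p%:E ->
  msupport al `<=` `[- K, K] -> confined K p al.
Proof.
move=> alp supp; split => //.
(* An enumeration of the rational balls in which those of positive measure are replaced by the empty
   set, so that every [F k] is negligible. *)
pose F (k : nat) : set (measurableTypeR R) :=
  if unpickle k is Some qr then
    let B := ball (ratr (qr : rat * rat).1 : R) (ratr qr.2) in
    if `[< al B = 0%E >] then B else set0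
  else set0.
have F0 k : al.-negligible (F k).
  rewrite /F; case: unpickle => [[q r]|]; last exact: negligible_set0.
  case: asboolP => [B0|_]; last exact: negligible_set0.
  exists (ball (ratr q : R) (ratr r)); split => //=.
  exact: measurable_ball.
have [A [mA A0 FA]] := negligible_bigcup F0.
apply/eqP; rewrite eq_le measure_ge0 andbT -A0; apply: le_measure; rewrite ?inE//.
  by apply: measurableC; exact: measurable_itv.
apply: subset_trans FA => x /= xK.
have : ~ msupport al x by move=> /supp.
move=> /existsNP [e] /not_implyP [e0 /negP]; rewrite -leNgt => Be.
(* With the centre within e/4 of [x] and the radius between e/4 and e/2, the rational ball contains
   [x] and lies inside the null ball of radius [e]. *)
have [q] := @rat_in_itvoo R (x - e / 4) (x + e / 4) ltac:(lra).
rewrite in_itv/= => /andP[q1 q2].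
have [r] := @rat_in_itvoo R (e / 4) (e / 2) ltac:(lra).
rewrite in_itv/= => /andP[r1 r2].
have B0 : al (ball (ratr q : R) (ratr r)) = 0%E.
  apply/eqP; rewrite eq_le measure_ge0 andbT (le_trans _ Be)//.
  apply: le_measure; rewrite ?inE; [exact: measurable_ball..|].
  move=> z /=; rewrite /ball/= => qz.
  rewrite (_ : x - z = (x - ratr q) + (ratr q - z)); last by ring.
  apply: le_lt_trans (ler_normD _ _) _.
  have : `|x - ratr q| < e / 4 by rewrite ltr_norml; apply/andP; split; lra.
  lra.
exists (pickle (q, r)); first by [].
rewrite /F pickleK/= asboolT// /ball/= ltr_norml; apply/andP; split; lra.
Qed.

Definition lip_on (L : R) f := forall x y, - K <= x <= K -> - K <= y <= K ->
  `|f x - f y| <= L * `|x - y|.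

Lemma clamp_nearest x w : - K <= w <= K -> `|x - clamp K x| <= `|x - w|.
Proof.
have k0 := K0; move=> /andP[w1 w2]; rewrite /clamp maxEle minEle.
case: (leP K x) => [Kx|xK].
  have -> : (- K <= K) = true by lra.
  by rewrite !ger0_norm; lra.
case: (leP (- K) x) => [Kx|Kx]; first by rewrite subrr normr0.
by rewrite !ler0_norm; lra.
Qed.

Section coupling.
Variables (al be : borel_measure R) (ga : borel_measure2 R).
Hypothesis cga : coupling al be ga.

Lemma coupling_mass : ga setT = al setT.
Proof. by rewrite -(cga measurableT).1 setXTT. Qed.

Lemma ge0_integral_coupling1 (f : R -> \bar R) :
  measurable_fun (setT : set (measurableTypeR R)) f -> (forall x, 0 <= f x)%E ->
  (\int[ga]_z f z.1 = \int[al]_x f x)%E.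
Proof.
move=> mf f0.
rewrite -(@ge0_integral_pushforward _ _ _ _ R fst measurable_fst ga setT f)//.
by apply: eq_measure_integral => A mA _; rewrite /pushforward -(cga mA).1; congr (ga _); apply/seteqP; split => [z//|z []//].
Qed.

Lemma ge0_integral_coupling2 (f : R -> \bar R) :
  measurable_fun (setT : set (measurableTypeR R)) f -> (forall x, 0 <= f x)%E ->
  (\int[ga]_z f z.2 = \int[be]_x f x)%E.
Proof.
move=> mf f0.
rewrite -(@ge0_integral_pushforward _ _ _ _ R snd measurable_snd ga setT f)//.
by apply: eq_measure_integral => A mA _; rewrite /pushforward -(cga mA).2; congr (ga _); apply/seteqP; split => [z//|z []//].
Qed.

Lemma Rintegral_coupling1 f p (M : R) : al setT = p%:E ->
  measurable_fun (setT : set (measurableTypeR R)) f -> (forall x, `|f x| <= M) ->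
  \int[ga]_z f z.1 = \int[al]_x f x.
Proof.
move=> alp mf fM; congr fine.
rewrite -(@integral_pushforward _ _ _ _ R fst measurable_fst ga setT (EFin \o f))//.
- by apply: eq_measure_integral => A mA _; rewrite /pushforward -(cga mA).1; congr (ga _); apply/seteqP; split => [z//|z []//].
- exact/measurable_EFinP.
- rewrite preimage_setT; apply: (@bounded_integrable _ _ _ ga (fun z => f z.1) p M) => //.
    by rewrite coupling_mass.
  by apply: measurableT_comp => //; exact: measurable_fst.
Qed.

Lemma Rintegral_coupling2 f p (M : R) : al setT = p%:E ->
  measurable_fun (setT : set (measurableTypeR R)) f -> (forall x, `|f x| <= M) ->
  \int[ga]_z f z.2 = \int[be]_x f x.
Proof.
move=> alp mf fM; congr fine.
rewrite -(@integral_pushforward _ _ _ _ R snd measurable_snd ga setT (EFin \o f))//.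
- by apply: eq_measure_integral => A mA _; rewrite /pushforward -(cga mA).2; congr (ga _); apply/seteqP; split => [z//|z []//].
- exact/measurable_EFinP.
- rewrite preimage_setT; apply: (@bounded_integrable _ _ _ ga (fun z => f z.2) p M) => //.
    by rewrite coupling_mass.
  by apply: measurableT_comp => //; exact: measurable_snd.
Qed.

(* The easy half of Kantorovich-Rubinstein duality. *)
Lemma coupling_lip f p (L c : R) : 0 <= L -> confined K p al -> confined K p be ->
  continuous f -> lip_on L f ->
  (\int[ga]_z (`|z.1 - z.2|)%:E <= c%:E)%E ->
  `|\int[al]_x f x - \int[be]_x f x| <= L * c.
Proof.
move=> L0 hal hbe cf lf gac.
rewrite (Rintegral_clamp hal cf) (Rintegral_clamp hbe cf).
have [M _ fM] := @continuous_bounded R f (- K) K cf.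
pose fc x := f (clamp K x).
have cfc : continuous fc.
  by move=> x; apply: continuous_comp; [exact: clamp_continuous|exact: cf].
have mfc := continuous_measurable cfc.
have fcM x : `|fc x| <= M by exact/fM/clamp_bound.
have gap : ga setT = p%:E by rewrite coupling_mass hal.1.
have m1 : measurable_fun setT (fun z : measurableTypeR R * measurableTypeR R => fc z.1).
  by apply: measurableT_comp => //; exact: measurable_fst.
have m2 : measurable_fun setT (fun z : measurableTypeR R * measurableTypeR R => fc z.2).
  by apply: measurableT_comp => //; exact: measurable_snd.
rewrite -(Rintegral_coupling1 hal.1 mfc fcM) -(Rintegral_coupling2 hal.1 mfc fcM).
have i1 := bounded_integrable gap m1 (fun z => fcM z.1).
have i2 := bounded_integrable gap m2 (fun z => fcM z.2).
rewrite -RintegralB//.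
have i12 : ga.-integrable setT (EFin \o (fun z => fc z.1 - fc z.2)).
  by have := integrableB measurableT i1 i2; apply: eq_integrable.
rewrite -lee_fin EFin_normr_Rintegral//.
apply: le_trans (le_abse_integral _ _ _) _ => //.
  by have /integrableP[] := i12.
have mn : measurable_fun setT (fun z : measurableTypeR R * measurableTypeR R => (`|z.1 - z.2|)%:E).
  apply/measurable_EFinP; apply: measurableT_comp => //.
  by apply: measurable_funB; [exact: measurable_fst|exact: measurable_snd].
apply: (@le_trans _ _ (\int[ga]_z (L%:E * (`|z.1 - z.2|)%:E))%E).
  apply: ge0_le_integral => //.
  - by apply: measurableT_comp => //; have /integrableP[] := i12.
  - exact: measurable_funeM.
  - move=> z _; rewrite /= lee_fin (le_trans (lf _ _ (clamp_bound K0 _) (clamp_bound K0 _)))//.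
    by rewrite ler_wpM2l// clamp_lip.
rewrite ge0_integralZl_EFin//.
by rewrite EFinM lee_wpmul2l.
Qed.

End coupling.

(** [clamp K x] is the point of [-K, K] nearest to [x], so the integral is the mean distance from
    the interval, and its integrand is positive off the interval. *)
Lemma coupling_confined p al be : confined K p al ->
  (\int[be]_x (`|x - clamp K x|)%:E = 0)%E -> be setT = p%:E -> confined K p be.
Proof.
move=> hal be0 bep; split => //.
have mc : measurable_fun setT (fun x : measurableTypeR R => (`|x - clamp K x|)%:E).
  apply/measurable_EFinP; apply: continuous_measurable => x.
  by apply: cvg_norm; apply: cvgB; [exact: cvg_id|exact: clamp_continuous].
have : (\int[be]_x `|(`|x - clamp K x|)%:E| = 0)%E.
  by rewrite -be0; apply: eq_integral => x _; rewrite gee0_abs// lee_fin.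
move/(ae_eq_integral_abs be measurableT mc).
move=> [A [mA A0 AS]]; apply/eqP; rewrite eq_le measure_ge0 andbT -A0.
apply: le_measure; rewrite ?inE//.
  by apply: measurableC; exact: measurable_itv.
move=> x /= xK; apply: AS => /= /(_ I) [] /eqP; rewrite normr_eq0 subr_eq0 => /eqP e.
by apply: xK; rewrite in_itv/= e clamp_bound.
Qed.

(** Pointwise |y - clamp y| <= |y - clamp x| <= |y - x| + |x - clamp x|, and the last term
    integrates to zero because [al] is confined. *)
Lemma coupling_dist_clamp p al be (ga : borel_measure2 R) (c : R) :
  confined K p al -> coupling al be ga ->
  (\int[ga]_z (`|z.1 - z.2|)%:E <= c%:E)%E ->
  (\int[be]_x (`|x - clamp K x|)%:E <= c%:E)%E.
Proof.
move=> hal cga; apply: le_trans.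
have mc : measurable_fun setT (fun x : measurableTypeR R => (`|x - clamp K x|)%:E).
  apply/measurable_EFinP; apply: continuous_measurable => x.
  by apply: cvg_norm; apply: cvgB; [exact: cvg_id|exact: clamp_continuous].
have p0 x : (0 <= (`|x - clamp K x|)%:E)%E by rewrite lee_fin.
have mn : measurable_fun setT (fun z : measurableTypeR R * measurableTypeR R => (`|z.1 - z.2|)%:E).
  apply/measurable_EFinP; apply: measurableT_comp => //.
  by apply: measurable_funB; [exact: measurable_fst|exact: measurable_snd].
rewrite -(ge0_integral_coupling2 cga mc p0).
have -> : (\int[ga]_z (`|z.1 - z.2|)%:E = \int[ga]_z ((`|z.1 - z.2|)%:E + (`|z.1 - clamp K z.1|)%:E))%E.
  rewrite ge0_integralD//; last first.
  - by apply: (measurableT_comp mc); exact: measurable_fst.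
  rewrite (ge0_integral_coupling1 cga mc p0).
  rewrite [X in (_ + X)%E](_ : _ = 0%E) ?adde0//.
  rewrite (@ae_eq_integral _ _ _ al setT (cst 0%E))//; first by rewrite integral0.
  apply: (confined_ae hal (f := fun x => `|x - clamp K x|) (g := cst 0)) => x xK.
  by rewrite clamp_id// subrr normr0.
apply: ge0_le_integral => //.
- by apply: (measurableT_comp mc); exact: measurable_snd.
- by apply: emeasurable_funD => //; apply: (measurableT_comp mc); exact: measurable_fst.
- move=> z _; rewrite -EFinD lee_fin.
  have h1 : `|z.2 - clamp K z.2| <= `|z.2 - clamp K z.1|.
    exact/clamp_nearest/clamp_bound.
  apply: le_trans h1 _.
  rewrite (_ : z.2 - clamp K z.1 = (z.2 - z.1) + (z.1 - clamp K z.1)); last by ring.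
  by rewrite [`|z.1 - z.2|]distrC ler_normD.
Qed.

(** Only the values of [h] on [-2K, 2K] matter. Clamping to this interval gives a bounded kernel,
    integrable for the product measure. *)
Lemma Fubini_conv p q al be h : confined K p al -> confined K q be -> continuous h ->
  \int[be]_y (\int[al]_x h (x - y)) = \int[al]_x (\int[be]_y h (x - y)).
Proof.
move=> hal hbe ch.
pose hc x := h (clamp (2 * K) x).
have K20 : 0 < 2 * K by rewrite mulr_gt0.
have chc : continuous hc.
  by move=> x; apply: continuous_comp; [exact: clamp_continuous|exact: ch].
have [M _ hM] := @continuous_bounded R h (- (2 * K)) (2 * K) ch.
have hcM x : `|hc x| <= M by exact/hM/clamp_bound.
have hE x y : - K <= x <= K -> - K <= y <= K -> h (x - y) = hc (x - y).
  by move=> ? ?; rewrite /hc clamp_id//; lra.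
have crev f y : continuous f -> continuous (fun x : R => f (x - y)).
  exact: continuous_shift_comp'.
have crev2 f x : continuous f -> continuous (fun y : R => f (x - y)).
  exact: continuous_shift_comp.
have cflip f : continuous f -> continuous (fun y => \int[al]_x f (x - y)).
  move=> cf; have cN : continuous (fun x => f (- x)).
    by move=> x; apply: continuous_comp; [exact: opp_continuous|exact: cf].
  have := continuous_conv K0 hal cN.
  by under eq_fun do under eq_Rintegral do rewrite opprB.
have -> : \int[be]_y (\int[al]_x h (x - y)) = \int[be]_y (\int[al]_x hc (x - y)).
  apply: (eq_confined hbe); [exact: cflip|exact: cflip|] => y yK.
  apply: (eq_confined hal); [exact: crev|exact: crev|] => x xK.
  exact: hE.
have -> : \int[al]_x (\int[be]_y h (x - y)) = \int[al]_x (\int[be]_y hc (x - y)).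
  apply: (eq_confined hal); [exact: continuous_conv hbe _ _|exact: continuous_conv hbe _ _|] => x xK.
  apply: (eq_confined hbe); [exact: crev2|exact: crev2|] => y yK.
  exact: hE.
have fin1 (m : borel_measure R) r : m setT = r%:E -> fin_num_fun m.
  move=> mr A mA; rewrite ge0_fin_numE// (@le_lt_trans _ _ (m setT))//.
    by apply: le_measure; rewrite ?inE.
  by rewrite mr ltry.
have fin (m : borel_measure R) (r : R) : m setT = r%:E -> (m setT < +oo)%E.
  by move=> ->; rewrite ltry.
(* Restriction to the whole space changes no value on measurable sets but equips the measures with
   the finiteness structure that [Fubini] expects. *)
pose m1 := mfrestr measurableT (fin _ _ hal.1).
pose m2 := mfrestr measurableT (fin _ _ hbe.1).
have m1E (f : R -> \bar R) : (\int[m1]_x f x = \int[al]_x f x)%E.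
  by apply: eq_measure_integral => A mA _; rewrite /m1/= /mfrestr/= /mrestr setIT.
have m2E (f : R -> \bar R) : (\int[m2]_x f x = \int[be]_x f x)%E.
  by apply: eq_measure_integral => A mA _; rewrite /m2/= /mfrestr/= /mrestr setIT.
have mh : measurable_fun setT (fun z : measurableTypeR R * measurableTypeR R => (hc (z.1 - z.2))%:E).
  apply/measurable_EFinP; apply: (measurableT_comp (continuous_measurable chc)).
  by apply: measurable_funB; [exact: measurable_fst|exact: measurable_snd].
have ih : (m1 \x m2)%E.-integrable setT (fun z : measurableTypeR R * measurableTypeR R => (hc (z.1 - z.2))%:E).
  apply: (@bounded_integrable _ _ _ (m1 \x m2)%E (fun z => hc (z.1 - z.2)) (p * q) M) => //.
    transitivity ((m1 \x m2)%E (setT `*` setT)); first by rewrite setXTT.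
    rewrite (@product_measure1E _ _ _ _ R m1 m2)// /m1 /m2 /= /mfrestr /mrestr !setIT.
    by rewrite hal.1 hbe.1.
  exact/measurable_EFinP.
have := Fubini ih => /=.
rewrite m1E m2E.
under eq_integral do rewrite m2E.
under [X in _ = X -> _]eq_integral do rewrite m1E.
have EE (m m' : borel_measure R) (r : R) (F : R -> R -> R) : confined K r m ->
  (forall x, continuous (F x)) -> (\int[m']_x (\int[m]_y (F x y)%:E) = \int[m']_x (\int[m]_y (F x y))%:E)%E.
  move=> hm cF; apply: eq_integral => x _; rewrite /Rintegral fineK//.
  by apply: integrable_fin_num => //; exact: (confined_integrable K0 hm).
rewrite (EE be al q (fun x y => hc (x - y)) hbe) => [|x]; last exact: crev2.
rewrite (EE al be p (fun y x => hc (x - y)) hal) => [|y]; last exact: crev.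
by move=> E; congr fine.
Qed.
End Transport.

(** * Distances between measures seen through Lipschitz functions *)

Section Closeness.
Context {R : realType} (K : R) (K0 : 0 < K).
Implicit Types (f g h : R -> R) (x y a b c p q d e : R) (al be : borel_measure R).

(* Closeness in the dual of Lipschitz functions: [dist_W1] and [dist_P] enter the
   estimates only through this quantity. *)
Definition lip_close d al be := forall L f, 0 <= L -> continuous f ->
  lip_on K L f -> `|\int[al]_x f x - \int[be]_x f x| <= L * d.

Lemma measurable_dist2 : measurable_fun setT
  (fun z : measurableTypeR R * measurableTypeR R => `|z.1 - z.2| : R).
Proof.
apply: measurableT_comp => //.
by apply: measurable_funB; [exact: measurable_fst|exact: measurable_snd].
Qed.

Lemma transport_cost_ge0 (c : R -> R -> R) al be : (forall x y, 0 <= c x y) ->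
  (0 <= transport_cost c al be)%E.
Proof.
move=> c0; apply: le_ereal_inf_tmp => _ [ga _ <-].
by apply: integral_ge0 => z _; rewrite lee_fin.
Qed.

Lemma transport_cost_coupling (c : R -> R -> R) al be e :
  (transport_cost c al be < e%:E)%E ->
  exists2 ga, coupling al be ga & (\int[ga]_z (c z.1 z.2)%:E <= e%:E)%E.
Proof.
by move=> /ereal_inf_lt [_ [ga cga <-] /ltW ?]; exists ga.
Qed.

(* By AM-GM, [|x - y| <= |x - y| ^+ 2 / q + q], which is integrated against a
   coupling. *)
Lemma cost2_lip_close al be p q c : 0 < q -> confined K p al -> confined K p be ->
  (transport_cost (fun x y => `|x - y| ^+ 2)%R al be < (c * q ^+ 2)%:E)%E ->
  lip_close (q * (c + p)) al be.
Proof.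
move=> q0 hal hbe /transport_cost_coupling [ga cga gac] L f L0 cf lf.
have p0 : 0 <= p by exact: mass_ge0 hal.
have c0 : 0 <= c.
  have : (0%:E <= (c * q ^+ 2)%:E)%E.
    by apply: le_trans gac; apply: integral_ge0 => z _; rewrite lee_fin exprn_ge0.
  by rewrite lee_fin pmulr_lge0// exprn_gt0.
apply: (coupling_lip K0 cga L0 hal hbe cf lf).
apply: (@le_trans _ _ (\int[ga]_z ((q^-1)%:E * (`|z.1 - z.2| ^+ 2)%:E + q%:E)))%E.
  apply: ge0_le_integral => //.
  - by apply/measurable_EFinP; exact: measurable_dist2.
  - apply: emeasurable_funD => //; apply: measurable_funeM.
    by apply/measurable_EFinP; apply: measurable_funX; exact: measurable_dist2.
  - move=> z _; rewrite -EFinM -EFinD lee_fin.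
    set t := `|_|.
    rewrite mulrC -lerBlDr ler_pdivlMr// -subr_ge0.
    rewrite [X in 0 <= X](_ : _ = (t - q / 2) ^+ 2 + 3 / 4 * q ^+ 2); last by field.
    by rewrite addr_ge0 ?sqr_ge0// mulr_ge0 ?sqr_ge0.
have gap : ga setT = p%:E by rewrite (coupling_mass cga) hal.1.
have md : measurable_fun setT (fun z : measurableTypeR R * measurableTypeR R => (`|z.1 - z.2| ^+ 2)%:E).
  by apply/measurable_EFinP; apply: measurable_funX; exact: measurable_dist2.
have q'0 : 0 <= q^-1 by rewrite invr_ge0 ltW.
rewrite ge0_integralD//; do ?[exact: measurable_funeM|by move=> z _; rewrite lee_fin ltW|
  by move=> z _; rewrite mule_ge0// lee_fin exprn_ge0].
rewrite ge0_integralZl_EFin//.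
rewrite integral_cst// gap mulrDr EFinD EFinM leeD//.
apply: (@le_trans _ _ ((q^-1)%:E * (c * q ^+ 2)%:E)%E).
  by rewrite lee_wpmul2l// lee_fin invr_ge0 ltW.
rewrite -!EFinM lee_fin (_ : q^-1 * _ = q * c)//; field; exact: lt0r_neq0.
Qed.

Lemma W1_lip_close al be p e : confined K p al -> confined K p be ->
  (dist_W1 al be < e%:E)%E -> lip_close e al be.
Proof.
move=> hal hbe /transport_cost_coupling [ga cga gac] L f L0 cf lf.
exact: (coupling_lip K0 cga L0 hal hbe cf lf).
Qed.

(** The mean distance of [be] from [-K, K] is at most the cost of transport from any confined
    measure of the same mass, hence at most every [e]. *)
Lemma W1_confined al be p : confined K p al -> be setT = p%:E ->
  (forall e, 0 < e -> exists2 al, confined K p al & (dist_W1 al be < e%:E)%E) ->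
  confined K p be.
Proof.
move=> hal bep close; apply: (coupling_confined K0 hal _ bep).
apply/eqP; rewrite eq_le; apply/andP; split; last first.
  by apply: integral_ge0 => x _; rewrite lee_fin.
apply/lee_addgt0Pr => e' e0; rewrite add0e.
have [al' hal' /transport_cost_coupling [ga cga gac]] := close _ e0.
exact: (coupling_dist_clamp K0 hal' cga gac).
Qed.

(** The weighted sum of costs is at most [q ^+ 2], so the [i]-th cost is at most [m i * q ^+ 2]. The
    [+ 1] gives the strict inequality needed to pick a coupling, and [p i] is the mass term of the
    AM-GM bound. *)
Lemma dist_P_lip_close n (m p : 'I_n -> R) (mu nu : 'I_n -> borel_measure R) q :
  (forall i, 0 < m i) -> 0 < q ->
  (forall i, confined K (p i) (mu i)) -> (forall i, confined K (p i) (nu i)) ->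
  (dist_P m mu nu <= q%:E)%E ->
  forall i, lip_close (q * (m i + 1 + p i)) (mu i) (nu i).
Proof.
move=> m0 q0 hmu hnu dq i.
apply: cost2_lip_close => //.
set cost := fun j => transport_cost (fun x y => `|x - y| ^+ 2) (mu j) (nu j).
have cost0 j : (0 <= cost j)%E.
  by apply: transport_cost_ge0 => x y; rewrite exprn_ge0.
have S0 : (0 <= \sum_j (m j)^-1%:E * cost j)%E.
  by apply: sume_ge0 => j _; rewrite mule_ge0// lee_fin invr_ge0 ltW.
have S2 : (\sum_j (m j)^-1%:E * cost j <= (q ^+ 2)%:E)%E.
  have -> : (\sum_j (m j)^-1%:E * cost j = ((\sum_j (m j)^-1%:E * cost j) `^ 2^-1) `^ 2)%E.
    by rewrite -poweRrM mulVf ?pnatr_eq0// poweRe1.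
  have -> : ((q ^+ 2)%:E = q%:E `^ 2)%E by rewrite poweR_EFin powR_mulrn// ltW.
  apply: gt0_ler_poweR => //; rewrite ?in_itv/= ?andbT ?leey ?poweR_ge0//.
  by rewrite lee_fin ltW.
have : ((m i)^-1%:E * cost i <= (q ^+ 2)%:E)%E.
  apply: le_trans S2; rewrite (bigD1 i)//= leeDl// sume_ge0// => j _.
  by rewrite mule_ge0// lee_fin invr_ge0 ltW.
rewrite lee_pdivrMl// => h; apply: le_lt_trans h _.
by rewrite -EFinM lte_fin mulrDl mul1r ltrDl exprn_gt0.
Qed.

(** Young's inequality |f| <= q f^2 + 1/q is integrated; the free weight [q] later makes the first
    term small before the interval is shortened for the second. *)
Lemma L2_integral_le (f : R -> R) (T C s t q : R) :
  measurable_fun (`[0, T] : set (measurableTypeR R)) f ->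
  (\int[lebesgue_measure]_(r in `[0%R, T]) ((f r) ^+ 2)%:E <= C%:E)%E ->
  0 <= s -> s <= t -> t <= T -> 0 < q ->
  (\int[lebesgue_measure]_(r in `[s, t]) (f r)%:E <= (q * C + q^-1 * (t - s))%:E)%E.
Proof.
move=> mf fC s0 st tT q0.
have sub : `[s, t] `<=` `[0, T].
  by move=> x /=; rewrite !in_itv/= => /andP[sx xt]; rewrite (le_trans s0 sx) (le_trans xt).
have mf' : measurable_fun (`[s, t] : set (measurableTypeR R)) f.
  by apply: measurable_funS mf => //; exact: measurable_itv.
apply: le_trans (lee_abs _) _.
apply: le_trans (le_abse_integral _ _ _) _ => //; first exact/measurable_EFinP.
apply: (@le_trans _ _ (\int[lebesgue_measure]_(r in `[s, t]) (q%:E * ((f r) ^+ 2)%:E + (q^-1)%:E))%E).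
  apply: ge0_le_integral => //.
  - by apply: measurableT_comp => //; exact/measurable_EFinP.
  - apply: emeasurable_funD => //; apply: measurable_funeM.
    by apply/measurable_EFinP; exact: measurable_funX.
  - move=> x _; rewrite -EFinM -EFinD lee_fin.
    have -> : f x ^+ 2 = `|f x| ^+ 2 by rewrite real_normK ?num_real.
    rewrite -(ler_pM2l q0) mulrDr mulfV ?gt_eqF// -subr_ge0.
    rewrite [X in 0 <= X](_ : _ = (q * `|f x| - 1 / 2) ^+ 2 + 3 / 4); last by field.
    by rewrite addr_ge0 ?sqr_ge0.
have md : measurable_fun (`[s, t] : set (measurableTypeR R)) (fun r => ((f r) ^+ 2)%:E).
  by apply/measurable_EFinP; exact: measurable_funX.
rewrite ge0_integralD//; last 3 first.
- by move=> z _; rewrite mule_ge0// lee_fin ?(ltW q0)// sqr_ge0.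
- exact: measurable_funeM.
- by move=> z _; rewrite lee_fin invr_ge0 ltW.
rewrite ge0_integralZl_EFin//; last 2 first.
- by move=> z _; rewrite lee_fin sqr_ge0.
- exact: ltW.
rewrite integral_cst//= lebesgue_measure_itv/= EFinD EFinM; apply: leeD.
  rewrite lee_wpmul2l ?lee_fin ?(ltW q0)//; apply: le_trans fC.
  apply: ge0_subset_integral => //.
    by apply/measurable_EFinP; exact: measurable_funX.
  by move=> z _; rewrite lee_fin sqr_ge0.
rewrite lte_fin; case: ltP => st'; first by rewrite -EFinB -EFinM.
by rewrite mule0 lee_fin mulr_ge0 ?invr_ge0 ?(ltW q0)// subr_ge0.
Qed.

Lemma AC2_lip_close n (m p : 'I_n -> R) E (mu : R -> 'I_n -> borel_measure R) (t0 e : R) :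
  (forall i, 0 < m i) -> (forall i, 0 < p i) ->
  AC2_loc m p E mu -> (forall t, 0 <= t -> forall i, confined K (p i) (mu t i)) ->
  0 < t0 -> 0 < e ->
  exists2 d : R, 0 < d & forall t, `|t - t0| < d -> 0 < t /\
     forall i, lip_close e (mu t i) (mu t0 i).
Proof.
move=> m0 p0 [_ AC] conf t00 e0.
have [f [mf fC fd]] := AC (t0 + 1) (ltr_wpDr ler01 t00).
set C := (\int[lebesgue_measure]_(r in `[0%R, (t0 + 1)%R]) ((f r) ^+ 2)%:E)%E in fC.
have C0 : (0 <= C)%E by apply: integral_ge0 => x _; rewrite lee_fin sqr_ge0.
pose Cr := fine C.
have CE : C = Cr%:E by rewrite fineK// ge0_fin_numE.
have Cr0 : 0 <= Cr by rewrite fine_ge0.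
pose M := \sum_i (m i + 1 + p i) + 1.
have Mi i : m i + 1 + p i <= M.
  rewrite /M (bigD1 i)//= -[leRHS]addrA lerDl addr_ge0// sumr_ge0// => j _.
  by rewrite !addr_ge0// ltW.
have M0 : 0 < M.
  by rewrite ltr_wpDl// sumr_ge0// => j _; rewrite !addr_ge0// ltW.
pose q := e / M.
have q0 : 0 < q by rewrite divr_gt0.
(* The weight [r] bounds the L^2 term by [q / 2]. In [d] below, [q * r / 2] does the same for the
   length term, [t0 / 2] keeps times positive and 1 keeps them below [t0 + 1]. *)
pose r := q / (2 * (Cr + 1)).
have r0 : 0 < r by rewrite divr_gt0// mulr_gt0// ltr_wpDl.
have rC : r * Cr <= q / 2.
  rewrite /r mulrAC ler_pdivrMr ?mulr_gt0 ?ltr_wpDl//.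
  have -> : q / 2 * (2 * (Cr + 1)) = q * Cr + q by field.
  by rewrite lerDl ltW.
pose d := Num.min (t0 / 2) (Num.min 1 (q * r / 2)).
have qr0 : 0 < q * r / 2 by rewrite divr_gt0// mulr_gt0.
have d0 : 0 < d by rewrite !lt_min qr0 ltr01 divr_gt0.
have [d1 [d2 d3]] : d <= t0 / 2 /\ d <= 1 /\ d <= q * r / 2.
  by rewrite /d !ge_min !lexx ?orbT.
exists d => // t; rewrite ltr_norml => /andP[td1 td2].
have t1 : 0 < t by lra.
split=> // i L g L0 cg lg.
have small s u : 0 <= s -> s <= u -> u <= t0 + 1 -> u - s <= d ->
    (dist_P m (mu s) (mu u) <= q%:E)%E.
  move=> s0 su uT us; apply: le_trans (fd _ _ s0 su uT) _.
  have CE' : (C <= Cr%:E)%E by rewrite CE.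
  apply: le_trans (L2_integral_le mf CE' s0 su uT r0) _.
  rewrite lee_fin (_ : q = q / 2 + q / 2); last by field.
  rewrite lerD// mulrC ler_pdivrMr//; lra.
have res : lip_close (q * (m i + 1 + p i)) (mu t i) (mu t0 i).
  have [tt|tt] := leP t t0.
    by apply: dist_P_lip_close => // [j|j|]; [exact/conf/ltW|exact/conf/ltW|apply: small; lra].
  move=> L' g' L0' cg' lg'; rewrite distrC.
  apply: (@dist_P_lip_close n m p (mu t0) (mu t) q) => // [j|j|]; [exact/conf/ltW|exact/conf/ltW|apply: small; lra].
apply: le_trans (res L g L0 cg lg) _.
rewrite ler_wpM2l// /q mulrAC ler_pdivrMr// ler_wpM2l// ltW//.
Qed.
End Closeness.

(** * Velocity and dissipation *)

Section Velocity.
Context {R : realType} {n : nat} (m p : 'I_n -> R) (W : R -> 'M[R]_n) (K : R).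
Hypotheses (K0 : 0 < K) (m0 : forall i, 0 < m i) (p0 : forall i, 0 < p i).
Hypothesis dW : forall i j z, derivable (W_entry W i j) z 1.
Hypothesis cW' : forall i j, continuous (derive1 (W_entry W i j)).
Implicit Types (mu nu : 'I_n -> borel_measure R) (x y z : R) (i j : 'I_n).

Definition velocity mu i x : R :=
  m i * \sum_j \int[mu j]_y derive1 (W_entry W i j) (x - y).

Definition potential mu i x : R := \sum_j \int[mu j]_y W_entry W i j (x - y).

Definition dissipation mu : R :=
  \sum_i (m i)^-1 * \int[mu i]_x (velocity mu i x * velocity mu i x).

Definition confined_family mu := forall i, confined K (p i) (mu i).

Definition family_close (d : R) mu nu := forall i, lip_close K d (mu i) (nu i).

Lemma lip_closexx (d : R) (al : borel_measure R) : 0 <= d -> lip_close K d al al.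
Proof. by move=> d0 L f L0 _ _; rewrite subrr normr0 mulr_ge0. Qed.

Lemma lip_closeC (d : R) (al be : borel_measure R) : lip_close K d al be -> lip_close K d be al.
Proof. by move=> h L f L0 cf lf; rewrite distrC; exact: h. Qed.

Lemma lip_close_le (d e : R) (al be : borel_measure R) : d <= e -> lip_close K d al be ->
  lip_close K e al be.
Proof.
by move=> de h L f L0 cf lf; apply: le_trans (h _ _ L0 cf lf) _; rewrite ler_wpM2l.
Qed.

Lemma continuous_sum k (F : 'I_k -> R -> R) : (forall l, continuous (F l)) ->
  continuous (fun x => \sum_l F l x).
Proof.
elim: k F => [|k ih] F cF.
  by under eq_fun do rewrite big_ord0; move=> x; exact: cvg_cst.
under eq_fun do rewrite big_ord_recr/=.
by move=> x; apply: cvgD; [apply: ih => l; exact: cF|exact: cF].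
Qed.

Lemma continuousMf (f g : R -> R) : continuous f -> continuous g ->
  continuous (fun x => f x * g x).
Proof. by move=> cf cg x; apply: cvgM; [exact: cf|exact: cg]. Qed.

Lemma continuousDf (f g : R -> R) : continuous f -> continuous g ->
  continuous (fun x => f x + g x).
Proof. by move=> cf cg x; apply: cvgD; [exact: cf|exact: cg]. Qed.

Lemma continuousBf (f g : R -> R) : continuous f -> continuous g ->
  continuous (fun x => f x - g x).
Proof. by move=> cf cg x; apply: cvgB; [exact: cf|exact: cg]. Qed.

Lemma continuousZf (c : R) (f : R -> R) : continuous f -> continuous (fun x => c * f x).
Proof. by move=> cf x; apply: cvgM; [exact: cvg_cst|exact: cf]. Qed.

Lemma velocity_continuous mu i : confined_family mu -> continuous (velocity mu i).
Proof.
move=> hmu; apply: continuousZf; apply: continuous_sum => j.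
by apply: (continuous_conv K0 (hmu j)); exact: cW'.
Qed.

Lemma is_derive_sumf k (F G : 'I_k -> R -> R) x :
  (forall l, is_derive x 1 (F l) (G l x)) ->
  is_derive x 1 (fun x => \sum_l F l x) (\sum_l G l x).
Proof.
elim: k F G => [|k ih] F G dF.
  by rewrite big_ord0; under eq_fun do rewrite big_ord0; exact: der_cst.
rewrite big_ord_recr/=; under eq_fun do rewrite big_ord_recr/=.
apply: (derD (ih (fun l => F (widen_ord (leqnSn k) l)) (fun l => G (widen_ord (leqnSn k) l)) _) (dF _)).
Qed.

Lemma is_derive_potential mu i x : confined_family mu ->
  is_derive x 1 (potential mu i) ((m i)^-1 * velocity mu i x).
Proof.
move=> hmu; rewrite /velocity mulrA mulVf ?gt_eqF// mul1r.
apply: (@is_derive_sumf n (fun j x => \int[mu j]_y W_entry W i j (x - y))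
  (fun j x => \int[mu j]_y derive1 (W_entry W i j) (x - y))) => j.
exact: (is_derive_conv K0 (hmu j)).
Qed.

Hypothesis W'lip : exists2 L : R, 0 <= L & forall i j x y, - (2 * K) <= x <= 2 * K ->
  - (2 * K) <= y <= 2 * K ->
  `|derive1 (W_entry W i j) x - derive1 (W_entry W i j) y| <= L * `|x - y|.

(** For [x] in [-K, K] the kernel y |-> W_ij'(x - y) is bounded by [B] and [L]-Lipschitz on [-K, K].
    The bound controls the velocity, the Lipschitz estimate its variation in [x], and it also admits
    the kernel as a test function in [lip_close]. One constant [C] covers all three, with the total
    mass and the number of species as factors. *)
Lemma velocity_estimates : exists C : R, [/\ 0 <= C,
  (forall mu, confined_family mu -> forall i x, - K <= x <= K -> `|velocity mu i x| <= C),
  (forall mu, confined_family mu -> forall i, lip_on K C (velocity mu i)) &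
  (forall mu nu (d : R), confined_family mu -> confined_family nu -> 0 <= d ->
     family_close d mu nu -> forall i x, - K <= x <= K ->
     `|velocity mu i x - velocity nu i x| <= C * d)].
Proof.
have [L L0 lW] := W'lip.
have [B B0 hB] : exists2 B : R, 0 <= B & forall i j z, - (2 * K) <= z <= 2 * K ->
    `|derive1 (W_entry W i j) z| <= B.
  have Bij (ij : 'I_n * 'I_n) : exists B : R, 0 <= B /\ forall z, - (2 * K) <= z <= 2 * K ->
      `|derive1 (W_entry W ij.1 ij.2) z| <= B.
    by have [B B0 hB] := continuous_bounded (- (2 * K)) (2 * K) (@cW' ij.1 ij.2); exists B.
  have [Bf hBf] := choice Bij.
  exists (\sum_ij Bf ij); first by apply: sumr_ge0 => ij _; case: (hBf ij).
  move=> i j z zK; apply: le_trans ((hBf (i, j)).2 z zK) _.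
  by rewrite (bigD1 (i, j))//= lerDl sumr_ge0// => ij _; case: (hBf ij).
pose M := \sum_i m i; pose P := \sum_i p i.
have M0 : 0 <= M by apply: sumr_ge0 => i _; exact: ltW.
have P0 : 0 <= P by apply: sumr_ge0 => i _; exact: ltW.
have mM i : m i <= M by rewrite /M (bigD1 i)//= lerDl sumr_ge0// => j _; exact: ltW.
pose C := M * ((B + L) * (P + n%:R)).
have C0 : 0 <= C by rewrite !mulr_ge0// addr_ge0.
have aux i (F : 'I_n -> R) (G : R) : 0 <= G -> `|\sum_j F j| <= G -> `|m i * \sum_j F j| <= M * G.
  by move=> G0 h; rewrite normrM ger0_norm ?(ltW (m0 i))// ler_pM// ltW.
have sub2 x y : - K <= x <= K -> - K <= y <= K -> - (2 * K) <= x - y <= 2 * K by lra.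
have sc x i j : continuous (fun y => derive1 (W_entry W i j) (x - y)).
  by apply: continuous_shift_comp; exact: cW'.
have BLP : 0 <= (B + L) * (P + n%:R) by rewrite mulr_ge0// addr_ge0.
exists C; split => //.
- move=> mu hmu i x xK; apply: aux => //.
  apply: le_trans (ler_norm_sum _ _ _) _.
  apply: (@le_trans _ _ (\sum_j B * p j)).
    apply: ler_sum => j _; apply: (Rintegral_bound K0 (hmu j)) => [|y yK]; first exact: sc.
    exact/hB/sub2.
  by rewrite -mulr_sumr ler_pM ?lerDl.
- move=> mu hmu i x y xK yK.
  rewrite /velocity -mulrBr -sumrB /C -[leRHS]mulrA; apply: aux; first by rewrite mulr_ge0.
  apply: le_trans (ler_norm_sum _ _ _) _.
  apply: (@le_trans _ _ (\sum_j (L * `|x - y|) * p j)).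
    apply: ler_sum => j _; rewrite -(RintegralBc K0 (hmu j)); [|exact: sc..].
    apply: (Rintegral_bound K0 (hmu j)) => [|z zK]; first by apply: continuousBf; exact: sc.
    rewrite (_ : x - y = (x - z) - (y - z)); last by ring.
    by apply: lW; exact: sub2.
  rewrite -mulr_sumr mulrAC ler_wpM2r// ler_pM ?lerDl ?lerDr//.
- move=> mu nu d hmu hnu d0 cl i x xK.
  rewrite /velocity -mulrBr -sumrB /C -[leRHS]mulrA; apply: aux; first by rewrite mulr_ge0.
  apply: le_trans (ler_norm_sum _ _ _) _.
  apply: (@le_trans _ _ (\sum_(j < n) L * d)).
    apply: ler_sum => j _; apply: cl => //.
    move=> y z yK zK.
    apply: le_trans (lW i j (x - y) (x - z) (sub2 _ _ xK yK) (sub2 _ _ xK zK)) _.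
    by rewrite (_ : x - y - (x - z) = - (y - z)) ?normrN//; ring.
  rewrite sumr_const card_ord -[L * d *+ n]mulr_natr (mulrAC L d) ler_wpM2r// ler_pM ?lerDl ?lerDr//.
Qed.

Variable C : R.
Hypotheses (C0 : 0 <= C)
  (Vb : forall mu, confined_family mu -> forall i x, - K <= x <= K -> `|velocity mu i x| <= C)
  (Vl : forall mu, confined_family mu -> forall i, lip_on K C (velocity mu i))
  (Vd : forall mu nu (d : R), confined_family mu -> confined_family nu -> 0 <= d ->
     family_close d mu nu -> forall i x, - K <= x <= K ->
     `|velocity mu i x - velocity nu i x| <= C * d).

Lemma norm_bilin_le (a b c d A B A' B' : R) : `|a| <= A -> `|b| <= B -> `|c| <= A' -> `|d| <= B' ->
  `|a * b + c * d| <= A * B + A' * B'.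
Proof.
move=> ha hb hc hd; apply: le_trans (ler_normD _ _) _; rewrite !normrM.
by apply: lerD; apply: ler_pM.
Qed.

Lemma lip_onM (f g : R -> R) (Bf Bg Lf Lg : R) : 0 <= Bf -> 0 <= Bg ->
  (forall x, - K <= x <= K -> `|f x| <= Bf) -> (forall x, - K <= x <= K -> `|g x| <= Bg) ->
  lip_on K Lf f -> lip_on K Lg g -> lip_on K (Bf * Lg + Bg * Lf) (fun x => f x * g x).
Proof.
move=> Bf0 Bg0 bf bg lf lg x y xK yK.
rewrite (_ : f x * g x - f y * g y = f x * (g x - g y) + g y * (f x - f y)); last by ring.
apply: le_trans (ler_normD _ _) _; rewrite !normrM mulrDl -!mulrA.
by apply: lerD; apply: ler_pM => //; [exact: bf|exact: lg|exact: bg|exact: lf].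
Qed.

(** The integrating measure and the two velocity fields vary separately because the energy expansion
    takes them at different times. Changing the fields costs [2 * C ^+ 2 * p i * d]; changing the
    measure costs [2 * C ^+ 2 * d], the product of two fields being Lipschitz with constant
    [2 * C ^+ 2]. *)
Lemma dissipation_pair_close al al' mu mu' nu nu' (d : R) i : 0 <= d ->
  confined_family al -> confined_family al' -> confined_family mu ->
  confined_family mu' -> confined_family nu -> confined_family nu' ->
  family_close d al al' -> family_close d mu mu' -> family_close d nu nu' ->
  `|\int[al i]_x (velocity mu i x * velocity nu i x) -
    \int[al' i]_x (velocity mu' i x * velocity nu' i x)| <= 2 * C ^+ 2 * (p i + 1) * d.
Proof.
move=> d0 hal hal' hmu hmu' hnu hnu' cal cmu cnu.
have c1 : continuous (fun x => velocity mu i x * velocity nu i x).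
  by apply: continuousMf; exact: velocity_continuous.
have c2 : continuous (fun x => velocity mu' i x * velocity nu' i x).
  by apply: continuousMf; exact: velocity_continuous.
rewrite -(subrK (\int[al i]_x (velocity mu' i x * velocity nu' i x)) (\int[al i]_x (velocity mu i x * velocity nu i x))).
rewrite -addrA; apply: le_trans (ler_normD _ _) _.
rewrite mulrDr mulr1 mulrDl; apply: lerD.
  rewrite -(RintegralBc K0 (hal i))// mulrAC; apply: (Rintegral_bound K0 (hal i)); first exact: continuousBf.
  move=> x xK.
  rewrite (_ : velocity mu i x * velocity nu i x - velocity mu' i x * velocity nu' i x =
    velocity mu i x * (velocity nu i x - velocity nu' i x) + velocity nu' i x * (velocity mu i x - velocity mu' i x)); last by ring.
  rewrite (_ : 2 * C ^+ 2 * d = C * (C * d) + C * (C * d)); last by ring.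
  by apply: norm_bilin_le; [exact: Vb|exact: Vd|exact: Vb|exact: Vd].
have -> : 2 * C ^+ 2 = C * C + C * C by ring.
apply: cal => //; first by rewrite addr_ge0// mulr_ge0.
by apply: lip_onM => //; [exact: Vb|exact: Vb|exact: Vl|exact: Vl].
Qed.

Lemma dissipation_close : exists2 C' : R, 0 <= C' & forall mu nu (d : R), 0 <= d ->
  confined_family mu -> confined_family nu -> family_close d mu nu ->
  `|dissipation mu - dissipation nu| <= C' * d.
Proof.
exists (\sum_i (m i)^-1 * (2 * C ^+ 2 * (p i + 1))).
  apply: sumr_ge0 => i _; rewrite !mulr_ge0 ?sqr_ge0//; first by rewrite invr_ge0 ltW.
  by rewrite addr_ge0// ltW.
move=> mu nu d d0 hmu hnu cl.
rewrite /dissipation -sumrB mulr_suml; apply: le_trans (ler_norm_sum _ _ _) _.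
apply: ler_sum => i _; rewrite -mulrBr normrM ger0_norm ?invr_ge0 ?(ltW (m0 i))// -[leRHS]mulrA.
rewrite ler_wpM2l ?invr_ge0 ?(ltW (m0 i))//.
exact: dissipation_pair_close.
Qed.

Lemma dissipation_ge0 mu : 0 <= dissipation mu.
Proof.
apply: sumr_ge0 => i _; rewrite mulr_ge0 ?invr_ge0 ?(ltW (m0 i))//.
by apply: Rintegral_ge0 => x _; rewrite -expr2 sqr_ge0.
Qed.

End Velocity.

(** * Evolution of the measures and of the energy *)

Section Flow.
Context {R : realType} {n : nat} (m p : 'I_n -> R) (W : R -> 'M[R]_n) (K : R).
Hypotheses (K0 : 0 < K) (m0 : forall i, 0 < m i) (p0 : forall i, 0 < p i).
Hypothesis dW : forall i j z, derivable (W_entry W i j) z 1.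
Hypothesis cW' : forall i j, continuous (derive1 (W_entry W i j)).
Variable C : R.
Hypotheses (C0 : 0 <= C)
  (Vb : forall mu, confined_family p K mu -> forall i x, - K <= x <= K -> `|velocity m W mu i x| <= C)
  (Vl : forall mu, confined_family p K mu -> forall i, lip_on K C (velocity m W mu i))
  (Vd : forall mu nu (d : R), confined_family p K mu -> confined_family p K nu -> 0 <= d ->
     family_close K d mu nu -> forall i x, - K <= x <= K ->
     `|velocity m W mu i x - velocity m W nu i x| <= C * d).
Variable mu : R -> 'I_n -> borel_measure R.
Hypothesis confp : forall t, 0 < t -> confined_family p K (mu t).
Hypothesis mu_cont : forall t0 e : R, 0 < t0 -> 0 < e ->
  exists2 d : R, 0 < d & forall t, `|t - t0| < d ->
    0 < t /\ family_close K e (mu t) (mu t0).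
Hypothesis sol : distributional_solution m W mu.
Implicit Types (f q : R -> R) (i j : 'I_n) (s t : R).

Lemma lip_onZDZ f q (k A B : R) : 0 <= k -> lip_on K A f -> lip_on K B q ->
  lip_on K (k * A + k * B) (fun x => k * f x + k * q x).
Proof.
move=> k0 lf lq x y xK yK.
rewrite (_ : _ - _ = k * (f x - f y) + k * (q x - q y)); last by ring.
have kn : `|k| <= k by rewrite ger0_norm.
by rewrite mulrDl -!mulrA; apply: norm_bilin_le => //; [exact: lf|exact: lq].
Qed.

Lemma between_dist s t r : Num.min s t <= r -> r <= Num.max s t -> `|r - s| <= `|t - s|.
Proof.
rewrite ge_min le_max; have [st|ts] := leP s t.
  rewrite (@ger0_norm _ (t - s)) ?subr_ge0// => h1 h2.
  by rewrite ger0_norm; move: h1 h2 => /orP[] ? /orP[] ?; lra.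
rewrite (@ler0_norm _ (t - s)) ?subr_le0 ?(ltW ts)// => h1 h2.
by rewrite ler0_norm; move: h1 h2 => /orP[] ? /orP[] ?; lra.
Qed.

Lemma flow_velocity_continuous i t : 0 < t -> continuous (velocity m W (mu t) i).
Proof. by move=> t0; exact: (@velocity_continuous _ _ m p W K K0 cW' _ i (confp t0)). Qed.

Lemma flow_continuous f i (t0 L : R) : 0 < t0 -> 0 <= L -> continuous f -> lip_on K L f ->
  {for t0, continuous (fun t => \int[mu t i]_x f x)}.
Proof.
move=> t00 L0 cf lf; apply/cvgrPdist_le => e e0.
have e'0 : 0 < e / (L + 1) by rewrite divr_gt0// ltr_wpDl.
have [d d0 hd] := mu_cont t00 e'0.
apply/nbhs_ballP; exists d => //= t; rewrite /ball/= distrC => td.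
have [_ /(_ i L f L0 cf lf) h] := hd _ td.
rewrite distrC (le_trans h)// mulrA ler_pdivrMr ?ltr_wpDl// mulrDr mulr1 mulrC lerDl ltW//.
Qed.

Lemma flow_continuous_velocity q i (t0 B L : R) : 0 < t0 -> 0 <= B -> 0 <= L -> continuous q ->
  (forall x, - K <= x <= K -> `|q x| <= B) -> lip_on K L q ->
  {for t0, continuous (fun t => \int[mu t i]_x (q x * velocity m W (mu t) i x))}.
Proof.
move=> t00 B0 L0 cq qB lq; apply/cvgrPdist_le => e e0.
pose A := B * C * p i + (B * C + C * L).
have A0 : 0 <= A by rewrite !addr_ge0 ?mulr_ge0// ltW.
have e'0 : 0 < e / (A + 1) by rewrite divr_gt0// ltr_wpDl.
have [d d0 hd] := mu_cont t00 e'0.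
set e' := e / (A + 1) in e'0 hd.
apply/nbhs_ballP; exists d => //= t; rewrite /ball/= distrC => td.
have [t1 cl] := hd _ td.
have ht := confp t1; have ht0 := confp t00.
have cq1 s : 0 < s -> continuous (fun x => q x * velocity m W (mu s) i x).
  by move=> s0; apply: continuousMf => //; exact: flow_velocity_continuous.
rewrite distrC.
rewrite -(subrK (\int[mu t i]_x (q x * velocity m W (mu t0) i x)) (\int[mu t i]_x (q x * velocity m W (mu t) i x))).
rewrite -addrA; apply: le_trans (ler_normD _ _) _.
have h1 : `|\int[mu t i]_x (q x * velocity m W (mu t) i x) - \int[mu t i]_x (q x * velocity m W (mu t0) i x)| <= B * C * p i * e'.
  rewrite -(RintegralBc K0 (ht i)); [|exact: cq1..].
  rewrite mulrAC; apply: (Rintegral_bound K0 (ht i)); first by apply: continuousBf; exact: cq1.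
  move=> x xK; rewrite -mulrBr normrM -mulrA ler_pM//; first exact: qB.
  by apply: Vd => //; exact: ltW.
have h2 : `|\int[mu t i]_x (q x * velocity m W (mu t0) i x) - \int[mu t0 i]_x (q x * velocity m W (mu t0) i x)| <= (B * C + C * L) * e'.
  apply: cl; [by rewrite addr_ge0// mulr_ge0|exact: cq1|].
  by apply: lip_onM => //; [exact: Vb|exact: Vl].
apply: le_trans (lerD h1 h2) _.
rewrite -mulrDl -/A /e' mulrA ler_pdivrMr ?ltr_wpDl// mulrDr mulr1 mulrC lerDl ltW//.
Qed.

(** The test function is a time profile times [q] cut off outside [-K, K], a cutoff that confined
    measures do not notice. Comparing the flux with a constant [c] up to [d] replaces its integral
    over time. *)
Lemma weak_balance_smooth q i (a b c d : R) : 0 < a -> a < b -> smooth q ->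
  (forall r, a <= r <= b -> `|\int[mu r i]_x (derive1 q x * velocity m W (mu r) i x) - c| <= d) ->
  `|\int[mu b i]_x q x - \int[mu a i]_x q x + c * (b - a)| <= d * (b - a).
Proof.
move=> a0 ab sq gd.
have sq' := smooth_derive1 sq.
have cq := smooth_continuous sq; have cq' := smooth_continuous sq'.
have cq'' := smooth_continuous (smooth_derive1 sq').
have [B B0 hB] := continuous_bounded (- K) K cq'.
have [L L0 hL] := continuous_bounded (- K) K cq''.
have lq : lip_on K B q by move=> x y; exact: (mvt_bound (smooth_derivable sq) hB).
have lq' : lip_on K L (derive1 q) by move=> x y; exact: (mvt_bound (smooth_derivable sq') hL).
apply: (@weak_derivative_bound _ (fun t => \int[mu t i]_x q x)
  (fun t => \int[mu t i]_x (derive1 q x * velocity m W (mu t) i x))) => //.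
- by move=> t /andP[ta _]; apply: (@flow_continuous _ _ _ B) => //; exact: lt_le_trans ta.
- by move=> t /andP[ta _]; apply: (@flow_continuous_velocity _ _ _ B L) => //; exact: lt_le_trans ta.
move=> psi spsi psi0.
have [chi schi [chi1 chi0]] := smooth_cutoff K0.
pose theta x := chi x * q x.
have stheta : smooth theta by exact: smoothM.
have theta0 x : x \notin `[- (K + 2), K + 2] -> theta x = 0.
  by move=> /chi0 e; rewrite /theta e mul0r.
have theta1 x : - K <= x <= K -> theta x = q x /\ derive1 theta x = derive1 q x.
  move=> xK; have [e1 e2] := chi1 _ xK.
  rewrite /theta e1 mul1r; split => //; apply: derive1_is_derive.
  have := derM (smooth_is_derive schi x) (smooth_is_derive sq x).
  by rewrite e1 e2 mul1r mulr0 addr0.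
have test := test_function_tensor a0 spsi stheta psi0 theta0.
have := sol i test.
rewrite (partial_t_tensor _ spsi) (partial_x_tensor _ stheta) /tensor/=.
have inner t : 0 < t ->
  (\int[mu t i]_x (derive1 psi t * theta x - m i * (psi t * derive1 theta x) *
     \sum_j \int[mu t j]_y derive1 (W_entry W i j) (x - y))%:E =
   (derive1 psi t * (\int[mu t i]_x q x) - psi t * \int[mu t i]_x (derive1 q x * velocity m W (mu t) i x))%:E)%E.
  move=> t1; have ht := confp t1.
  have cV := @flow_velocity_continuous i _ t1.
  have cq'V := continuousMf cq' cV.
  have ct := smooth_continuous stheta; have ct' := smooth_continuous (smooth_derive1 stheta).
  have -> : (fun x => (derive1 psi t * theta x - m i * (psi t * derive1 theta x) *
     \sum_j \int[mu t j]_y derive1 (W_entry W i j) (x - y))%:E) =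
     EFin \o (fun x => derive1 psi t * theta x - psi t * (derive1 theta x * velocity m W (mu t) i x)).
    apply/funext => x /=; congr EFin; rewrite /velocity; ring.
  have cc : continuous (fun x => derive1 psi t * theta x - psi t * (derive1 theta x * velocity m W (mu t) i x)).
    by apply: continuousBf; apply: continuousZf => //; exact: continuousMf.
  rewrite -[LHS]fineK; last by apply: integrable_fin_num => //; exact: (confined_integrable K0 (ht i)).
  congr EFin; rewrite -[LHS]/(\int[mu t i]_x (derive1 psi t * theta x - psi t * (derive1 theta x * velocity m W (mu t) i x))).
  rewrite -!(RintegralZc K0 (ht i))// -(RintegralBc K0 (ht i)); [|exact: continuousZf..].
  apply: (eq_confined (ht i)) => //; first by apply: continuousBf; exact: continuousZf.
  by move=> x /theta1 [-> ->].
move=> E; transitivity (fine (0%E : \bar R)) => //.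
rewrite [LHS]/Rintegral; congr (fine _); rewrite -[RHS]E.
(* The two time domains are reconciled by extension by zero: outside [a, b] both [psi] and its
   derivative vanish. *)
rewrite integral_mkcond [RHS]integral_mkcond; apply: eq_integral => t _.
rewrite !patchE.
have dpsi0 (x : R) : x \notin `[a, b] -> derive1 psi x = 0.
  move=> xab; apply: derive1_is_derive; apply: eq_near_derive (der_cst 0 x).
  move: xab; rewrite in_itv/= negb_and -!ltNge => /orP[xa|bx].
    near=> y; apply: psi0; rewrite in_itv/= negb_and -!ltNge.
    by apply/orP; left; near: y; exact: lt_nbhsl.
  near=> y; apply: psi0; rewrite in_itv/= negb_and -!ltNge.
  by apply/orP; right; near: y; exact: lt_nbhsr.
case: ifPn => tab.
  rewrite ifT; last first.
    by move: tab; rewrite !inE/= !in_itv/= andbT => /andP[at_ _]; exact: lt_le_trans at_.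
  by rewrite inner//; move: tab; rewrite inE/= in_itv/= => /andP[at_ _]; exact: lt_le_trans at_.
case: ifPn => // t1.
rewrite inner; last by move: t1; rewrite inE/= in_itv/= andbT.
move: tab; rewrite notin_setE/= => /negP tab.
by rewrite psi0// dpsi0// !mul0r subr0.
Unshelve. all: by end_near. Qed.

(** A C^1 approximation of [q] on [-K, K] by smooth functions suffices, since the measures live
    there and only [q] and its first derivative appear in the balance. *)
Lemma weak_balance q i s t (c d L : R) : 0 < s -> s <= t -> 0 <= L ->
  (forall x, derivable q x 1) -> continuous (derive1 q) -> lip_on K L (derive1 q) ->
  (forall r, s <= r <= t -> `|\int[mu r i]_x (derive1 q x * velocity m W (mu r) i x) - c| <= d) ->
  `|\int[mu t i]_x q x - \int[mu s i]_x q x + c * (t - s)| <= d * (t - s).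
Proof.
move=> s0; rewrite le_eqVlt => /predU1P[->|st] L0 dq cq' lq' gd.
  by rewrite !subrr !mulr0 addr0 normr0.
have t0 : 0 < t by exact: lt_trans st.
have cq := derivable_cont dq.
apply/ler_addgt0Pr => e e0.
(* [A] collects the errors per unit of [e']: that of the flux over the time span, and [K * p i] at
   each end time. *)
pose A := C * p i * (t - s) + 2 * (K * p i).
have ts : 0 < t - s by rewrite subr_gt0.
have A0 : 0 < A by rewrite ltr_wpDl ?mulr_ge0 ?(ltW ts) ?(ltW (p0 i))// !mulr_gt0.
have e'0 : 0 < e / A by exact: divr_gt0.
set e' := e / A in e'0.
have [f [sf f1 f2]] := smooth_C1_approx K0 e'0 L0 dq lq'.
have cf := smooth_continuous sf; have cf' := smooth_continuous (smooth_derive1 sf).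
have close r : 0 < r -> `|\int[mu r i]_x f x - \int[mu r i]_x q x| <= e' * K * p i.
  move=> r0; rewrite -(RintegralBc K0 (confp r0 i))//.
  by apply: (Rintegral_bound K0 (confp r0 i)) => //; exact: continuousBf.
have bal : `|\int[mu t i]_x f x - \int[mu s i]_x f x + c * (t - s)| <= (d + e' * C * p i) * (t - s).
  apply: weak_balance_smooth => // r /andP[sr rt].
  have r0 : 0 < r by exact: lt_le_trans sr.
  have cV := @flow_velocity_continuous i _ r0.
  have h1 : `|\int[mu r i]_x (derive1 f x * velocity m W (mu r) i x) - \int[mu r i]_x (derive1 q x * velocity m W (mu r) i x)| <= e' * C * p i.
    rewrite -(RintegralBc K0 (confp r0 i)); [|exact: continuousMf..].
    apply: (Rintegral_bound K0 (confp r0 i)); first by apply: continuousBf; exact: continuousMf.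
    move=> x xK; rewrite -mulrBl normrM ler_pM//; first exact: f1.
    by apply: Vb => //; exact: confp.
  have h2 := gd r; rewrite sr rt in h2.
  rewrite -(subrK (\int[mu r i]_x (derive1 q x * velocity m W (mu r) i x)) (\int[mu r i]_x (derive1 f x * velocity m W (mu r) i x))).
  rewrite -addrA addrC [d + _]addrC [leRHS]addrC; apply: le_trans (ler_normD _ _) _.
  by rewrite lerD// h2.
have ct := close _ t0; have cs := close _ s0.
set Ft := \int[mu t i]_x f x in bal ct; set Fs := \int[mu s i]_x f x in bal cs.
set Qt := \int[mu t i]_x q x in ct *; set Qs := \int[mu s i]_x q x in cs *.
rewrite (_ : Qt - Qs + c * (t - s) = (Ft - Fs + c * (t - s)) - (Ft - Qt) + (Fs - Qs)); last by ring.
apply: le_trans (ler_normD _ _) _.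
apply: le_trans (lerD (ler_normB _ _) cs) _.
apply: le_trans (lerD (lerD bal ct) (lexx _)) _.
rewrite (_ : (d + e' * C * p i) * (t - s) + e' * K * p i + e' * K * p i = d * (t - s) + e' * A); last by rewrite /A; ring.
by rewrite lerD2l /e' divfK// gt_eqF.
Qed.

(** A Lipschitz [f] is replaced by its average [phi] over [x, x + h], which is C^1 with derivative
    bounded by [L]; the balance with [c = 0] then bounds the increment. The Lipschitz constant of
    [derive1 phi] grows like 1/h, but the conclusion of [weak_balance] does not depend on it. *)
Lemma flow_lip i s t : 0 < s -> 0 < t -> lip_close K (C * p i * `|t - s|) (mu t i) (mu s i).
Proof.
wlog st : s t / s <= t => [wl s0 t0|s0 t0 L f L0 cf lf].
  have [|/ltW ts] := leP s t; first by move=> ?; exact: wl.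
  by rewrite distrC; apply: lip_closeC; exact: wl.
rewrite [`|t - s|]ger0_norm ?subr_ge0//.
(* Averages near [K] reach beyond [-K, K], so [f] is first extended to a globally Lipschitz
   function. *)
pose fc x := f (clamp K x).
have fcl x y : `|fc x - fc y| <= L * `|x - y|.
  apply: le_trans (lf _ _ (clamp_bound K0 _) (clamp_bound K0 _)) _.
  by rewrite ler_wpM2l// clamp_lip.
have cfc : continuous fc.
  by move=> x; apply: continuous_comp; [exact: clamp_continuous|exact: cf].
have [Phi dPhi] := continuous_primitive cfc.
apply/ler_addgt0Pr => e e0.
(* The averaging errors at the two end times add up to [2 * (L * h * p i)], which this [h] keeps
   below [e]; the [+ 1] covers [L = 0]. *)
pose h := e / (2 * (L + 1) * p i).
have h0 : 0 < h by rewrite divr_gt0// !mulr_gt0// ltr_wpDl.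
pose phi (x : R) := h^-1 * (Phi (1 * x + h) - Phi x).
have dphi (x : R) : is_derive x 1 phi (h^-1 * (fc (x + h) - fc x)).
  have := derZ h^-1 (derB (@der_comp _ Phi (fun x => 1 * x + h) x _ _ (dPhi _) (der_affine 1 h x)) (dPhi x)).
  by rewrite mul1r mulr1.
have phi'E x : derive1 phi x = h^-1 * (fc (x + h) - fc x) := derive1_is_derive (dphi x).
have phi'EE : derive1 phi = fun x => h^-1 * (fc (x + h) - fc x) by apply/funext.
have dphi1 x : derivable phi x 1 by have [] := dphi x.
have cphi := derivable_cont dphi1.
have cphi' : continuous (derive1 phi).
  rewrite phi'EE; apply: continuousZf; apply: continuousBf => // x.
  apply: (@continuous_comp _ _ _ (fun x => x + h) fc); last exact: cfc.
  by apply: cvgD; [exact: cvg_id|exact: cvg_cst].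
have hi0 : 0 <= h^-1 by rewrite invr_ge0 ltW.
have phi'b x : `|derive1 phi x| <= L.
  rewrite phi'E normrM ger0_norm// ler_pdivrMl//; apply: le_trans (fcl _ _) _.
  by rewrite addrC addKr ger0_norm ?(ltW h0)// mulrC.
have phi'l : lip_on K (h^-1 * (L + L)) (derive1 phi).
  move=> x y _ _; rewrite !phi'E -mulrBr normrM ger0_norm// -mulrA ler_wpM2l//.
  rewrite (_ : _ - _ - _ = (fc (x + h) - fc (y + h)) - (fc x - fc y)); last by ring.
  apply: le_trans (ler_normB _ _) _; rewrite mulrDl lerD//.
  by apply: le_trans (fcl _ _) _; rewrite (_ : x + h - (y + h) = x - y)//; ring.
have phif x : - K <= x <= K -> `|phi x - f x| <= L * h.
  move=> xK; have [||y [xy yh E]] := @mvt _ Phi x (x + h).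
  - by rewrite ltrDl.
  - by move=> z; have [] := dPhi z.
  rewrite /phi mul1r E (derive1_is_derive (dPhi y)) [x + h]addrC addrK mulrCA mulVf ?gt_eqF// mulr1.
  rewrite -[X in _ - f X](clamp_id xK) -/(fc x); apply: le_trans (fcl _ _) _.
  rewrite ler_wpM2l// ger0_norm; lra.
have bal : `|\int[mu t i]_x phi x - \int[mu s i]_x phi x + 0 * (t - s)| <= L * C * p i * (t - s).
  have ll0 : 0 <= h^-1 * (L + L) by rewrite mulr_ge0// addr_ge0.
  apply: (weak_balance s0 st ll0 dphi1 cphi' phi'l) => r /andP[sr _]; have r0 : 0 < r by exact: lt_le_trans sr.
  rewrite subr0; apply: (Rintegral_bound K0 (confp r0 i)).
    by apply: continuousMf => //; exact: flow_velocity_continuous.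
  move=> x xK; rewrite normrM ler_pM//.
  by apply: Vb => //; exact: confp.
have close r : 0 < r -> `|\int[mu r i]_x phi x - \int[mu r i]_x f x| <= L * h * p i.
  move=> r0; rewrite -(RintegralBc K0 (confp r0 i))//.
  by apply: (Rintegral_bound K0 (confp r0 i)) => //; exact: continuousBf.
have ct := close _ t0; have cs := close _ s0.
rewrite mul0r addr0 in bal.
set Ft := \int[mu t i]_x phi x in bal ct; set Fs := \int[mu s i]_x phi x in bal cs.
set Qt := \int[mu t i]_x f x in ct *; set Qs := \int[mu s i]_x f x in cs *.
rewrite (_ : Qt - Qs = (Ft - Fs) - (Ft - Qt) + (Fs - Qs)); last by ring.
apply: le_trans (ler_normD _ _) _.
apply: le_trans (lerD (ler_normB _ _) cs) _.
apply: le_trans (lerD (lerD bal ct) (lexx _)) _.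
rewrite (_ : L * (C * p i * (t - s)) = L * C * p i * (t - s)); last by ring.
rewrite -addrA lerD2l -mulr2n -mulr_natl.
have -> : 2 * (L * h * p i) = e * (L / (L + 1)).
  by rewrite /h; field; rewrite !gt_eqF ?ltr_wpDl// p0.
by rewrite ler_piMr ?(ltW e0)// ler_pdivrMr ?ltr_wpDl// mul1r lerDl.
Qed.

(** * Expansion of the interaction energy *)

Section energy.
Hypotheses (Wsym : forall i j z, W_entry W i j z = W_entry W j i z)
  (Weven : forall i j z, W_entry W i j (- z) = W_entry W i j z).
Implicit Types (al be : 'I_n -> borel_measure R).

Let cW i j : continuous (W_entry W i j).
Proof. exact: derivable_cont. Defined.

(** The polar form of the quadratic energy; on the diagonal it is twice the energy. *)
Definition mutual_energy al be : R :=
  \sum_i \sum_j \int[be j]_y (\int[al i]_x W_entry W i j (x - y)).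

Lemma mutual_energy_l al be : confined_family p K al -> confined_family p K be ->
  mutual_energy al be = \sum_i \int[al i]_x potential W be i x.
Proof.
move=> hal hbe; apply: eq_bigr => i _.
rewrite /potential (Rintegral_sum K0 (hal i)); last first.
  by move=> j; apply: (continuous_conv K0 (hbe j)); exact: cW.
by apply: eq_bigr => j _; apply: (Fubini_conv K0 (hal i) (hbe j)); exact: cW.
Qed.

(** Here the order of integration is already the right one, and symmetry with evenness turns W_ij(x
    - y) into W_ji(y - x), the kernel of the potential of [al] at [y]. *)
Lemma mutual_energy_r al be : confined_family p K al -> confined_family p K be ->
  mutual_energy al be = \sum_j \int[be j]_y potential W al j y.
Proof.
move=> hal hbe; rewrite /mutual_energy exchange_big/=; apply: eq_bigr => j _.
rewrite /potential (Rintegral_sum K0 (hbe j)); last first.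
  by move=> i; apply: (continuous_conv K0 (hal i)); exact: cW.
apply: eq_bigr => i _; apply: eq_Rintegral => y _; apply: eq_Rintegral => x _.
by rewrite Wsym -Weven opprB.
Qed.

Lemma energyE al : interaction_energy W al = 2^-1 * mutual_energy al al.
Proof. by []. Qed.

Lemma potential_continuous al i : confined_family p K al -> continuous (potential W al i).
Proof.
move=> hal; apply: continuous_sum => j.
by apply: (continuous_conv K0 (hal j)); exact: cW.
Qed.

(* Symmetry of the interaction turns the difference of the quadratic energies into
   one that is linear in [al - be]. *)
Lemma energy_diff al be : confined_family p K al -> confined_family p K be ->
  interaction_energy W al - interaction_energy W be = 2^-1 * \sum_i
   (\int[al i]_x (potential W al i x + potential W be i x) -
    \int[be i]_x (potential W al i x + potential W be i x)).
Proof.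
move=> hal hbe; rewrite !energyE -mulrBr; congr (_ * _).
have E1 := mutual_energy_l hal hal; have E2 := mutual_energy_l hbe hbe.
have E3 := mutual_energy_l hal hbe; have E4 := mutual_energy_r hal hbe.
rewrite (_ : _ - _ = (mutual_energy al al - mutual_energy al be) + (mutual_energy al be - mutual_energy be be)); last by ring.
rewrite {1}E4 E1 E3 E2 -!sumrB -big_split/=; apply: eq_bigr => i _.
have ca := potential_continuous hal (i := i); have cb := potential_continuous hbe (i := i).
by rewrite (RintegralDc K0 (hal i) ca cb) (RintegralDc K0 (hbe i) ca cb); ring.
Qed.

(** The test function is the sum of the potentials at the two end times, held fixed while the
    measure evolves; by [energy_diff] its increments give twice the energy difference. Its flux at
    time [r] involves the velocities at [s], [t] and [r], all within O(|t - s|) of those at [s], so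
    freezing it at [s] costs a second-order error over the interval. *)
Lemma energy_expansion : exists2 A : R, 0 <= A & forall s t, 0 < s -> 0 < t ->
  `|interaction_energy W (mu t) - interaction_energy W (mu s) +
    dissipation m W (mu s) * (t - s)| <= A * (t - s) ^+ 2.
Proof.
pose C1 := C * \sum_i p i.
have C10 : 0 <= C1 by rewrite mulr_ge0// sumr_ge0// => i _; exact: ltW.
have cl s t : 0 < s -> 0 < t -> forall d : R, `|t - s| <= d -> family_close K (C1 * d) (mu t) (mu s).
  move=> s0 t0 d td i; apply: lip_close_le (flow_lip i s0 t0).
  apply: ler_pM => //; first by rewrite mulr_ge0// ltW.
  rewrite ler_wpM2l// (bigD1 i)//= lerDl sumr_ge0// => j _; exact: ltW.
pose A := \sum_i (m i)^-1 * (2 * C ^+ 2 * (p i + 1) * C1).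
have A0 : 0 <= A.
  apply: sumr_ge0 => i _; rewrite mulr_ge0 ?invr_ge0 ?(ltW (m0 i))//.
  by rewrite mulr_ge0// mulr_ge0 ?addr_ge0 ?(ltW (p0 i))// mulr_ge0// sqr_ge0.
exists A => // s t s0 t0.
have hs := confp s0; have ht := confp t0.
pose phi i x := potential W (mu t) i x + potential W (mu s) i x.
(* [c i] is the flux of [phi i] with all times set to [s], and [B i] bounds the deviation from it;
   the outer factor 2 stands for the two potentials. *)
pose c i := (m i)^-1 * (2 * \int[mu s i]_x (velocity m W (mu s) i x * velocity m W (mu s) i x)).
pose B i := (m i)^-1 * (2 * (2 * C ^+ 2 * (p i + 1) * (C1 * `|t - s|))).
have dphi i (x : R) : is_derive x 1 (phi i) ((m i)^-1 * velocity m W (mu t) i x + (m i)^-1 * velocity m W (mu s) i x).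
  exact: (derD (is_derive_potential K0 m0 dW cW' i x ht) (is_derive_potential K0 m0 dW cW' i x hs)).
have phi'E i : derive1 (phi i) = fun x => (m i)^-1 * velocity m W (mu t) i x + (m i)^-1 * velocity m W (mu s) i x.
  by apply/funext => x; exact: derive1_is_derive.
have mi0 i : 0 <= (m i)^-1 by rewrite invr_ge0 ltW.
have step i : `|\int[mu t i]_x phi i x - \int[mu s i]_x phi i x + c i * (t - s)| <= B i * `|t - s|.
  have gd r : Num.min s t <= r -> r <= Num.max s t ->
     `|\int[mu r i]_x (derive1 (phi i) x * velocity m W (mu r) i x) - c i| <= B i.
    move=> r1 r2.
    have r0 : 0 < r by apply: lt_le_trans r1; rewrite lt_min s0.
    have hr := confp r0.
    have cV u : 0 < u -> continuous (fun x => velocity m W (mu u) i x * velocity m W (mu r) i x).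
      by move=> u0; apply: continuousMf; exact: flow_velocity_continuous.
    have -> : \int[mu r i]_x (derive1 (phi i) x * velocity m W (mu r) i x) =
      (m i)^-1 * (\int[mu r i]_x (velocity m W (mu t) i x * velocity m W (mu r) i x) +
                 \int[mu r i]_x (velocity m W (mu s) i x * velocity m W (mu r) i x)).
      rewrite -(RintegralDc K0 (hr i)); [|exact: cV..].
      rewrite -(RintegralZc K0 (hr i)); last by apply: continuousDf; exact: cV.
      by apply: eq_Rintegral => x _; rewrite phi'E; ring.
    rewrite /c /B -mulrBr normrM ger0_norm// ler_wpM2l// mulr_natl mulr2n mulr_natl mulr2n.
    set I0 := \int[mu s i]_x _.
    rewrite opprD addrACA.
    have rs := between_dist r1 r2.
    have d0 : 0 <= C1 * `|t - s| by rewrite mulr_ge0.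
    have css : family_close K (C1 * `|t - s|) (mu s) (mu s) by move=> j; exact: lip_closexx.
    have crs := cl _ _ s0 r0 _ rs.
    have cts := cl _ _ s0 t0 _ (lexx _).
    apply: le_trans (ler_normD _ _) _; apply: lerD.
      exact: (dissipation_pair_close K0 cW' C0 Vb Vl Vd i d0 hr hs ht hs hr hs).
    exact: (dissipation_pair_close K0 cW' C0 Vb Vl Vd i d0 hr hs hs hs hr hs).
  have L0 : 0 <= (m i)^-1 * C + (m i)^-1 * C by rewrite addr_ge0// mulr_ge0.
  have dphi1 x : derivable (phi i) x 1 by have [] := dphi i x.
  have cphi' : continuous (derive1 (phi i)).
    by rewrite phi'E; apply: continuousDf; apply: continuousZf; exact: flow_velocity_continuous.
  have lphi' : lip_on K ((m i)^-1 * C + (m i)^-1 * C) (derive1 (phi i)).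
    by rewrite phi'E; apply: lip_onZDZ => //; [exact: (Vl ht)|exact: (Vl hs)].
  have [st|/ltW ts] := leP s t.
    rewrite [`|t - s|]ger0_norm ?subr_ge0//.
    apply: (weak_balance s0 st L0 dphi1 cphi' lphi') => r /andP[sr rt].
    by apply: gd; rewrite ?(min_l st) ?(max_r st).
  (* For [t <= s] the balance runs over [t, s] and the sign is reversed, while the expansion stays
     centred at [s]. *)
  rewrite [`|t - s|]distrC [`|s - t|]ger0_norm ?subr_ge0//.
  rewrite (_ : _ + _ = - (\int[mu s i]_x phi i x - \int[mu t i]_x phi i x + c i * (s - t))); last by ring.
  rewrite normrN.
  apply: (weak_balance t0 ts L0 dphi1 cphi' lphi') => r /andP[tr rs].
  by apply: gd; rewrite ?(min_r ts) ?(max_l ts).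
rewrite (energy_diff ht hs).
have -> : dissipation m W (mu s) * (t - s) = 2^-1 * \sum_i c i * (t - s).
  rewrite /dissipation mulr_suml mulr_sumr; apply: eq_bigr => i _; rewrite /c; field.
  by rewrite gt_eqF.
rewrite -mulrDr -big_split/= normrM ger0_norm//.
rewrite -(real_normK (num_real (t - s))) ler_pdivrMl//.
apply: le_trans (ler_norm_sum _ _ _) _.
apply: le_trans (ler_sum _ (fun i _ => step i)) _.
rewrite /A mulr_suml mulr_sumr; apply: ler_sum => i _.
by rewrite /B le_eqVlt; apply/orP; left; apply/eqP; ring.
Qed.

End energy.
End Flow.

(** * Vanishing dissipation *)

Section Limit.
Context {R : realType}.
Implicit Types (s t : R).

(* Barbalat's argument: if [D] were large at arbitrarily late times, then the
   expansion would make [e] drop by a fixed amount there. *)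
Lemma dissipative_limit (e D : R -> R) (A b : R) : 0 <= A ->
  (forall s t, 0 < s -> 0 < t -> `|e t - e s + D s * (t - s)| <= A * (t - s) ^+ 2) ->
  (forall t, 0 < t -> 0 <= D t) -> (forall t, 0 < t -> b <= e t) ->
  [/\ (exists l : R, e t @[t --> +oo] --> l),
      (forall t : R, 0 < t -> is_derive t 1 e (- D t)) &
      D t @[t --> +oo] --> (0 : R)].
Proof.
move=> A0 eD D0 be.
have de (t : R) : 0 < t -> is_derive t 1 e (- D t).
  move=> t0; apply: (@is_derive_quadratic _ _ _ _ A t) => // h ht.
  have th : 0 < t + h by move: ht; rewrite ltr_norml; lra.
  by have := eD _ _ t0 th; rewrite [t + h]addrC addrK mulNr opprK [h + t]addrC.
have noninc s t : 0 < s -> s <= t -> e t <= e s.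
  move=> s0 st.
  have [||c] := @MVT_segment R e (fun t => - D t) s t st.
  - by move=> x; rewrite in_itv/= => /andP[sx _]; apply: de; exact: lt_trans sx.
  - apply: continuous_in_subspaceT => x; rewrite inE/= in_itv/= => /andP[sx _].
    have [dx _] := de x (lt_le_trans s0 sx).
    by apply: differentiable_continuous; apply/derivable1_diffP.
  rewrite in_itv/= => /andP[sc ct] E.
  by rewrite -subr_le0 E mulNr oppr_le0 mulr_ge0 ?subr_ge0// D0// (lt_le_trans s0).
pose S := [set e t | t in [set t : R | 0 < t]].
have S0 : S !=set0 by exists (e 1); exists 1 => //=.
have lbS : has_lbound S by exists b => _ [t /= t0 <-]; exact: be.
have infS : has_inf S by [].
pose l := inf S.
have le_l t : 0 < t -> l <= e t by move=> t0; apply: ge_inf => //; exists t.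
have el (eps : R) : 0 < eps -> exists2 t, 0 < t & forall u, t <= u -> e u <= l + eps.
  move=> eps0; have [_ [t /= t0 <-] te] := inf_adherent eps0 infS.
  by exists t => // u tu; apply: le_trans (ltW te); exact: noninc.
split => //.
  exists l; apply/cvgrPdist_le => eps eps0.
  have [t t0 ht] := el _ eps0.
  near=> u.
  have tu : t <= u by near: u; apply: nbhs_pinfty_ge; rewrite num_real.
  have u0 : 0 < u by exact: lt_le_trans tu.
  rewrite distrC ger0_norm ?subr_ge0 ?le_l// lerBlDl; exact: ht.
apply/cvgrPdist_le => eps eps0.
(* [h] ensures [A * h <= eps / 2]; once the energy is within [eps * h / 2] of its infimum, the
   expansion over a span [h] gives [D u * h <= eps * h]. *)
pose h := eps / (2 * (A + 1)).
have h0 : 0 < h by rewrite divr_gt0// mulr_gt0// ltr_wpDl.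
have [t t0 ht] := el (eps * h / 2) ltac:(by rewrite divr_gt0// mulr_gt0).
near=> u.
have tu : t <= u by near: u; apply: nbhs_pinfty_ge; rewrite num_real.
have u0 : 0 < u by exact: lt_le_trans tu.
have uh : 0 < u + h by rewrite addr_gt0.
rewrite sub0r normrN ger0_norm ?D0//.
have := eD _ _ u0 uh; rewrite [u + h]addrC addrK [h + u]addrC => /ler_normlP [_ E].
have E1 := ht _ tu; have E2 := le_l _ uh.
have Ah : A * h <= eps / 2.
  rewrite /h mulrA ler_pdivrMr ?mulr_gt0 ?ltr_wpDl//.
  have -> : eps / 2 * (2 * (A + 1)) = A * eps + eps by field.
  by rewrite lerDl ltW.
rewrite -(ler_pM2r h0).
have Ahh : A * h ^+ 2 <= eps / 2 * h by rewrite expr2 mulrA ler_pM2r.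
have -> : eps * h = eps * h / 2 + eps / 2 * h by field.
by move: E E1 E2 Ahh; set x := D u * h; lra.
Unshelve. all: by end_near. Qed.

End Limit.

(** * Stationarity of measures with zero dissipation *)

Section Stationary.
Context {R : realType}.

Lemma pair_continuousr (t : R) : continuous (fun x : R => (t, x)).
Proof. by move=> x; apply: (@cvg_pair _ _ _ (nbhs x) (nbhs t) (nbhs x) _ _ _ (cst t) id); [exact: cvg_cst|exact: cvg_id]. Qed.

Lemma pair_continuousl (x : R) : continuous (fun t : R => (t, x)).
Proof. by move=> t; apply: (@cvg_pair _ _ _ (nbhs t) (nbhs t) (nbhs x) _ _ _ id (cst x)); [exact: cvg_id|exact: cvg_cst]. Qed.

(* The inner integral is the time derivative of a compactly supported function,
   which avoids exchanging the two integrals. *)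
Lemma integral_partial_t (al : borel_measure R) (p : R) (phi : R * R -> R) :
  al setT = p%:E -> test_function phi ->
  (\int[lebesgue_measure]_(t in `]0%R, +oo[) \int[al]_x (partial_t phi (t, x))%:E = 0)%E.
Proof.
move=> alp [sphi]; set S := closure _ => cS S0.
have [cphi dphi _] := sphi [::]; have [cphit _ _] := sphi [:: false].
rewrite /= in cphi dphi cphit.
have phi0 z : ~ S z -> phi z = 0.
  move=> nS; apply: contrapT => /eqP h; apply: nS; exact: subset_closure.
have dphi' (t x : R) : is_derive t 1 (fun s => phi (s, x)) (partial_t phi (t, x)).
  exact: (is_derive_derive1 (dphi (t, x))).
have cx (F : R * R -> R) t : continuous F -> continuous (fun x : R => F (t, x)).
  move=> cF x; apply: (@continuous_comp _ _ _ (fun x => (t, x)) F); last exact: cF.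
  exact: pair_continuousr.
have ct (F : R * R -> R) x : continuous F -> continuous (fun t : R => F (t, x)).
  move=> cF t; apply: (@continuous_comp _ _ _ (fun t => (t, x)) F); last exact: cF.
  exact: pair_continuousl.
have phit0 z : ~ S z -> partial_t phi z = 0.
  case: z => t x nS; apply: derive1_is_derive; apply: eq_near_derive (der_cst 0 t).
  have : nbhs (t, x) (~` S) by apply: open_nbhs_nbhs; split => //; exact/closed_openC/closed_closure.
  move=> [[U V] /= [Ut Vx] UV]; near=> s; apply: phi0; apply: (UV (s, x)); split => /=.
    by near: s.
  exact: nbhs_singleton.
have bdd (F : R * R -> R) : continuous F -> exists2 M : R, 0 <= M & forall z, S z -> `|F z| <= M.
  move=> cF; have : compact (F @` S) by apply: continuous_compact => //; exact: continuous_subspaceT.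
  move=> /compact_bounded [M [_ hM]]; exists (`|M| + 1); first by rewrite addr_ge0.
  by move=> z Sz; apply: (hM (`|M| + 1)); [rewrite (le_lt_trans (ler_norm M))// ltrDl|exists z].
have [M M0 hM] := bdd _ cphit.
have [T T0 hT] := bdd fst (fun z => cvg_fst).
have [B B0 hB] := bdd _ cphi.
have phitM z : `|partial_t phi z| <= M.
  by have [/hM//|/phit0 ->] := pselect (S z); rewrite normr0.
have phiM z : `|phi z| <= B.
  by have [/hB//|/phi0 ->] := pselect (S z); rewrite normr0.
have int (F : R -> R) N : continuous F -> (forall x, `|F x| <= N) -> al.-integrable setT (EFin \o F).
  by move=> cF FN; apply: (bounded_integrable alp _ FN); exact: continuous_measurable.
pose H t := \int[al]_x phi (t, x).
pose h t := \int[al]_x partial_t phi (t, x).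
have intM : al.-integrable setT (EFin \o (fun=> M)).
  by apply: (int _ M) => x; [exact: cvg_cst|rewrite ger0_norm].
have ch : continuous h.
  move=> a; apply: (@continuity_under_integral R _ _ al (fun t x => partial_t phi (t, x)) setT
    measurableT (a - 1) (a + 1) _ _ (fun=> M) intM).
  - by move=> t _; apply: (int _ M) => //; exact: cx.
  - apply: aeW => y _ t _; exact: ct.
  - by move=> t _; apply: aeW => y _; exact: phitM.
  - by rewrite inE/= in_itv/=; lra.
have dH (t : R) : is_derive t 1 H (h t).
  have tI : `]t - 1, t + 1[%classic t by rewrite /= in_itv/=; lra.
  have intf z : `]t - 1, t + 1[%classic z -> al.-integrable setT (EFin \o (fun y => phi (z, y))).
    by move=> _; apply: (int _ B) => //; exact: cx.
  have derf z y : `]t - 1, t + 1[%classic z -> [set: R] y -> derivable (fun x => phi (x, y)) z 1.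
    by move=> _ _; exact: (dphi (z, y)).
  have ub z y : `]t - 1, t + 1[%classic z -> [set: R] y -> `|derive1 (fun x => phi (x, y)) z| <= M.
    by move=> _ _; exact: (phitM (z, y)).
  have d1 := @derivable_under_integral R _ _ al (fun x y => phi (x, y)) setT measurableT
    t (t - 1) (t + 1) tI intf derf (fun=> M) (fun=> M0) intM ub.
  have d2 := @differentiation_under_integral R _ _ al (fun x y => phi (x, y)) setT measurableT
    t (t - 1) (t + 1) tI intf derf (fun=> M) (fun=> M0) intM ub.
  have -> : h t = derive1 H t by rewrite d2.
  exact: is_derive_derive1.
(* The support of [phi] lies at times in ]0, T], so [H] vanishes both at 0 and at [T + 1]. *)
have T10 : 0 < T + 1 by rewrite ltr_wpDl.
have := Rintegral_derive1 T10 dH ch.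
have out t : ~ (0 < t <= T) -> forall x, ~ S (t, x).
  move=> tT x Sx; apply: tT; rewrite (S0 _ Sx)/=.
  by apply: le_trans (hT _ Sx); exact: ler_norm.
have H0 t : ~ (0 < t <= T) -> H t = 0.
  move=> /out nS; rewrite /H; under eq_Rintegral => x _ do rewrite (phi0 _ (nS x)).
  by rewrite Rintegral_cst// mul0r.
rewrite H0 ?H0 ?subrr; [|by lra|by lra].
move=> E.
have hE t : (\int[al]_x (partial_t phi (t, x))%:E = (h t)%:E)%E.
  by rewrite /h /Rintegral fineK//; apply: integrable_fin_num => //; apply: (int _ M) => //; exact: cx.
under eq_integral do rewrite hE.
have ih : lebesgue_measure.-integrable `[0, T + 1] (EFin \o h).
  by apply: continuous_integrable_itv => x _; exact: ch.
transitivity (\int[lebesgue_measure]_(t in `[0%R, (T + 1)%R]) (h t)%:E)%E; last first.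
  rewrite -[LHS]fineK; last exact: integrable_fin_num.
  by rewrite -[fine _]/(\int[lebesgue_measure]_(t in `[0, T + 1]) h t) E.
rewrite integral_mkcond [RHS]integral_mkcond; apply: eq_integral => t _.
rewrite !patchE.
have h0 : ~ (0 < t <= T) -> h t = 0.
  move=> /out nS; rewrite /h; under eq_Rintegral => x _ do rewrite (phit0 _ (nS x)).
  by rewrite Rintegral_cst// mul0r.
case: ifPn => t1; case: ifPn => t2 //.
  rewrite h0// => /andP[t3 t4]; move: t2; rewrite notin_setE/= in_itv/= => /negP.
  by rewrite negb_and -!ltNge; lra.
rewrite h0// => /andP[t3 t4]; move: t1; rewrite notin_setE/= in_itv/= andbT.
by move=> /negP; rewrite -leNgt; lra.
Unshelve. all: by end_near. Qed.

Context {n : nat} (m p : 'I_n -> R) (W : R -> 'M[R]_n) (K : R).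
Hypotheses (K0 : 0 < K) (m0 : forall i, 0 < m i) (p0 : forall i, 0 < p i).
Hypothesis cW' : forall i j, continuous (derive1 (W_entry W i j)).

Lemma dissipation0_velocity (nu : 'I_n -> borel_measure R) i : confined_family p K nu ->
  dissipation m W nu = 0 -> ae_eq (nu i) setT (EFin \o velocity m W nu i) (cst 0%E).
Proof.
move=> hnu D0.
have mi j : 0 < (m j)^-1 by rewrite invr_gt0.
have cV : continuous (velocity m W nu i) by apply: (velocity_continuous K0 cW' hnu).
have I0 : \int[nu i]_x (velocity m W nu i x * velocity m W nu i x) = 0.
  have ge j : 0 <= (m j)^-1 * \int[nu j]_x (velocity m W nu j x * velocity m W nu j x).
    rewrite mulr_ge0 ?(ltW (mi j))//; apply: Rintegral_ge0 => x _.
    by rewrite -expr2 sqr_ge0.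
  have /eqP := D0; rewrite /dissipation psumr_eq0 => [/allP /(_ i)|//].
  rewrite mem_index_enum => /(_ isT) /=.
  by rewrite mulf_eq0 gt_eqF//= => /eqP.
have iVV : (nu i).-integrable setT (EFin \o (fun x => velocity m W nu i x * velocity m W nu i x)).
  by apply: (confined_integrable K0 (hnu i)); exact: continuousMf.
have mVV : measurable_fun setT (EFin \o (fun x : measurableTypeR R => velocity m W nu i x * velocity m W nu i x)).
  by have /integrableP[] := iVV.
have : (\int[nu i]_x `|(EFin \o (fun x => velocity m W nu i x * velocity m W nu i x)%R) x| = 0)%E.
  transitivity (\int[nu i]_x ((velocity m W nu i x * velocity m W nu i x)%R)%:E)%E.
    by apply: eq_integral => x _; rewrite gee0_abs// lee_fin -expr2 sqr_ge0.
  rewrite -[LHS]fineK; last exact: integrable_fin_num.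
  by rewrite -[fine _]/(\int[nu i]_x (velocity m W nu i x * velocity m W nu i x)) I0.
move=> /(ae_eq_integral_abs (nu i) measurableT mVV) [A [mA A0 AS]].
exists A; split => // x /= nx; apply: AS => /= /(_ I) [] E; apply: nx => _.
by move: E => /eqP; rewrite mulf_eq0 orbb => /eqP ->.
Qed.

(** The flux term vanishes almost everywhere, and what remains is the time derivative of the test
    function, which integrates to zero. *)
Lemma dissipation0_solution (nu : 'I_n -> borel_measure R) : confined_family p K nu ->
  dissipation m W nu = 0 -> distributional_solution m W (fun=> nu).
Proof.
move=> hnu D0 i phi test.
rewrite -[RHS](integral_partial_t (hnu i).1 test).
apply: eq_integral => t tI.
clear tI; have [sphi _ _] := test.
have [ct _ _] := sphi [:: false]; have [cx _ _] := sphi [:: true].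
rewrite /= in ct cx.
have cc (F : R * R -> R) : continuous F -> continuous (fun x : R => F (t, x)).
  move=> cF x; apply: (@continuous_comp _ _ _ (fun x => (t, x)) F); last exact: cF.
  exact: pair_continuousr.
have cV := velocity_continuous K0 cW' hnu (m := m) (i := i).
have [A [mA A0 AS]] := dissipation0_velocity i hnu D0.
have -> : (fun x => (partial_t phi (t, x) - m i * partial_x phi (t, x) *
    \sum_j \int[nu j]_y derive1 (W_entry W i j) (x - y))%:E) =
    EFin \o (fun x => partial_t phi (t, x) - partial_x phi (t, x) * velocity m W nu i x).
  by apply/funext => x /=; congr EFin; rewrite /velocity; ring.
apply: ae_eq_integral => //.
- apply/measurable_EFinP; apply: continuous_measurable.
  apply: continuousBf; first exact: cc.
  by apply: continuousMf => //; exact: cc.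
- by apply/measurable_EFinP; apply: continuous_measurable; exact: cc.
exists A; split => // x /= nx; apply: AS => /= E; apply: nx => _.
by move: (E I) => [->]; rewrite mulr0 subr0.
Qed.

End Stationary.

(** * Quantile functions and compactness *)

Section Quantile.
Context {R : realType} (K : R) (K0 : 0 < K).
Implicit Types (al be : borel_measure R) (x y p h e : R) (X Y : R -> R).

Definition image_measure d d' (T1 : measurableType d) (T2 : measurableType d')
    (m : {measure set T1 -> \bar R}) (f : T1 -> T2) (mf : measurable_fun setT f) :
    {measure set T2 -> \bar R} :=
  measure_function_pushforward__canonical__measure_function_Measure m mf.

(** Unnormalised, so that its mass is [p]. The left end is excluded because the relation between
    quantile and distribution function fails at level 0. *)
Definition unif p : borel_measure R :=
  mrestr lebesgue_measure (measurable_itv `]0, p]).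

Lemma unifE p (A : set (measurableTypeR R)) :
  unif p A = lebesgue_measure (A `&` `]0, p]).
Proof. by []. Qed.

Lemma unif_itv p (a b : R) : 0 <= a -> a <= b -> b <= p -> unif p `]a, b]%classic = (b - a)%:E.
Proof.
move=> a0 ab bp; rewrite unifE setIidl; last first.
  move=> x /=; rewrite !in_itv/= => /andP[ax xb].
  by rewrite (le_lt_trans a0 ax) (le_trans xb bp).
rewrite lebesgue_measure_itv/= lte_fin; case: ltP => // ba.
by rewrite (@le_anti _ _ a b) ?ab// subrr.
Qed.

Lemma measure_unique_ray (m1 m2 : borel_measure R) p :
  m1 setT = p%:E ->
  (forall x, m1 `]x, +oo[%classic = m2 `]x, +oo[%classic) ->
  forall A : set (measurableTypeR R), measurable A -> m1 A = m2 A.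
Proof.
move=> m1p m12.
apply: (@measure_unique _ R (measurableTypeR R) (@RGenOInfty.G R) (fun k => `](- k%:R)%R, +oo[%classic)).
- exact: RGenOInfty.measurableE.
- move=> _ _ [x ->] [y ->]; exists (Num.max x y).
  apply/seteqP; split => z /=; rewrite !in_itv/= !andbT gt_max.
    by move=> [-> ->].
  by move=> /andP.
- by move=> k; exists (- k%:R).
- apply/seteqP; split => // x _; exists (Num.truncn `|x|).+1 => //=.
  rewrite in_itv/= andbT; have : `|x| < (Num.truncn `|x|).+1%:R by rewrite truncnS_gt.
  by rewrite ltr_norml => /andP[].
- by move=> A [x ->]; exact: m12.
- move=> k; apply: (@le_lt_trans _ _ (m1 setT)); last by rewrite m1p ltry.
  by apply: le_measure; rewrite ?inE//; exact: measurable_itv.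
Qed.

(** [X] is the generalised inverse of the distribution function [F]: for 0 < w <= p, [X w <= x] iff
    [w <= F x]. Preimages of rays are then intervals ]F x, p] of the right length, and rays
    determine a measure of finite mass. *)
Lemma quantile_ex al p : 0 < p -> confined K p al -> exists X,
  [/\ {homo X : x y / x <= y}, (forall x, - K <= X x <= K) &
    forall A : set (measurableTypeR R), measurable A -> unif p (X @^-1` A) = al A].
Proof.
move=> p0 hal.
pose F x := fine (al `]-oo, x]%classic).
have mray x : measurable (`]-oo, x] : set (measurableTypeR R)) by exact: measurable_itv.
have FE x : al `]-oo, x]%classic = (F x)%:E.
  rewrite fineK// ge0_fin_numE// (@le_lt_trans _ _ (al setT))//.
    by apply: le_measure; rewrite ?inE.
  by rewrite hal.1 ltry.
have F0 x : 0 <= F x by rewrite fine_ge0.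
have Fp x : F x <= p.
  by rewrite -lee_fin -FE -hal.1; apply: le_measure; rewrite ?inE.
have Fnd x y : x <= y -> F x <= F y.
  move=> xy; rewrite -lee_fin -!FE; apply: le_measure; rewrite ?inE//.
  by move=> z /=; rewrite !in_itv/= => /le_trans; apply.
have FK x : K <= x -> F x = p.
  move=> Kx; apply/eqP; rewrite eq_le Fp/= -lee_fin -FE -hal.1.
  rewrite -(setvU `]-oo, x]%classic).
  apply: (le_trans (measureU2 _ _ _)) => //; first exact: measurableC.
  rewrite [X in (X + _ <= _)%E](_ : _ = 0%E) ?add0e//.
  apply/eqP; rewrite eq_le measure_ge0 andbT -hal.2.
  apply: le_measure; rewrite ?inE//.
  - exact: measurableC.
  - by apply: measurableC; exact: measurable_itv.
  - move=> z /=; rewrite !in_itv/= => zx /andP[_ zK]; apply: zx.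
    exact: le_trans zK Kx.
have FmK x : x < - K -> F x = 0.
  move=> xK; apply/eqP; rewrite eq_le F0 andbT -lee_fin -FE.
  apply: (@le_trans _ _ (al (~` `[- K, K]%classic))); last by rewrite hal.2.
  apply: le_measure; rewrite ?inE//.
    by apply: measurableC; exact: measurable_itv.
  move=> z /=; rewrite !in_itv/= => zx /andP[zK _].
  by move: (le_lt_trans (le_trans zK zx) xK); rewrite ltxx.
(* Right continuity of [F], from continuity of the measure along decreasing rays; the infimum
   defining [X w] needs it to satisfy the constraint itself. *)
have Frc x w : (forall y, x < y -> w <= F y) -> w <= F x.
  move=> wF.
  have cap : \bigcap_k `]-oo, x + k.+1%:R^-1]%classic = `]-oo, x]%classic.
    apply/seteqP; split => z /=.
      move=> zk; rewrite in_itv/= leNgt; apply/negP => xz.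
      have [k] : exists k : nat, (z - x)^-1 < k.+1%:R.
        by exists (Num.truncn (z - x)^-1); rewrite truncnS_gt.
      rewrite invf_plt ?posrE ?subr_gt0// => kz.
      by have := zk k I; rewrite /= in_itv/= leNgt -ltrBrDl kz.
    rewrite in_itv/= => zx k _ /=; rewrite in_itv/= (le_trans zx)// lerDl.
    by rewrite invr_ge0.
  have cv : al `]-oo, x + k.+1%:R^-1]%classic @[k --> \oo] --> al `]-oo, x]%classic.
    rewrite -cap; apply: (@nonincreasing_cvg_mu _ (measurableTypeR R) R al (fun k => `]-oo, x + k.+1%:R^-1]%classic)) => //.
    - by rewrite FE ltry.
    - by rewrite cap.
    - move=> k j kj; apply/subsetPset => z /=; rewrite !in_itv/= => /le_trans; apply.
      by rewrite lerD2l lef_pV2 ?posrE// ler_nat.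
  rewrite -lee_fin -FE -(cvg_lim _ cv)//.
  apply: lime_ge; first by apply/cvg_ex; eexists; exact: cv.
  by near=> k; rewrite FE lee_fin wF// ltrDl invr_gt0.
(* The minimum with [p] keeps the quantile function monotone on all of R; only
   its values on ]0, p] matter. *)
pose S w := [set x | - K <= x <= K /\ Num.min w p <= F x].
have SK w : S w K by split; [move: K0; lra|rewrite FK// ge_min lexx orbT].
have Slb w : has_lbound (S w) by exists (- K) => x [/andP[]].
have Sinf w : has_inf (S w) by split => //; exists K; exact: SK.
pose X w := inf (S w).
have X1 w : - K <= X w by apply: lb_le_inf; [exists K; exact: SK|move=> x [/andP[]]].
have X2 w : X w <= K by apply: ge_inf => //; exact: SK.
have gal (w x : R) : 0 < w -> w <= p -> (X w <= x) = (w <= F x).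
  move=> w0 wp; apply/idP/idP => [Xx|wF].
    apply: Frc => y xy.
    have [z [_]] := @inf_adherent _ (S w) (y - X w) ltac:(by rewrite subr_gt0; exact: le_lt_trans xy) (Sinf w).
    rewrite -/(X w) addrC subrK min_l// => wz zy.
    exact: le_trans wz (Fnd _ _ (ltW zy)).
  have [xK|Kx] := leP x K; last exact: le_trans (X2 w) (ltW Kx).
  have [Kx|xmK] := leP (- K) x; last by move: wF; rewrite FmK// leNgt w0.
  by apply: ge_inf => //; split; rewrite ?Kx// min_l.
have Xnd : {homo X : x y / x <= y}.
  move=> w w' ww'; apply: lb_le_inf; first by exists K; exact: SK.
  move=> x [xK wx]; apply: ge_inf => //; split => //.
  by apply: le_trans wx; rewrite le_min !ge_min ww' lexx orbT.
exists X; split => //; first by move=> w; rewrite X1 X2.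
have mX : measurable_fun (setT : set (measurableTypeR R)) (X : R -> measurableTypeR R).
  exact: nondecreasing_measurable.
apply: (@measure_unique_ray (image_measure (unif p) mX) al p).
  rewrite /image_measure/= /pushforward preimage_setT unifE setTI lebesgue_measure_itv/=.
  by rewrite lte_fin p0 sube0.
move=> x; rewrite /image_measure/= /pushforward unifE.
have -> : X @^-1` `]x, +oo[ `&` `]0, p] = `]F x, p]%classic.
  apply/seteqP; split => w /=; rewrite !in_itv/= andbT.
    by move=> [Xw /andP[w0 wp]]; rewrite wp andbT ltNge -gal// -ltNge.
  move=> /andP[Fw wp]; have w0 : 0 < w by exact: le_lt_trans Fw.
  by rewrite w0 wp ltNge gal// -ltNge.
have -> : `]x, +oo[%classic = ~` `]-oo, x]%classic :> set (measurableTypeR R).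
  by rewrite setCitvl.
have mC := measurableC (mray x).
have alC : al (~` `]-oo, x]%classic) = (p - F x)%:E.
  have fC : al (~` `]-oo, x]%classic) \is a fin_num.
    rewrite ge0_fin_numE// (@le_lt_trans _ _ (al setT)) ?hal.1 ?ltry//.
    by rewrite -hal.1; apply: le_measure; rewrite ?inE.
  have eU : (al `]-oo, x]%classic + al (~` `]-oo, x]%classic))%E = p%:E.
    by rewrite -hal.1 -(setUv `]-oo, x]%classic); apply/esym/measureU => //; exact: setICr.
  by move: eU; rewrite FE -(fineK fC) -EFinD => -[pE]; rewrite -pE (addrC (F x)) addrK fineK.
rewrite alC; have := unif_itv (F0 x) (Fp x) (lexx p); rewrite unifE setIidl//.
by move=> z /=; rewrite !in_itv/= => /andP[/(le_lt_trans (F0 x)) -> ->].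
Unshelve. all: by end_near. Qed.

(** The joint law of [X] and [Y] under [unif p] is a coupling, and its cost is their L^1
    distance. *)
Lemma dist_W1_image al be p X Y :
  measurable_fun (setT : set (measurableTypeR R)) (X : R -> measurableTypeR R) ->
  measurable_fun (setT : set (measurableTypeR R)) (Y : R -> measurableTypeR R) ->
  (forall A : set (measurableTypeR R), measurable A -> unif p (X @^-1` A) = al A) ->
  (forall A : set (measurableTypeR R), measurable A -> unif p (Y @^-1` A) = be A) ->
  (dist_W1 al be <= \int[unif p]_w (`|X w - Y w|)%:E)%E.
Proof.
move=> mX mY hX hY.
pose XY (w : measurableTypeR R) : measurableTypeR R * measurableTypeR R := (X w, Y w).
have mXY : measurable_fun (setT : set (measurableTypeR R)) XY.
  exact/measurable_fun_pair.
pose ga : borel_measure2 R := image_measure (unif p) mXY.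
apply: ge_ereal_inf; exists (\int[ga]_z (`|z.1 - z.2|)%:E)%E.
  exists ga => // A mA; rewrite /ga/= /pushforward.
  split; [rewrite -hX// | rewrite -hY//]; congr (unif p _).
    by apply/seteqP; split => w /= => [[]|].
  by apply/seteqP; split => w /= => [[]|].
have mf : measurable_fun setT (fun z : measurableTypeR R * measurableTypeR R => (`|z.1 - z.2|)%:E).
  by apply/measurable_EFinP; exact: measurable_dist2.
have := @ge0_integral_pushforward _ _ (measurableTypeR R) (measurableTypeR R * measurableTypeR R)%type R XY mXY (unif p) setT _ measurableT mf.
rewrite preimage_setT => -> //.
Qed.

Lemma unif_integral_grid p N e (f : R -> \bar R) (g : nat -> R) : 0 < p -> (0 < N)%N ->
  measurable_fun (setT : set (measurableTypeR R)) f -> (forall w, 0 <= f w)%E ->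
  (forall j w, (j < N)%N -> j%:R * (p / N%:R) < w <= j.+1%:R * (p / N%:R) ->
     (f w <= (e + (g j.+1 - g j))%:E)%E) ->
  (\int[unif p]_w f w <= (p * e + p / N%:R * (g N - g 0%N))%:E)%E.
Proof.
move=> p0 N0 mf f0 fg.
set h := p / N%:R in fg *.
have Nr : 0 < N%:R :> R by rewrite ltr0n.
have h0 : 0 < h by rewrite divr_gt0.
have step j : (j <= N)%N ->
  (\int[unif p]_(w in (`]0%R, (j%:R * h)%R]%classic : set (measurableTypeR R))) f w <= (j%:R * h * e + h * (g j - g 0%N))%:E)%E.
  elim: j => [_|j IH jN].
    by rewrite mul0r set_itvoc0 integral_set0 mul0r subrr mulr0 addr0.
  have jh : (j%:R * h <= j.+1%:R * h :> R) by rewrite ler_pM2r// ler_nat.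
  have jh0 : 0 <= j%:R * h by rewrite mulr_ge0// ltW.
  have -> : `]0%R, (j.+1%:R * h)%R]%classic = `]0%R, (j%:R * h)%R]%classic `|` `](j%:R * h)%R, (j.+1%:R * h)%R]%classic.
    by rewrite -itv_bndbnd_setU// bnd_simp.
  rewrite ge0_integral_setU//=; first last.
  - rewrite disj_set2E; apply/eqP/seteqP; split => // w [] /=; rewrite !in_itv/= => /andP[_ w1] /andP[w2 _].
    by move: (le_lt_trans w1 w2); rewrite ltxx.
  - exact: measurable_funTS.
  have -> : j.+1%:R * h * e + h * (g j.+1 - g 0%N) =
      (j%:R * h * e + h * (g j - g 0%N)) + (e + (g j.+1 - g j)) * h.
    by rewrite -natr1; ring.
  rewrite EFinD leeD ?IH 1?ltnW//.
  apply: (@le_trans _ _ (\int[unif p]_(w in (`](j%:R * h)%R, (j.+1%:R * h)%R]%classic : set (measurableTypeR R))) (e + (g j.+1 - g j))%:E)%E).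
    apply: ge0_le_integral => //=.
    - exact: measurable_funTS.
    - move=> w; rewrite in_itv/= => wj; exact: fg.
  rewrite integral_cst//= unif_itv//.
    by rewrite -EFinM lee_fin -mulrBl -natr1 addrAC subrr add0r mul1r.
  by rewrite /h mulrCA ler_piMr// ?(ltW p0)// ler_pdivrMr// mul1r ler_nat.
have hN : N%:R * h = p by rewrite /h mulrCA divff ?mulr1// gt_eqF.
have := step N (leqnn N); rewrite hN => sN.
apply: le_trans sN.
rewrite (@ge0_negligible_integral _ _ _ (unif p) setT (~` `]0, p]%classic))//=.
- by rewrite setTD setCK.
- by apply: measurableC; exact: measurable_itv.
- by rewrite unifE setICl measure0.
Qed.

(* On a cell of the grid the two functions differ by at most [e] plus the increment
   of [X], and the increments telescope. *)
Lemma monotone_grid_le p N e X Y : 0 < p -> (0 < N)%N ->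
  {homo X : x y / x <= y} -> {homo Y : x y / x <= y} ->
  (forall x, - K <= X x <= K) ->
  (forall j, (j <= N)%N -> `|Y (j%:R * (p / N%:R)) - X (j%:R * (p / N%:R))| <= e) ->
  (\int[unif p]_w (`|Y w - X w|)%:E <= (p * e + p / N%:R * (2 * K))%:E)%E.
Proof.
move=> p0 N0 Xnd Ynd XK XY.
pose g j := X (j%:R * (p / N%:R)).
have h0 : 0 < p / N%:R by rewrite divr_gt0// ltr0n.
have mX : measurable_fun (setT : set (measurableTypeR R)) (X : R -> measurableTypeR R).
  exact: nondecreasing_measurable.
have mY : measurable_fun (setT : set (measurableTypeR R)) (Y : R -> measurableTypeR R).
  exact: nondecreasing_measurable.
apply: (@le_trans _ _ (p * e + p / N%:R * (g N - g 0%N))%:E); last first.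
  rewrite lee_fin lerD2l ler_pM2l// /g.
  have := XK (N%:R * (p / N%:R)); have := XK (0%:R * (p / N%:R)).
  by move=> /andP[? ?] /andP[? ?]; lra.
apply: unif_integral_grid => //.
  apply/measurable_EFinP; apply: measurableT_comp => //.
  exact: measurable_funB.
move=> j w jN /andP[jw wj]; rewrite lee_fin /g.
have := XY j (ltnW jN); have := XY j.+1 jN.
have := Xnd _ _ (ltW jw); have := Xnd _ _ wj.
have := Ynd _ _ (ltW jw); have := Ynd _ _ wj.
move: (X w) (Y w) (X (j%:R * _)) (Y (j%:R * _)) (X (j.+1%:R * _)) (Y (j.+1%:R * _)) => a b c d c' d' hb1 hb2 ha1 ha2.
rewrite !ler_norml => /andP[? ?] /andP[? ?]; apply/andP; split; lra.
Qed.
End Quantile.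

(** Functions with values in [-K, K] form a compact set for pointwise convergence. The index set may
    be uncountable, where compactness need not give a convergent subsequence; a cluster point still
    promises closeness on finite sets at arbitrarily late [k]. *)
Lemma cluster_function {R : realType} (I : eqType) (K : R) (X : nat -> I -> R) :
  (forall k i, - K <= X k i <= K) ->
  exists a : I -> R, forall (s : seq I) (e : R) M, 0 < e ->
    exists2 k, (M <= k)%N & forall i, i \in s -> `|X k i - a i| < e.
Proof.
move=> XK.
pose T : I -> topologicalType := fun=> R.
have cK : compact [set f : prod_topology T | forall i, `[- K, K]%classic (f i)].
  by apply: (@tychonoff I T (fun=> `[- K, K]%classic)) => i; exact: segment_compact.
have [] := cK ((X : nat -> prod_topology T) @ \oo).
- by exists 0%N => // k _ i /=; rewrite in_itv/=; exact: XK.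
- move=> a [_ acl]; exists a => s e M e0.
have nb : nbhs (a : prod_topology T) [set f : prod_topology T | forall i, i \in s -> `|f i - a i| < e].
  elim: s => [|i s IH]; first by apply: filterE => f i; rewrite in_nil.
  have ni : nbhs (a : prod_topology T) [set f : prod_topology T | `|f i - a i| < e].
    have : nbhs (a i : R) [set x : R | `|x - a i| < e].
      by apply/nbhs_ballP; exists e => // x; rewrite /ball/= distrC.
    exact: (@proj_continuous I T i a).
  apply: filterS2 IH ni => f fs fi j; rewrite inE => /orP[/eqP ->|] //.
  exact: fs.
have XM : ((X : nat -> prod_topology T) @ \oo) [set X k | k in [set k | (M <= k)%N]].
  by exists M => // k /= Mk; exists k.
have [_ [[k Mk <-] h]] := acl _ _ XM nb.
by exists k.
Qed.

(** * Cluster points of confined sequences of measures *)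

Section Compactness.
Context {R : realType} {n : nat} (m p : 'I_n -> R) (K : R).
Hypotheses (K0 : 0 < K) (m0 : forall i, 0 < m i) (p0 : forall i, 0 < p i).

(** Monotonicity and bounds involve at most two points at a time, so the cluster function of the
    quantiles inherits them, and its image measure is the limit sought. *)
Lemma confined_family_cluster (nu : nat -> 'I_n -> borel_measure R) :
  (forall k, confined_family p K (nu k)) ->
  exists2 nubar : 'I_n -> borel_measure R, confined_family p K nubar &
    forall (e : R) M, 0 < e ->
      exists2 k, (M <= k)%N & forall i, (dist_W1 (nu k i) (nubar i) < e%:E)%E.
Proof.
move=> hnu.
have qex (ki : nat * 'I_n) : exists X : R -> R,
    [/\ {homo X : x y / x <= y}, (forall x, - K <= X x <= K) &
    forall A : set (measurableTypeR R), measurable A -> unif (p ki.2) (X @^-1` A) = nu ki.1 ki.2 A].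
  exact: (quantile_ex K0 (p0 ki.2) (hnu ki.1 ki.2)).
have [X hX] := choice qex.
(* Species and levels form one index set, so that a single [k] serves all species at once. *)
have [a acl] := @cluster_function R ('I_n * R)%type K (fun k iw => X (k, iw.1) iw.2)
  ltac:(by move=> k [i w] /=; have [_ + _] := hX (k, i)).
have andec i : {homo (fun w => a (i, w)) : x y / x <= y}.
  move=> x y xy; apply/ler_addgt0Pr => e e0.
  have [k _ hk] := acl [:: (i, x); (i, y)] (e / 2) 0%N ltac:(by rewrite divr_gt0).
  have := hk (i, x); have := hk (i, y); rewrite !inE !eqxx orbT => /(_ isT) + /(_ isT).
  have [Xnd _ _] := hX (k, i); have /= := Xnd _ _ xy.
  move: (X _ x) (X _ y) (a _) (a _) => u v b c uv.
  by rewrite !ltr_norml => /andP[? ?] /andP[? ?]; lra.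
have aK i w : - K <= a (i, w) <= K.
  have hh (e : R) : 0 < e -> - K - e <= a (i, w) <= K + e.
    move=> e0; have [k _ hk] := acl [:: (i, w)] e 0%N e0.
    have := hk (i, w); rewrite inE eqxx => /(_ isT) /=.
    have [_ + _] := hX (k, i) => /(_ w) /andP[? ?].
    by rewrite ltr_norml => /andP[? ?]; apply/andP; split; lra.
  apply/andP; split; apply/ler_addgt0Pr => e /hh /andP[? ?]; lra.
have ma i : measurable_fun (setT : set (measurableTypeR R)) (fun w => a (i, w) : measurableTypeR R).
  exact: nondecreasing_measurable.
exists (fun i => image_measure (unif (p i)) (ma i)).
  move=> i; split; rewrite /image_measure/= /pushforward unifE.
    by rewrite preimage_setT setTI lebesgue_measure_itv/= lte_fin p0 sube0.
  rewrite (_ : _ @^-1` _ = set0) ?set0I ?measure0//.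
  by apply/seteqP; split => w //=; rewrite in_itv/= aK.
move=> e M e0.
pose P := \sum_i p i + 1.
have P0 : 0 < P by rewrite ltr_wpDl// sumr_ge0// => i _; exact: ltW.
have pP i : p i <= P.
  by rewrite /P (bigD1 i)//= -addrA lerDl addr_ge0// sumr_ge0// => j _; exact: ltW.
(* The mesh [p i / N] and the tolerance [e / (4 * P)] at the grid points each contribute at most
   [e / 4] to the L^1 distance. *)
pose N := (Num.truncn (8 * K * P / e)).+1.
have NP : P / N%:R * (2 * K) < e / 4.
  have : 8 * K * P / e < N%:R by rewrite truncnS_gt.
  rewrite ltr_pdivrMr// => hN.
  by rewrite mulrAC ltr_pdivrMr ?ltr0n//; lra.
have [k Mk hk] := acl (allpairs (fun i j => (i, j%:R * (p i / N%:R))) (enum 'I_n) (iota 0 N.+1))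
   (e / (4 * P)) M ltac:(by rewrite divr_gt0// mulr_gt0).
exists k => // i; have [Xnd XK Xnu] := hX (k, i).
have mX : measurable_fun (setT : set (measurableTypeR R)) (X (k, i) : R -> measurableTypeR R).
  exact: nondecreasing_measurable.
apply: (le_lt_trans (dist_W1_image mX (ma i) Xnu _)) => //.
apply: le_lt_trans (monotone_grid_le (N := N) (e := e / (4 * P)) (p0 i) _ (andec i) Xnd (aK i) _) _ => //.
  move=> j jN; apply/ltW; apply: (hk (i, j%:R * (p i / N%:R))).
  by apply: allpairs_f; rewrite ?mem_enum// mem_iota/= ltnS.
rewrite lte_fin.
have h1 : p i * (e / (4 * P)) <= e / 4.
  by rewrite invfM !mulrA ler_pdivrMr// -mulrA mulrC ler_pM2l ?divr_gt0.
have h2 : p i / N%:R * (2 * K) <= P / N%:R * (2 * K).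
  by rewrite !ler_pM2r ?invr_gt0 ?ltr0n ?mulr_gt0.
by move: h1 h2 NP e0; clear; lra.
Qed.

(** The identity is 1-Lipschitz, so the weighted centre of mass passes to W_1 limits; confinement
    takes care of the second moments. *)
Lemma confined_in_P (E : R) (nu : 'I_n -> borel_measure R) :
  confined_family p K nu ->
  (forall e : R, 0 < e -> exists2 mu, confined_family p K mu /\ in_P m p E mu &
     forall i, (dist_W1 (mu i) (nu i) < e%:E)%E) ->
  in_P m p E nu.
Proof.
move=> hnu lim; split.
- by move=> j; case: (hnu j).
- move=> j; have c2 : continuous (fun x : R => x ^+ 2).
    by move=> x; exact: exprn_continuous.
  have /integrableP[_] := confined_integrable K0 (hnu j) c2.
  apply: le_lt_trans; rewrite le_eqVlt; apply/orP; left; apply/eqP.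
  by apply: eq_integral => x _; rewrite /= ger0_norm// sqr_ge0.
- pose S := \sum_j (m j)^-1.
  have S0 : 0 <= S by apply: sumr_ge0 => j _; rewrite invr_ge0 ltW.
  apply/eqP; rewrite -subr_eq0 -normr_le0; apply/ler_addgt0Pr => e e0; rewrite add0r.
  have d0 : 0 < e / (S + 1) by rewrite divr_gt0// ltr_wpDl.
  have [mu [hmu [_ _ <-]] cl] := lim _ d0.
  rewrite -sumrB; apply: le_trans (ler_norm_sum _ _ _) _.
  apply: (@le_trans _ _ (\sum_j (m j)^-1 * (e / (S + 1)))).
    apply: ler_sum => j _; rewrite -mulrBr normrM ger0_norm ?invr_ge0 ?(ltW (m0 j))//.
    rewrite ler_wpM2l ?invr_ge0 ?(ltW (m0 j))// distrC -[leRHS]mul1r.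
    apply: (W1_lip_close K0 (hmu j) (hnu j) (cl j)) => //.
      by move=> x; exact: cvg_id.
    by move=> x y _ _; rewrite mul1r.
  rewrite -mulr_suml mulrA ler_pdivrMr ?ltr_wpDl// -/S mulrDr mulr1 mulrC lerDl.
  exact: ltW.
Qed.
End Compactness.

Lemma subsequence_ex (Q : nat -> nat -> Prop) :
  (forall j M, exists2 k, (M <= k)%N & Q j k) ->
  exists2 l : nat -> nat, {homo l : i j / (i < j)%N} & forall j, Q j (l j).
Proof.
move=> hQ.
have [f hf] := choice (fun jM : nat * nat => let: ex_intro2 k h1 h2 := hQ jM.1 jM.2 in
   ex_intro (fun k => (jM.2 <= k)%N /\ Q jM.1 k) k (conj h1 h2)).
pose l := fix l j := if j is j'.+1 then f (j, (l j').+1) else f (0%N, 0%N).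
exists l; last by case => [|j]; [exact: (hf (_, _)).2|exact: (hf (_, _)).2].
apply: homo_ltn; first exact: ltn_trans.
by move=> i; have [] := hf (i.+1, (l i).+1).
Qed.

(** * Large times *)

Section LargeTime.
Context {R : realType} {n : nat} (m p : 'I_n -> R) (E : R) (W : R -> 'M[R]_n) (K : R).
Hypotheses (K0 : 0 < K) (m0 : forall i, 0 < m i) (p0 : forall i, 0 < p i).
Hypothesis dW : forall i j z, derivable (W_entry W i j) z 1.
Hypothesis cW' : forall i j, continuous (derive1 (W_entry W i j)).
Hypothesis W'lip : exists2 L : R, 0 <= L & forall i j x y, - (2 * K) <= x <= 2 * K ->
    - (2 * K) <= y <= 2 * K ->
    `|derive1 (W_entry W i j) x - derive1 (W_entry W i j) y| <= L * `|x - y|.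
Hypotheses (Wsym : forall i j z, W_entry W i j z = W_entry W j i z)
  (Weven : forall i j z, W_entry W i j (- z) = W_entry W i j z).

Lemma energy_bounded : exists B : R, forall nu, confined_family p K nu ->
  `|interaction_energy W nu| <= B.
Proof.
have [B B0 hB] : exists2 B : R, 0 <= B & forall i j z, - (2 * K) <= z <= 2 * K ->
    `|W_entry W i j z| <= B.
  have Bij (ij : 'I_n * 'I_n) : exists B : R, 0 <= B /\ forall z, - (2 * K) <= z <= 2 * K ->
      `|W_entry W ij.1 ij.2 z| <= B.
    have [B B0 hB] := continuous_bounded (- (2 * K)) (2 * K) (derivable_cont (@dW ij.1 ij.2)).
    by exists B.
  have [Bf hBf] := choice Bij.
  exists (\sum_ij Bf ij); first by apply: sumr_ge0 => ij _; case: (hBf ij).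
  move=> i j z zK; have [_ /(_ z zK) /= h] := hBf (i, j).
  apply: le_trans h _; rewrite (bigD1 (i, j))//= lerDl.
  by apply: sumr_ge0 => ij _; case: (hBf ij).
exists (2^-1 * \sum_i (\sum_j B * p j) * p i) => nu hnu.
rewrite energyE (mutual_energy_l K0 dW hnu hnu) normrM ger0_norm ?invr_ge0//.
rewrite ler_wpM2l ?invr_ge0//; apply: le_trans (ler_norm_sum _ _ _) _.
apply: ler_sum => i _; apply: (Rintegral_bound K0 (hnu i)).
  exact: (potential_continuous K0 dW hnu).
move=> x xK; apply: le_trans (ler_norm_sum _ _ _) _.
apply: ler_sum => j _;
apply: (Rintegral_bound K0 (hnu j)).
  apply: continuous_shift_comp; exact: derivable_cont.
by move=> y yK; apply: hB; move: xK yK => /andP[? ?] /andP[? ?]; apply/andP; split; lra.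
Qed.

Variable mu : R -> 'I_n -> borel_measure R.
Hypothesis mu_conf : forall t, 0 <= t -> confined_family p K (mu t).
Hypothesis mu_AC : AC2_loc m p E mu.
Hypothesis sol : distributional_solution m W mu.

Lemma energy_dissipation_limit :
  [/\ (exists l : R, interaction_energy W (mu t) @[t --> +oo] --> l),
      (forall t : R, 0 < t ->
         is_derive t 1 (fun t => interaction_energy W (mu t)) (- dissipation m W (mu t))) &
      dissipation m W (mu t) @[t --> +oo] --> (0 : R)].
Proof.
have [C [C0 Vb Vl Vd]] := velocity_estimates K0 m0 p0 cW' W'lip.
have confp t : 0 < t -> confined_family p K (mu t) by move=> /ltW; exact: mu_conf.
have mu_cont (t0 e : R) (t00 : 0 < t0) (e0 : 0 < e) := AC2_lip_close K0 m0 p0 mu_AC mu_conf t00 e0.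
have [A A0 hA] := energy_expansion K0 m0 p0 dW cW' C0 Vb Vl Vd confp mu_cont sol Wsym Weven.
have [B hB] := energy_bounded.
apply: (dissipative_limit (b := - B) A0 hA) => t t0.
  exact: dissipation_ge0.
by have := hB _ (confp t t0); rewrite ler_norml => /andP[].
Qed.

(** Closeness at arbitrarily late times is all that both the subsequence statement and the one on
    the limit set provide. Confinement of [nu] comes first, as it makes the continuity of the
    dissipation available. *)
Lemma cluster_steady_state (nu : 'I_n -> borel_measure R) :
  (forall i, nu i setT = (p i)%:E) ->
  (forall (e M : R), 0 < e -> exists2 t, M < t &
     forall i, (dist_W1 (mu t i) (nu i) < e%:E)%E) ->
  steady_state m p E W nu.
Proof.
move=> nup cl.
have [C [C0 Vb Vl Vd]] := velocity_estimates K0 m0 p0 cW' W'lip.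
have [C' C'0 hC'] := dissipation_close K0 m0 p0 cW' C0 Vb Vl Vd.
have [_ _ D0] := energy_dissipation_limit.
have hnu : confined_family p K nu.
  move=> i; apply: (W1_confined K0 (mu_conf (lexx 0) i) (nup i)) => e e0.
  have [t t0 ht] := cl e 0 e0; exists (mu t i) => //.
  exact: mu_conf (ltW t0) i.
split.
  apply: (confined_in_P K0 m0 hnu) => e e0.
  have [t t0 ht] := cl e 0 e0; exists (mu t) => //; split.
    exact: mu_conf (ltW t0).
  by apply: mu_AC.1; exact: ltW.
apply: (dissipation0_solution K0 m0 cW' hnu).
apply/eqP; rewrite -normr_le0; apply/ler_addgt0Pr => e e0; rewrite add0r.
(* One half of [e] pays for the passage from [mu t] to [nu], the other for the dissipation at time
   [t]; the [+ 1] covers [C' = 0]. *)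
have d0 : 0 < e / (2 * (C' + 1)) by rewrite divr_gt0// mulr_gt0// ltr_wpDl.
have [M [Mr hM]] : \forall t \near +oo, dissipation m W (mu t) < e / 2.
  by apply: (cvgr_lt _ D0); rewrite divr_gt0.
have [t Mt ht] := cl _ (Num.max M 0) d0.
move: Mt; rewrite gt_max => /andP[Mt t0].
have ct := mu_conf (ltW t0).
have fc : family_close K (e / (2 * (C' + 1))) (mu t) nu.
  by move=> i; exact: (W1_lip_close K0 (ct i) (hnu i) (ht i)).
have h1 := hC' _ _ _ (ltW d0) ct hnu fc.
have h2 := hM _ Mt.
have h3 : C' * (e / (2 * (C' + 1))) <= e / 2.
  rewrite invfM !mulrA ler_pdivrMr ?ltr_wpDl// -mulrA mulrC ler_pM2l ?divr_gt0//.
  by rewrite lerDl.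
have h4 := dissipation_ge0 W m0 (mu t).
move: h1 h2 h3 h4; move: (dissipation m W (mu t)) (dissipation m W nu) (C' * _) => a b c.
by rewrite !ler_norml => /andP[? ?] ? ? ?; apply/andP; split; lra.
Qed.

Lemma precompact_cluster (t : nat -> R) : (forall k, 0 < t k) -> t k @[k --> \oo] --> +oo ->
  exists2 l : nat -> nat, {homo l : i j / (i < j)%N} &
  exists2 mubar : 'I_n -> borel_measure R, steady_state m p E W mubar &
    forall i, dist_W1 (mu (t (l k)) i) (mubar i) @[k --> \oo] --> 0%E.
Proof.
move=> t0 toy.
have [mubar hmubar cl] := confined_family_cluster K0 p0
  (nu := fun k => mu (t k)) (fun k => mu_conf (ltW (t0 k))).
have [l l_lt hl] := @subsequence_ex
  (fun j k => forall i, (dist_W1 (mu (t k) i) (mubar i) < (j.+1%:R^-1)%:E)%E)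
  (fun j M => cl j.+1%:R^-1 M ltac:(by rewrite invr_gt0)).
exists l => //; exists mubar.
  apply: cluster_steady_state; first by move=> i; case: (hmubar i).
  move=> e M e0.
  have [N _ hN] : \forall k \near \oo, M < t k by move/cvgryPgt : toy => /(_ M).
  by have [k Nk hk] := cl e N e0; exists (t k) => //; exact: hN.
move=> i; apply: (squeeze_cvge (f := cst 0%E) (h := fun k => (k.+1%:R^-1)%:E)).
- apply: nearW => k; rewrite (ltW (hl k i)) andbT /=.
  by apply: transport_cost_ge0 => x y; exact: normr_ge0.
- exact: cvg_cst.
- by apply: cvg_EFin; [exact: nearW|exact: cvg_harmonic].
Qed.

Lemma omega_limit_steady : omega_limit m p E mu `<=` steady_state m p E W.
Proof.
move=> nu [[nup _ _] [t [_ toy tnu]]].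
apply: cluster_steady_state => // e M e0.
have far : \forall k \near \oo, M < t k by move/cvgryPgt : toy => /(_ M).
have close i : \forall k \near \oo, (dist_W1 (mu (t k) i) (nu i) < e%:E)%E.
  exact: (tnu i) _ (@nbhs_open_ereal_lt _ _ (cst e) e0).
have [k [Mk hk]] := filter_ex (filterI far (filter_forall _ close)).
by exists (t k).
Qed.
End LargeTime.

Theorem theorem3p6 (R : realType) (n : nat) (m p : 'I_n -> R) (E : R)
    (W : R -> 'M[R]_n) (mu0 : 'I_n -> borel_measure R)
    (mu : R -> 'I_n -> borel_measure R) (K : R)
    (m_gt0 : forall i, 0 < m i) (p_gt0 : forall i, 0 < p i)
    (W_adm : admissible_potential W)
    (mu0_P : in_P m p E mu0)
    (mu_sol : gradient_flow_solution m p E W mu0 mu)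
    (K_gt0 : 0 < K)
    (mu_confined : forall t, 0 <= t -> forall i,
        msupport (mu t i) `<=` `[- K, K])
    (W_lip : forall i j,
        [lipschitz derive1 (W_entry W i j) z | z in `[- (2 * K), 2 * K]]) :
  let Wt := fun t : R => interaction_energy W (mu t) in
  [/\ (exists Winf : R, Wt t @[t --> +oo] --> Winf) /\
      ((forall t, 0 < t -> derivable Wt t 1) /\
       derive1 Wt t @[t --> +oo] --> 0),
      (forall t : nat -> R, (forall k, 0 < t k) -> t k @[k --> \oo] --> +oo ->
        exists2 l : nat -> nat, {homo l : i j / (i < j)%N} &
        exists2 mubar : 'I_n -> borel_measure R,
          steady_state m p E W mubar &
          forall i, dist_W1 (mu (t (l k)) i) (mubar i) @[k --> \oo] --> 0%E) &
      omega_limit m p E mu `<=` steady_state m p E W].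
Proof.
move=> Wt.
have [Wt_sym dcW Wt_even _ _] := W_adm.
have dW i j z : derivable (W_entry W i j) z 1 by case: (dcW i j).
have cW' i j : continuous (derive1 (W_entry W i j)) by case: (dcW i j).
have Wsym i j z : W_entry W i j z = W_entry W j i z.
  by rewrite /W_entry -[in LHS]Wt_sym mxE.
have Weven i j z : W_entry W i j (- z) = W_entry W i j z by rewrite /W_entry -Wt_even.
have [AC _ sol] := mu_sol.
have mu_conf t : 0 <= t -> confined_family p K (mu t).
  move=> t0 i; have [massp _ _] := AC.1 t t0.
  exact: msupport_confined (massp i) (mu_confined t t0 i).
have W'lip : exists2 L : R, 0 <= L & forall i j x y, - (2 * K) <= x <= 2 * K ->
    - (2 * K) <= y <= 2 * K ->
    `|derive1 (W_entry W i j) x - derive1 (W_entry W i j) y| <= L * `|x - y|.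
  have Lij (ij : 'I_n * 'I_n) : exists L : R, 0 <= L /\ forall x y, - (2 * K) <= x <= 2 * K ->
    - (2 * K) <= y <= 2 * K ->
    `|derive1 (W_entry W ij.1 ij.2) x - derive1 (W_entry W ij.1 ij.2) y| <= L * `|x - y|.
    have [L [_ hL]] := W_lip ij.1 ij.2.
    (* The Lipschitz notation provides the estimate for every constant beyond some real [L]; this
       one is also nonnegative. *)
    exists (`|L| + 1); split => // x y xK yK.
    apply: (hL (`|L| + 1) _ (x, y)); first by rewrite (le_lt_trans (ler_norm L))// ltrDl.
    by split; rewrite /= in_itv.
  have [Lf hLf] := choice Lij.
  exists (\sum_ij Lf ij); first by apply: sumr_ge0 => ij _; case: (hLf ij).
  move=> i j x y xK yK; have [_ /(_ x y xK yK) /= h] := hLf (i, j).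
  apply: le_trans h _; rewrite ler_wpM2r// (bigD1 (i, j))//= lerDl.
  by apply: sumr_ge0 => ij _; case: (hLf ij).
have [lim der D0] := energy_dissipation_limit K_gt0 m_gt0 p_gt0 dW cW' W'lip Wsym Weven mu_conf AC sol.
split; last 2 first.
- exact: (precompact_cluster K_gt0 m_gt0 p_gt0 dW cW' W'lip Wsym Weven mu_conf AC sol).
- exact: (omega_limit_steady K_gt0 m_gt0 p_gt0 dW cW' W'lip Wsym Weven mu_conf AC sol).
split => //; split.
- by move=> t t0; case: (der t t0).
(* The derivative is identified with minus the dissipation at positive times only, which is enough
   for a limit at infinity. *)
- have : (- dissipation m W (mu t)) @[t --> +oo] --> (0 : R).
    by rewrite -oppr0; exact: cvgN.
  apply: cvg_trans; apply: near_eq_cvg.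
  exists 0; split => // t t0; rewrite derive1E.
  by have := der t t0 => h; rewrite [RHS]derive_val.
Qed.
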